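(* For every graph $G$, $KE(G)=KE(\mathcal{R}(G))$, where $\mathcal{R}(G)$ is the reduced form of $G$.
   Context: All graphs are finite, undirected and simple. For a graph $G$, the Gallai--Edmonds sets are: $D(G)$, the set of vertices missed by some maximum matching of $G$; $A(G)$, the set of vertices not in $D(G)$ that have a neighbor in $D(G)$; and $C(G)=V(G)\setminus(D(G)\cup A(G))$. Reduced form: let $D_1,\dots,D_k$ be the nontrivial components (those with more than one vertex) of the induced subgraph $G[D(G)]$. The graph $\mathcal{R}(G)$ is obtained from $G$ by deleting all vertices of $D_1,\dots,D_k$, adding $k$ pairwise disjoint new triangles $T_1,\dots,T_k$ (copies of $K_3$ on new vertices), choosing one vertex $t_i$ in each $T_i$, and adding all edges $t_ix$ with $x\in N_G(D_i)\cap A(G)$, for $i=1,\dots,k$; here $N_G(D_i)$ is the set of vertices having a neighbor in $D_i$. The vertices of $G$ outside $D_1,\dots,D_k$ are regarded as vertices of both $G$ and $\mathcal{R}(G)$. Let $M$ be a matching of a graph $G$. A path (or walk) is $M$-alternating if, of any two consecutive edges, exactly one belongs to $M$; an $mm$-$M$-path is an $M$-alternating path whose first and last edges are in $M$. An $M$-blossom is an odd cycle of length $2k+1$ with exactly $k$ edges in $M$; its base is the unique vertex of the cycle not covered by those $k$ edges. An $M$-Tflower consists of an $M$-blossom together with an $M$-stem, i.e. an $M$-alternating path of even length (possibly zero) connecting the base of the blossom to a vertex not saturated by $M$ in $G$, where the base is the only common vertex of the blossom and the stem. An $M$-Tposy consists of two $M$-blossoms joined by an $mm$-$M$-path whose endpoints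 are the bases of the two blossoms, such that no internal vertex of the path lies in the blossoms and the intersection of the two blossoms is either empty or an $mm$-$M$-path. Define $SD(G)$ as the set of vertices $v$ of $G$ for which there is a maximum matching $M$ of $G$ such that $v$ lies in an $M$-Tflower or an $M$-Tposy, and $KE(G)=V(G)\setminus SD(G)$. *)

(* Defs.v *)
From mathcomp Require Import all_boot.
From mathcomp Require Import boolp.

Set Implicit Arguments.
Unset Strict Implicit.
Unset Printing Implicit Defensive.

Record sgraph := SGraph {
  svertex :> finType;
  sedge : rel svertex;
  sedge_sym : symmetric sedge;
  sedge_irr : irreflexive sedge }.

Notation "x -- y" := (sedge x y) (at level 30).

Section Graph.
Variable G : sgraph.
Implicit Types (x y b v : G) (p q s c : seq G) (M : {set {set G}}).

Definition edges : {set {set G}} :=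
  [set e : {set G} | [exists x, exists y, (x -- y) && (e == [set x; y])]].

Definition matching M : bool := (M \subset edges) && trivIset M.

Definition max_matching M : bool :=
  matching M && [forall N : {set {set G}}, matching N ==> (#|N| <= #|M|)].

Definition saturated M v : bool := v \in cover M.

Definition GE_D : {set G} :=
  [set v | [exists M : {set {set G}}, max_matching M && ~~ saturated M v]].

Definition GE_A : {set G} :=
  [set v | (v \notin GE_D) && [exists u in GE_D, v -- u]].

Definition components (S : {set G}) : {set {set G}} :=
  equivalence_partition
    (connect [rel x y | [&& x \in S, y \in S & x -- y]]) S.

Definition ntcomp : {set {set G}} := [set X in components GE_D | 1 < #|X|].

(* The path with vertices x, p_0, p_1, ... is encoded by its first vertex x
   and the sequence p of the following ones; its length is size p. *)
Definition is_path x p : bool := path (@sedge G) x p && uniq (x :: p).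

Definition path_edges x p : seq {set G} := pairmap (fun y z => [set y; z]) x p.

Definition alternating M x p : bool :=
  sorted (fun e f => (e \in M) (+) (f \in M)) (path_edges x p).

Definition mm_path M x p : bool :=
  [&& is_path x p, alternating M x p, p != [::],
      head set0 (path_edges x p) \in M & last set0 (path_edges x p) \in M].

(* A cycle is encoded by the cyclic sequence c of its vertices. *)
Definition is_cycle c : bool := ucycleb (@sedge G) c && (2 < size c).

Definition cycle_edges c : {set {set G}} := [set [set x; next c x] | x in c].

Definition blossom M c : bool :=
  [&& is_cycle c, odd (size c) & #|cycle_edges c :&: M| == (size c)./2].

Definition base M c b : bool :=
  (b \in c) && (b \notin cover (cycle_edges c :&: M)).

Definition stem M b s : bool :=
  [&& is_path b s, alternating M b s, ~~ odd (size s)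
    & ~~ saturated M (last b s)].

Definition Tflower M c b s : Prop :=
  [/\ blossom M c, base M c b, stem M b s
    & forall x, (x \in c) && (x \in b :: s) = (x == b)].

(* The intersection of two cycles is taken as an intersection of subgraphs. *)
Definition cap_mm_path M c1 c2 : Prop :=
  exists y q,
    [/\ mm_path M y q,
        forall x, (x \in c1) && (x \in c2) = (x \in y :: q)
      & cycle_edges c1 :&: cycle_edges c2 = [set e in path_edges y q]].

(* behead (belast b p) lists the internal vertices of the path b :: p *)
Definition Tposy M c1 c2 b p : Prop :=
  [/\ blossom M c1 /\ base M c1 b,
      blossom M c2 /\ base M c2 (last b p),
      mm_path M b p,
      {in behead (belast b p), forall x, x \notin c1 /\ x \notin c2}
    & [disjoint c1 & c2] \/ cap_mm_path M c1 c2].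

Definition in_Tflower M v : Prop :=
  exists c b s, Tflower M c b s /\ v \in c ++ b :: s.

Definition in_Tposy M v : Prop :=
  exists c1 c2 b p, Tposy M c1 c2 b p /\ v \in c1 ++ c2 ++ b :: p.

Definition SD : {set G} :=
  [set v | `[< exists M, max_matching M /\ (in_Tflower M v \/ in_Tposy M v) >]].

Definition KE : {set G} := ~: SD.

End Graph.

Arguments edges : clear implicits.
Arguments GE_D : clear implicits.
Arguments GE_A : clear implicits.
Arguments ntcomp : clear implicits.
Arguments SD : clear implicits.
Arguments KE : clear implicits.

(* The reduced form; (X, i), for i : 'I_3, are the vertices of the triangle
   replacing the component X, and (X, t X) is the one attached to A(G). *)
Section Reduced.
Variable G : sgraph.

Definition kept := {v : G | v \notin cover (ntcomp G)}.
Definition comp_index := {X : {set G} | X \in ntcomp G}.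

Variable t : comp_index -> 'I_3.

Definition red_vertex : finType := (kept + comp_index * 'I_3)%type.

Definition attached (u : kept) (z : comp_index * 'I_3) : bool :=
  [&& z.2 == t z.1, val u \in GE_A G & [exists y in val z.1, val u -- y]].

Definition red_edge (a b : red_vertex) : bool :=
  match a, b with
  | inl u, inl v => val u -- val v
  | inl u, inr z => attached u z
  | inr z, inl u => attached u z
  | inr z, inr w => (z.1 == w.1) && (z.2 != w.2)
  end.

Lemma red_edge_sym : symmetric red_edge.
Proof.
case=> [u|z] [v|w] //=; first exact: sedge_sym.
by rewrite eq_sym [z.2 == _]eq_sym.
Qed.

Lemma red_edge_irr : irreflexive red_edge.
Proof. by case=> [u|z] /=; rewrite ?sedge_irr // !eqxx. Qed.

Definition reduced : sgraph := SGraph red_edge_sym red_edge_irr.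

(* V(G) and V(R(G)) both live in the disjoint union of V(G) and the new
   vertices, where they share the vertices outside the nontrivial components. *)
Definition old_vertex (v : G) : G + comp_index * 'I_3 := inl v.

Definition new_vertex (a : reduced) : G + comp_index * 'I_3 :=
  match (a : red_vertex) with inl u => inl (val u) | inr z => inr z end.

End Reduced.

(* Main.v *)
(* Fix a maximum matching M, viewed as an involution m fixing the exposed
   vertices. Let F be the least set that contains the exposed vertices and, with
   x, also m y for every neighbor y of x; let Z be the set of vertices of F having
   a neighbor in F.

   Propagating F along alternating walks shows that an M-flower is contained in
   Z, and that an M-posy is either contained in Z or disjoint from both F and its
   neighborhood. Conversely every vertex of Z lies in a flower or a posy of some
   maximum matching: starting from a set W of exposed vertices, one finds a
   structure S attached to W (an alternating path whose ends are neighbors of W or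
   bases of blossoms), contracts it into W, and proceeds by induction. What is
   found later becomes an ear on S, and either S already extends the ear to a
   larger structure, or the ear and a part of S close an alternating cycle that is
   switched first.

   By Gallai-Edmonds theory a maximum matching restricts to each nontrivial
   component of D(G) with exactly one defect, so maximum matchings of G and of
   R(G) correspond to each other and agree on the common vertices; F and Z then
   agree there too. The components and the triangles lie in Z, hence in SD, and a
   posy disjoint from F only uses common vertices, so it belongs to both graphs. *)

Require Import Defs.
From mathcomp Require Import all_boot.
From mathcomp Require Import zify boolp.

Set Implicit Arguments.
Unset Strict Implicit.
Unset Printing Implicit Defensive.

(** * Components of the union of two matchings *)

(** A vertex of Z is only known to lie on an alternating walk with both ends at exposed vertices,
    and such a walk may repeat vertices, whereas flowers and posies are built from paths. An ear
    that runs along with the structure it meets can be spliced in; one that runs against it cannot,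
    but then it closes an alternating cycle with it, and after switching that cycle it can. This is
    why [hits] lets the matching vary. A switch never touches the contracted set [W], which contains
    the exposed vertices, so the matching stays maximum and whatever was contracted earlier
    survives. An alternating walk is stored as a list with one end of each of its matching edges.
    Traversing it backwards means reversing the list and applying [m], and disjointness of pieces
    becomes a statement about multiplicities in one list. A triangle is the smallest factor-critical
    graph with more than one vertex. Factor-criticality allows a matching that uses one vertex of a
    component to be completed inside it, and the odd cycle makes every vertex of the triangle
    reachable. *)

Section AlternatingOrbit.
Variables (T : finType) (m n : T -> T) (d : T).
Hypotheses (mK : involutive m) (nK : involutive n) (nd : n d = d).

Let f := n \o m.

Let f_inj : injective f.
Proof. exact: inj_comp (inv_inj nK) (inv_inj mK). Qed.

Let f_iter_inj i : injective (iter i f).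
Proof. by elim: i => [|i IH] x y //= /f_inj /IH. Qed.

Let fmf x : f (m (f x)) = m x.
Proof. by rewrite /f /= mK nK. Qed.

Let fm_iter i : iter i.+1 f (m (iter i f d)) = d.
Proof.
elim: i => [|i IH]; first by rewrite /= /f /= mK nd.
by rewrite iterSr iterS fmf.
Qed.

Let fn_iter i : iter i f (n (iter i f d)) = d.
Proof.
case: i => [|i] //; rewrite -[RHS](fm_iter i) !iterS {2}/f /=.
by rewrite /f /= nK.
Qed.

Let L := order f d.

Let iter_mod k : iter k f d = iter (k %% L) f d.
Proof.
rewrite {1}(divn_eq k L) addnC iterD; congr (iter _ _ _).
elim: (k %/ L) => // q IH; rewrite mulSn iterD IH.
exact: iter_order.
Qed.

Let iter_fix k : k < L.*2 -> iter k f d = d -> k = 0 \/ k = L.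
Proof.
move=> kL; rewrite iter_mod => E.
have := findex_iter (ltn_pmod k (order_gt0 f d)).
rewrite -/L E findex0 => /esym/eqP kd.
have /dvdnP[q kq] : L %| k by rewrite /dvdn.
move: kL; rewrite kq -mul2n ltn_mul2r => /andP[_].
by case: q {kq} => [|[|]] // _; [left | right; rewrite mul1n].
Qed.

(** Because [n] fixes [d], the orbit under [n \o m] alone is already closed under [m] and under [n]:
    it is the component of [d] in the union of the two matchings, a path with end [d]. *)
Definition alt_orbit : {set T} := [set x | fconnect f d x].

Lemma alt_orbitP x : reflect (exists2 i, i < L & x = iter i f d) (x \in alt_orbit).
Proof.
rewrite inE; apply: (iffP idP) => [dx | [i _ ->]]; last exact: fconnect_iter.
exists (findex f d x); first exact: findex_max.
by rewrite iter_findex.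
Qed.

Lemma alt_orbit_m x : x \in alt_orbit -> m x \in alt_orbit.
Proof.
move/alt_orbitP => [i _ ->]; rewrite inE.
have := fconnect_iter f i.+1 (m (iter i f d)).
by rewrite fm_iter fconnect_sym.
Qed.

Lemma alt_orbit_n x : x \in alt_orbit -> n x \in alt_orbit.
Proof.
move=> xP; rewrite -[x]mK; have := alt_orbit_m xP; rewrite !inE => mx.
exact: connect_trans mx (fconnect1 f _).
Qed.

Lemma alt_orbit_d : d \in alt_orbit.
Proof. by rewrite inE. Qed.

(* On the orbit, identified with Z/L, n acts as i |-> -i and m as i |-> -i-1. *)
Lemma alt_orbit_ends :
  (exists2 e, e \in alt_orbit /\ m e = e &
     forall x, x \in alt_orbit -> (m x = x -> x = e) /\ (n x = x -> x = d))
  \/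
  (exists2 w, [/\ w \in alt_orbit, n w = w & w <> d] &
     forall x, x \in alt_orbit -> m x <> x /\ (n x = x -> x = d \/ x = w)).
Proof.
have mfix i : i < L -> m (iter i f d) = iter i f d -> i.*2.+1 = L.
  move=> iL E; have := fm_iter i; rewrite E -iterD addSn addnn => /iter_fix.
  by case; rewrite // -doubleS leq_double.
have nfix i : i < L -> n (iter i f d) = iter i f d -> i = 0 \/ i.*2 = L.
  move=> iL E; have := fn_iter i; rewrite E -iterD addnn => /iter_fix.
  rewrite ltn_double => /(_ iL)[/eqP|]; last by right.
  by rewrite double_eq0 => /eqP; left.
have Lgt0 : 0 < L := order_gt0 f d.
have iterL : iter L f d = d := iter_order f_inj d.
(* Modulo L, the equation i = -i-1 has one solution for odd L and none for even L, while i = -i has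
   the solution 0 and, for even L, also L/2. The parity thus decides which matching misses the other
   end of the path. *)
have [Lodd | Leven] := boolP (odd L).
  left; have EL : (L./2).*2.+1 = L by lia.
  exists (iter L./2 f d).
    split; first by apply/alt_orbitP; exists L./2 => //; lia.
    have := fm_iter L./2.
    rewrite -{2}iterL -{3}EL -addnn -addSn iterD.
    by move/f_iter_inj.
  move=> x /alt_orbitP[i iL ->]; split=> [/(mfix _ iL)|/(nfix _ iL)].
    by move=> E; congr (iter _ _ _); lia.
  by case=> [-> | E] //; lia.
right; have EL : (L./2).*2 = L by lia.
have L2 : L./2 < L by lia.
exists (iter L./2 f d).
  split; first by apply/alt_orbitP; exists L./2.
    have := fn_iter L./2; rewrite -{2}iterL -{3}EL -addnn iterD.
    by move/f_iter_inj.
  move=> E; have L2' : L./2 < L.*2 by lia.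
  by case: (iter_fix L2' E) => E'; lia.
move=> x /alt_orbitP[i iL ->]; split=> [/(mfix _ iL)|/(nfix _ iL)]; first lia.
by case=> [-> | E]; [left | right; congr (iter _ _ _); lia].
Qed.

End AlternatingOrbit.

(** * Matchings as involutions, and exchanging them on unions of components *)

Definition exposed (T : finType) (m : T -> T) : {set T} := [set x | m x == x].

Definition switch (T : finType) (P : {set T}) (n m : T -> T) x :=
  if x \in P then n x else m x.

Section Mates.
Variable G : sgraph.
Implicit Types (x y z : G) (m n : G -> G) (S P : {set G}).

(* A matching, given as the involution exchanging the ends of its edges and
   fixing the exposed vertices. *)
Definition is_mate m : Prop :=
  involutive m /\ forall x, m x != x -> x -- m x.

Definition mate_on S m : Prop :=
  is_mate m /\ forall x, x \notin S -> m x = x.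

(** A maximum matching of the subgraph induced by [S]. Vertices outside [S] count as exposed: for
    fixed [S] this adds a constant, and it makes the counts for [S] and for [S :\ a] directly
    comparable. *)
Definition opt_on S m : Prop :=
  mate_on S m /\ forall n, mate_on S n -> #|exposed m| <= #|exposed n|.

Lemma exposedP m x : reflect (m x = x) (x \in exposed m).
Proof. by rewrite inE; apply: eqP. Qed.

Lemma switch_mate S m n P : mate_on S m -> mate_on S n ->
  (forall x, x \in P -> m x \in P) -> (forall x, x \in P -> n x \in P) ->
  mate_on S (switch P n m).
Proof.
move=> [[mK em] Sm] [[nK en] Sn] Pm Pn; split; last first.
  by move=> x xS; rewrite /switch Sm ?Sn // if_same.
have mP x : (m x \in P) = (x \in P).
  by apply/idP/idP => [/Pm|/Pm//]; rewrite mK.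
split=> x; rewrite /switch; case: (boolP (x \in P)) => xP.
- by rewrite Pn // nK.
- by rewrite mP (negPf xP) mK.
- exact: en.
- exact: em.
Qed.

Lemma exposed_switch P m n :
  exposed (switch P n m) = (exposed n :&: P) :|: (exposed m :\: P).
Proof. by apply/setP => x; rewrite !inE /switch; case: (x \in P); rewrite ?andbT ?andbF ?orbF. Qed.

Lemma card_exposed_switch P m n :
  #|exposed (switch P n m)| + #|exposed m :&: P| = #|exposed n :&: P| + #|exposed m|.
Proof.
rewrite exposed_switch cardsU.
have -> : exposed n :&: P :&: (exposed m :\: P) = set0.
  by apply/setP => x; rewrite !inE; case: (x \in P); rewrite ?andbF.
by rewrite cards0 -(cardsID P (exposed m)); lia.
Qed.

Definition rejoin m x y z :=
  if z == x then y else if z == y then x else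
  if (z == m x) || (z == m y) then z else m z.

Lemma rejoin_mate S m x y : mate_on S m -> x \in S -> y \in S -> x -- y ->
  mate_on S (rejoin m x y).
Proof.
move=> [[mK em] Sm] xS yS xy.
have nxy : x != y by apply: contraTneq xy => ->; rewrite sedge_irr.
split; last first.
  move=> z zS; rewrite /rejoin.
  case: eqP => [E|_]; first by rewrite E xS in zS.
  case: eqP => [E|_]; first by rewrite E yS in zS.
  by rewrite (Sm z zS) if_same.
split=> z; rewrite /rejoin.
  case: (z =P x) => [->|zx]; first by rewrite eq_sym (negPf nxy) eqxx.
  case: (z =P y) => [->|zy]; first by rewrite eqxx.
  case: (boolP ((z == m x) || (z == m y))) => [E|]; first by rewrite (introF eqP zx) (introF eqP zy) E.
  rewrite negb_or => /andP[zmx zmy].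
  rewrite (can2_eq mK mK) (negPf zmx) (can2_eq mK mK) (negPf zmy).
  by rewrite !(inj_eq (inv_inj mK)) (introF eqP zx) (introF eqP zy) mK.
case: (z =P x) => [-> //|zx]; case: (z =P y) => [-> _|zy]; first by rewrite sedge_sym.
by case: ifP => _; [rewrite eqxx | apply: em].
Qed.

Lemma exposed_rejoin m x y : is_mate m -> x != y ->
  exposed (rejoin m x y) = ((exposed m :|: [set m x; m y]) :\: [set x; y]).
Proof.
move=> [mK _] nxy; apply/setP => z; rewrite !inE /rejoin.
case: (z =P x) => [->|_]; first by rewrite eq_sym (negPf nxy).
case: (z =P y) => [->|_]; first by rewrite (negPf nxy).
by case: ifP; rewrite ?eqxx ?orbT ?orbF.
Qed.

Definition detach m x z := if (z == x) || (z == m x) then z else m z.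

Lemma detach_mate S m x : mate_on S m -> mate_on (S :\ x) (detach m x).
Proof.
move=> [[mK em] Sm]; split; last first.
  move=> z; rewrite !inE negb_and negbK /detach.
  by case: eqP => //= _ zS; rewrite (Sm z zS) if_same.
split=> z; rewrite /detach.
  case: (boolP ((z == x) || (z == m x))) => [-> //|]; rewrite negb_or => /andP[zx zmx].
  by rewrite (can2_eq mK mK) (negPf zmx) (inj_eq (inv_inj mK)) (negPf zx) mK.
by case: ifP => _; [rewrite eqxx | apply: em].
Qed.

Lemma exposed_detach m x :
  exposed (detach m x) = exposed m :|: [set x; m x].
Proof.
by apply/setP => z; rewrite !inE /detach; case: ifP; rewrite ?eqxx ?orbT ?orbF.
Qed.

Lemma mate_onS S S' m : S \subset S' -> mate_on S m -> mate_on S' m.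
Proof.
move=> sS [mm Sm]; split=> // x xS; apply: Sm.
by apply: contra xS; apply: (subsetP sS).
Qed.

Definition missable S x : Prop := x \in S /\ exists2 m, opt_on S m & m x = x.

Lemma opt_same S m n : opt_on S m -> mate_on S n ->
  #|exposed n| <= #|exposed m| -> opt_on S n.
Proof.
by move=> [Sm om] Sn le; split=> // p /om; apply: leq_trans.
Qed.

(** The component of [d] cannot have both ends exposed by [n] and none by [m], since switching [n]
    to [m] on it would expose two vertices fewer. *)
Lemma opt_orbit_ends S m n d : opt_on S m -> opt_on S n -> n d = d ->
  let P := alt_orbit m n d in
  exists2 e, e \in P /\ m e = e &
    forall x, x \in P -> (m x = x -> x = e) /\ (n x = x -> x = d).
Proof.
move=> om on nd P; have [[[mK _] _] _] := om; have [[[nK _] _] _] := on.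
have Pm x : x \in P -> m x \in P := @alt_orbit_m _ m n d mK nK nd x.
have Pn x : x \in P -> n x \in P := @alt_orbit_n _ m n d mK nK nd x.
have dP : d \in P := alt_orbit_d m n d.
have := alt_orbit_ends mK nK nd; rewrite -/P.
clearbody P => -[[e [eP me] H] | [w [wP nw wd] H]]; first by exists e.
have := switch_mate on.1 om.1 Pn Pm => /on.2.
have := card_exposed_switch P n m.
have -> : exposed m :&: P = set0.
  by apply/setP => x; rewrite !inE; case: eqP => //= mx; apply/negP => xP; case: (H x xP).
have : [set d; w] \subset exposed n :&: P.
  by apply/subsetP => x; rewrite !inE => /orP[]/eqP->; rewrite ?nd ?nw ?eqxx.
move/subset_leq_card; rewrite cards2 eq_sym; move/eqP/negPf: wd => -> /=.
by rewrite cards0; lia.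
Qed.

(** An optimal matching can be modified to miss a given missable [d] at the price of covering only
    one vertex [e] that it missed before. *)
Lemma opt_switch S m n d : opt_on S m -> opt_on S n -> n d = d ->
  let P := alt_orbit m n d in
  exists e, [/\ m e = e, opt_on S (switch P n m),
    switch P n m d = d &
    forall x, m x = x -> x <> e -> switch P n m x = x].
Proof.
move=> om on nd P; have [[[mK _] _] _] := om; have [[[nK _] _] _] := on.
have Pm x : x \in P -> m x \in P := @alt_orbit_m _ m n d mK nK nd x.
have Pn x : x \in P -> n x \in P := @alt_orbit_n _ m n d mK nK nd x.
have dP : d \in P := alt_orbit_d m n d.
have [e [eP me] H] := opt_orbit_ends om on nd; rewrite -/P in eP H.
clearbody P.
have En : exposed n :&: P = [set d].
  apply/setP => x; rewrite !inE; apply/andP/eqP => [[/eqP nx xP]|->]; first exact: (H x xP).2.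
  by rewrite nd eqxx.
have Em : exposed m :&: P = [set e].
  apply/setP => x; rewrite !inE; apply/andP/eqP => [[/eqP nx xP]|->]; first exact: (H x xP).1.
  by rewrite me eqxx.
exists e; split=> //.
- apply: opt_same om (switch_mate om.1 on.1 Pm Pn) _.
  by have := card_exposed_switch P m n; rewrite En Em !cards1; lia.
- by rewrite /switch dP.
move=> x mx xe; rewrite /switch; case: ifP => // xP.
by case: xe; apply: (H x xP).1.
Qed.

Lemma opt_edge S m x y : opt_on S m -> x \in S -> y \in S -> x -- y ->
  m x = x -> m y <> y.
Proof.
move=> om xS yS xy mx my.
have nxy : x != y by apply: contraTneq xy => ->; rewrite sedge_irr.
have := om.2 _ (rejoin_mate om.1 xS yS xy).
rewrite (exposed_rejoin om.1.1 nxy) mx my cardsD.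
have E : [set x; y] \subset exposed m.
  by apply/subsetP => z; rewrite !inE => /orP[]/eqP->; apply/eqP.
rewrite (setUidPl E) (setIidPr E) cards2 nxy.
by have := subset_leq_card E; rewrite cards2 nxy; lia.
Qed.

(** The exchange step of Gallai's lemma: make an optimal matching that misses [x] and [y] also miss
    [z]. Only one of [x] and [y] can become covered, so [z] is missed together with the other
    one. *)
Lemma missable_trans S x y z : missable S z ->
  (forall m, opt_on S m -> m x = x -> m z <> z) ->
  (forall m, opt_on S m -> m z = z -> m y <> y) ->
  x <> y -> (forall m, opt_on S m -> m x = x -> m y <> y).
Proof.
move=> [zS [n on nz]] xz zy xy m om mx my.
have [e [_ om' m'z m'x]] := opt_switch om on nz.
have [ex|ex] := eqVneq x e; last by case: (xz _ om' _ m'z); apply: m'x => //; apply/eqP.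
by case: (zy _ om' m'z); apply: m'x => //; rewrite -ex => /esym.
Qed.

End Mates.

(** * Matchings as sets of edges and as involutions *)

Lemma card_exposed_odd (T : finType) (m : T -> T) : involutive m ->
  odd #|exposed m| = odd #|T|.
Proof.
(* [U] selects one vertex, the one of smaller rank, from each pair exchanged by [m]. *)
move=> mK; pose U := [set x | enum_rank x < enum_rank (m x)].
suff -> : #|T| = #|exposed m| + #|U|.*2 by rewrite oddD odd_double addbF.
rewrite -cardsT -(cardsID (exposed m) setT) setTI; congr (_ + _).
rewrite -addnn -{2}(card_imset U (inv_inj mK)) -(cardsID U (_ :\: _)); congr (_ + _).
  apply: eq_card => x; rewrite !inE andbT andbC.
  by case: ltnP => //= lx; apply/negP => /eqP E; rewrite E ltnn in lx.
apply: eq_card => x; rewrite -[x]mK mem_imset; last exact: inv_inj.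
rewrite !inE !mK andbT -leqNgt eq_sym ltn_neqAle andbC; congr (_ && _).
by rewrite (inj_eq (@ord_inj _)) (inj_eq (@enum_rank_inj _)) eq_sym.
Qed.

Section MateSets.
Variable G : sgraph.
Implicit Types (x y z : G) (m n : G -> G) (M : {set {set G}}).

Definition mate_of M x : G :=
  if [pick y | (x != y) && ([set x; y] \in M)] is Some y then y else x.

Definition edge_set m : {set {set G}} := [set [set x; m x] | x in ~: exposed m].

Lemma edgesP (e : {set G}) :
  reflect (exists x y, x -- y /\ e = [set x; y]) (e \in edges G).
Proof.
rewrite inE; apply: (iffP existsP) => [[x /existsP[y /andP[xy /eqP->]]]|[x [y [xy ->]]]].
  by exists x, y.
by exists x; apply/existsP; exists y; rewrite xy eqxx.
Qed.

Lemma set2_in_edges x y : ([set x; y] \in edges G) = (x -- y).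
Proof.
apply/edgesP/idP => [[u [v [uv E]]]|xy]; last by exists x, y.
have : x \in [set u; v] by rewrite -E set21.
have : y \in [set u; v] by rewrite -E set22.
have : u \in [set x; y] by rewrite E set21.
have : v \in [set x; y] by rewrite E set22.
have nuv : u != v by apply: contraTneq uv => ->; rewrite sedge_irr.
rewrite !inE => /orP[]/eqP ? /orP[]/eqP ?; subst; rewrite ?eqxx ?uv // in nuv *.
by rewrite sedge_sym.
Qed.

Lemma matching_edge M x y : matching M -> [set x; y] \in M -> x -- y.
Proof. by move=> /andP[/subsetP ME _] /ME; rewrite set2_in_edges. Qed.

Lemma matching_inj M x y z : matching M ->
  [set x; y] \in M -> [set x; z] \in M -> y = z.
Proof.
move=> mM xy xz; have /andP[_ /trivIsetP tM] := mM.
have E : [set x; y] = [set x; z].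
  apply/eqP/contraT => nE; have := tM _ _ xy xz nE.
  by rewrite -setI_eq0 => /eqP/setP/(_ x); rewrite !inE eqxx.
have := matching_edge mM xy.
have : y \in [set x; z] by rewrite -E set22.
by rewrite !inE => /orP[]/eqP-> //; rewrite sedge_irr.
Qed.

Lemma mate_ofP M x y : matching M -> x != y ->
  ([set x; y] \in M) = (mate_of M x == y).
Proof.
move=> mM nxy; rewrite /mate_of; case: pickP => [z /andP[nxz xz]|H].
  by apply/idP/eqP => [xy|<- //]; apply: matching_inj mM xz xy.
by have := H y; rewrite nxy (negPf nxy).
Qed.

Lemma mate_of_in M x : matching M -> mate_of M x != x -> [set x; mate_of M x] \in M.
Proof. by move=> mM nx; rewrite mate_ofP // eq_sym. Qed.

Lemma mate_of_mate M : matching M -> is_mate (mate_of M).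
Proof.
move=> mM; split=> x; last by move=> /(mate_of_in mM); apply: matching_edge.
have [E|nx] := eqVneq (mate_of M x) x; first by rewrite !E.
by apply/eqP; rewrite -mate_ofP // setUC mate_of_in.
Qed.

Lemma exposed_mate_of M : matching M -> exposed (mate_of M) = ~: cover M.
Proof.
move=> mM; apply/setP => x; rewrite !inE; apply/eqP/idP => [mx|].
  apply/negP => /bigcupP[e eM xe]; have /andP[/subsetP/(_ e eM)] := mM.
  move=> /edgesP[u [v [uv E]]] _; move: xe eM; rewrite {}E.
  have nuv : u != v by apply: contraTneq uv => ->; rewrite sedge_irr.
  rewrite !inE => /orP[]/eqP E; subst; first by rewrite mate_ofP // mx (negPf nuv).
  by rewrite eq_sym in nuv; rewrite setUC mate_ofP // mx (negPf nuv).
apply: contraNeq => nx; apply/bigcupP; exists [set x; mate_of M x].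
  exact: mate_of_in.
by rewrite set21.
Qed.

Lemma edge_set_in m x y : is_mate m -> ([set x; y] \in edge_set m) = (m x == y) && (x != y).
Proof.
move=> [mK _]; apply/imsetP/andP => [[z]|[/eqP <- nx]].
  rewrite !inE => nz E.
  have zE : z \in [set x; y] by rewrite E set21.
  have mzE : m z \in [set x; y] by rewrite E set22.
  move: zE mzE; rewrite !inE => /orP[]/eqP zE /orP[]/eqP mE.
  - by rewrite mE zE eqxx in nz.
  - by rewrite -mE -zE; split=> //; rewrite eq_sym.
  - by rewrite -mE -zE mK.
  - by rewrite mE zE eqxx in nz.
exists x => //; by rewrite !inE eq_sym.
Qed.

Lemma edge_set_matching m : is_mate m -> matching (edge_set m).
Proof.
move=> mm; have [mK em] := mm; apply/andP; split.
  apply/subsetP => e /imsetP[x]; rewrite inE inE => nx ->.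
  by rewrite set2_in_edges em.
apply/trivIsetP => _ _ /imsetP[x _ ->] /imsetP[y _ ->] nE.
rewrite -setI_eq0; apply: contraR nE => /set0Pn[z].
rewrite !inE => /andP[/orP[]/eqP-> /orP[]/eqP E].
- by rewrite E.
- by rewrite E mK setUC.
- by rewrite -E mK setUC.
- by rewrite (inv_inj mK E).
Qed.

Lemma edge_setK m : is_mate m -> mate_of (edge_set m) =1 m.
Proof.
move=> mm x; have mM := edge_set_matching mm.
have [E|nx] := eqVneq (m x) x; last first.
  by apply/eqP; rewrite -mate_ofP ?edge_set_in ?eqxx // eq_sym.
apply/eqP/contraT => nx; rewrite E in nx.
by have := mate_of_in mM nx; rewrite edge_set_in // E eq_sym (negPf nx).
Qed.

Lemma card_matching M : matching M -> #|M|.*2 + #|exposed (mate_of M)| = #|G|.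
Proof.
move=> mM; have /andP[/subsetP ME tM] := mM.
rewrite exposed_mate_of // -(cardsC (cover M)); congr (_ + _).
rewrite -(eqP tM) -mul2n mulnC -sum_nat_const; apply: eq_bigr => e /ME/edgesP[x [y [xy ->]]].
by rewrite cards2; case: eqP xy => // ->; rewrite sedge_irr.
Qed.

Lemma mate_onT m : is_mate m -> mate_on [set: G] m.
Proof. by move=> mm; split=> // x; rewrite inE. Qed.

Lemma max_opt M : max_matching M -> opt_on [set: G] (mate_of M).
Proof.
move=> /andP[mM /forallP maxM]; split; first exact/mate_onT/mate_of_mate.
move=> n [mn _]; have := maxM (edge_set n); rewrite edge_set_matching // implyTb.
have := card_matching mM; have := card_matching (edge_set_matching mn).
have -> : exposed (mate_of (edge_set n)) = exposed n.
  by apply/setP => x; rewrite !inE edge_setK.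
lia.
Qed.

Lemma opt_max m : opt_on [set: G] m -> max_matching (edge_set m).
Proof.
move=> [[mm _] om]; apply/andP; split; first exact: edge_set_matching.
apply/forallP => N; apply/implyP => mN.
have := om _ (mate_onT (mate_of_mate mN)).
have := card_matching mN; have := card_matching (edge_set_matching mm).
have -> : exposed (mate_of (edge_set m)) = exposed m.
  by apply/setP => x; rewrite !inE edge_setK.
lia.
Qed.

Lemma opt_exists : exists m, opt_on [set: G] m.
Proof.
have m0 : matching (set0 : {set {set G}}).
  by apply/andP; split; [apply: sub0set | apply/trivIsetP => A B; rewrite inE].
case: (arg_maxnP (fun N : {set {set G}} => #|N|) m0) => M mM maxM; exists (mate_of M).
by apply: max_opt; rewrite /max_matching mM; apply/forallP => N; apply/implyP/maxM.
Qed.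

Lemma GE_DP x : reflect (missable [set: G] x) (x \in GE_D G).
Proof.
rewrite inE; apply: (iffP existsP) => [[M /andP[maxM nx]]|[_ [m om mx]]].
  split; first by rewrite inE.
  exists (mate_of M); first exact: max_opt.
  have /andP[mM _] := maxM.
  by apply/exposedP; rewrite exposed_mate_of // inE.
exists (edge_set m); rewrite opt_max //=.
have mM := edge_set_matching om.1.1.
by move/setP/(_ x): (exposed_mate_of mM); rewrite !inE edge_setK ?mx ?eqxx //; exact: om.1.1.
Qed.

End MateSets.

(** * Gallai-Edmonds structure *)

Section GallaiEdmonds.
Variable G : sgraph.
Implicit Types (x y z a u : G) (m n : G -> G) (S : {set G}).

(** Detaching exposes [a] and its mate. No matching on [S :\ a] does better: it misses [a], so it is
    not optimal on [S], and by parity it then exposes at least two vertices more than [m]. *)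
Lemma detach_opt S a m : a \in S -> ~ missable S a -> opt_on S m ->
  opt_on (S :\ a) (detach m a) /\
  #|exposed (detach m a)| = #|exposed m| + 2.
Proof.
move=> aS na om; have ma : m a != a by apply/eqP => ma; apply: na; split=> //; exists m.
have [mK _] := om.1.1.
have E : #|exposed (detach m a)| = #|exposed m| + 2.
  rewrite exposed_detach cardsU cards2 eq_sym ma.
  suff -> : exposed m :&: [set a; m a] = set0 by rewrite cards0 subn0.
  apply/setP => x; rewrite !inE; apply/negP => /andP[mx /orP[]/eqP E].
    by rewrite -E mx in ma.
  by rewrite E mK eq_sym (negPf ma) in mx.
split=> //; split; first exact: detach_mate om.1.
move=> n Sn; have Sn' : mate_on S n := mate_onS (subsetDl _ _) Sn.
have := card_exposed_odd Sn.1.1; rewrite -(card_exposed_odd mK).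
have := om.2 _ Sn'; rewrite leq_eqVlt => /orP[/eqP En|]; last by rewrite E; lia.
case: na; split=> //; exists n; last by apply: Sn.2; rewrite !inE eqxx.
by apply: opt_same om Sn' _; rewrite En.
Qed.

(* The stability lemma of Gallai-Edmonds theory. *)
Lemma missable_detach S a u : a \in S -> ~ missable S a -> missable S u -> a -- u ->
  forall x, missable (S :\ a) x <-> missable S x.
Proof.
move=> aS na [uS [m om mu]] au x; split=> [[xS [n on nx]]|[xS [p op px]]]; last first.
  have xa : x != a by apply: contra_not_neq na => <-; split=> //; exists p.
  split; first by rewrite !inE xa.
  exists (detach p a); first exact: (detach_opt aS na op).1.
  by rewrite /detach px if_same.
move: xS; rewrite !inE => /andP[xa xS].
apply: contrapT => nx'.
have na' : n a = a by apply: on.1.2; rewrite !inE eqxx.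
have Sn : mate_on S n := mate_onS (subsetDl _ _) on.1.
have [mK _] := om.1.1; have [nK _] := on.1.1.
have [od Ed] := detach_opt aS na om.
have En : #|exposed n| = #|exposed m| + 2.
  by apply/eqP; rewrite -Ed eqn_leq on.2 ?od.2 //; [exact: on.1 | exact: od.1].
have Pm z : z \in alt_orbit m n x -> m z \in alt_orbit m n x by exact: alt_orbit_m.
have Pn z : z \in alt_orbit m n x -> n z \in alt_orbit m n x by exact: alt_orbit_n.
have xP := alt_orbit_d m n x.
have := alt_orbit_ends mK nK nx.
move: (alt_orbit m n x) Pm Pn xP => P Pm Pn xP.
have cmn := card_exposed_switch P m n; have cnm := card_exposed_switch P n m.
have Smn := switch_mate om.1 Sn Pm Pn.
(* If the component of [x] ends in a vertex exposed by [m], switching [m] to [n] on it exposes [x]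
   at no cost. Otherwise its two ends [x] and [w] are exposed by [n], and [m] exposes nothing on
   it. *)
case=> [[e [eP me] H] | [w [wP nw wx] H]].
  have E1 : exposed n :&: P = [set x].
    apply/setP => z; rewrite in_setI in_set1.
    apply/andP/eqP => [[/exposedP nz zP]|->]; first exact: (H z zP).2.
    by split=> //; apply/exposedP.
  have E2 : exposed m :&: P = [set e].
    apply/setP => z; rewrite in_setI in_set1.
    apply/andP/eqP => [[/exposedP mz zP]|->]; first exact: (H z zP).1.
    by split=> //; apply/exposedP.
  case: nx'; split=> //; exists (switch P n m); last by rewrite /switch xP.
  apply: opt_same om Smn _; move: cmn; rewrite E1 E2 !cards1; lia.
have E1 : exposed n :&: P = [set x; w].
  apply/setP => z; rewrite in_setI in_set2.
  apply/andP/orP => [[/exposedP nz zP]|[]/eqP->].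
  - by case: ((H z zP).2 nz) => ->; rewrite eqxx; [left | right].
  - by split=> //; apply/exposedP.
  - by split=> //; apply/exposedP.
have E2 : exposed m :&: P = set0.
  apply/setP => z; rewrite in_setI in_set0.
  by apply/negP => /andP[/exposedP mz zP]; case: (H z zP).
move: cmn cnm; rewrite E1 E2 cards0 cards2 eq_sym; move/eqP/negPf: (wx) => -> /= cmn cnm.
(* For [w] other than [a] the component avoids [a], so [n] can be switched to [m] on it within
   [S :\ a], which contradicts the optimality of [n]. *)
have [Ewa|wa] := eqVneq w a; last first.
  have aP : a \notin P.
    apply/negP => aP; case: ((H a aP).2 na') => E.
      by rewrite E eqxx in xa.
    by rewrite E eqxx in wa.
  have Snm : mate_on (S :\ a) (switch P m n).
    have [? Sw] := switch_mate Sn om.1 Pn Pm; split=> // z; rewrite !inE negb_and negbK.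
    case/orP => [/eqP->|/Sw //]; by rewrite /switch (negPf aP).
  have := on.2 _ Snm; lia.
(* Now [w] is [a]. Switching [m] to [n] exposes [x] and [a], while [u] stays exposed because it lies
   off the component. Adding the edge from [a] to [u] makes up for the two new exposed vertices and
   leaves [x] exposed. *)
have uP : u \notin P by apply/negP => uP; case: (H u uP).
have nau : a != u by apply: contraTneq au => ->; rewrite sedge_irr.
have sa : switch P n m a = a by rewrite /switch -Ewa wP.
have su : switch P n m u = u by rewrite /switch (negPf uP).
have := rejoin_mate Smn aS uS au => Sr.
have := exposed_rejoin Smn.1 nau; rewrite sa su => Er.
have : #|exposed (rejoin (switch P n m) a u)| <= #|exposed m|.
  have sub : [set a; u] \subset exposed (switch P n m).
    by apply/subsetP => z; rewrite in_set2 => /orP[]/eqP->; apply/exposedP.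
  rewrite Er (setUidPl sub) cardsD (setIidPr sub) cards2 nau; lia.
move/(opt_same om Sr) => or; case: nx'; split=> //.
exists (rejoin (switch P n m) a u) => //.
have xu : x != u by apply: contraNneq uP => <-.
have xE : x \in exposed (switch P n m) by apply/exposedP; rewrite /switch xP.
by apply/exposedP; rewrite Er in_setD in_set2 negb_or xa xu in_setU xE.
Qed.

Lemma edge_neq x y : x -- y -> x != y.
Proof. by apply: contraTneq => ->; rewrite sedge_irr. Qed.

Lemma GE_AP a : reflect (~ missable [set: G] a /\ exists2 u, missable [set: G] u & a -- u)
  (a \in GE_A G).
Proof.
rewrite inE; apply: (iffP andP) => [[/GE_DP nD /existsP[u /andP[/GE_DP uD au]]]|[nD [u uD au]]].
  by split=> //; exists u.
split; first exact/GE_DP.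
by apply/existsP; exists u; rewrite au andbT; apply/GE_DP.
Qed.

(** The stability lemma can be iterated: deleting one vertex of A keeps the missable vertices, so
    every further vertex of A is still not missable and still has a missable neighbour. *)
Lemma delete_A (s : seq G) : uniq s -> {subset s <= GE_A G} ->
  (forall x, missable (~: [set x in s]) x <-> missable [set: G] x) /\
  forall m, opt_on [set: G] m -> exists2 m', opt_on (~: [set x in s]) m' &
    forall x, m' x = if (x \in s) || (m x \in s) then x else m x.
Proof.
elim: s => [|a s IH] /=.
  have -> : ~: [set x in [::]] = [set: G] by apply/setP => x; rewrite !inE.
  by split=> // m om; exists m.
move=> /andP[a_s us] sA.
have [|IH1 IH2] := IH us; first by move=> x xs; apply: sA; rewrite inE xs orbT.
have /GE_AP[naD [u uD au]] : a \in GE_A G by apply: sA; rewrite mem_head.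
set S := ~: [set x in s]; have aS : a \in S by rewrite !inE.
have -> : ~: [set x in a :: s] = S :\ a.
  by apply/setP => x; rewrite !inE negb_or.
have naS : ~ missable S a by move/IH1.
split=> [x|m om]; first by rewrite (missable_detach aS naS _ au) ?IH1.
have [m' om' E] := IH2 m om; exists (detach m' a).
  exact: (detach_opt aS naS om').1.
have [mK _] := om.1.1.
move=> x; rewrite /detach !inE !E (negPf a_s) /=.
have [-> //|xa] := eqVneq x a.
rewrite [m x == a](can2_eq mK mK) /=.
have [mas|mas] := boolP (m a \in s).
  rewrite (negPf xa); case: (boolP (x \in s)) => //= xs.
  by case: eqP => [Ex|//]; rewrite Ex mas in xs.
by case: eqP => [_|_]; rewrite ?orbT.
Qed.

Notation A := (GE_A G).
Notation D := (GE_D G).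

Lemma missable_offA x : missable (~: A) x <-> x \in D.
Proof.
have [|H _] := @delete_A (enum A) (enum_uniq _); first by move=> a; rewrite mem_enum.
by rewrite -(rwP (GE_DP x)) -H set_enum.
Qed.

Lemma opt_offA m : opt_on [set: G] m ->
  exists2 m', opt_on (~: A) m' & forall x, m' x = if (x \in A) || (m x \in A) then x else m x.
Proof.
have [|_ H] := @delete_A (enum A) (enum_uniq _); first by move=> a; rewrite mem_enum.
by move=> /H[m']; rewrite set_enum => om E; exists m' => // x; rewrite E !mem_enum.
Qed.

Let R := connect [rel x y | [&& x \in D, y \in D & x -- y]].

Let R_sym : connect_sym [rel x y | [&& x \in D, y \in D & x -- y]].
Proof. by apply: sym_connect_sym => x y /=; rewrite sedge_sym andbCA. Qed.

Let R_equiv : {in D & &, equivalence_rel R}.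
Proof.
move=> x y z _ _ _; split; first exact: connect0.
by move=> xy; apply/idP/idP; apply: connect_trans; rewrite // /R R_sym.
Qed.

Let part := equivalence_partitionP R_equiv.

Implicit Type X : {set G}.

Lemma comp_sub X : X \in ntcomp G -> X \subset D.
Proof.
rewrite inE => /andP[XP _]; have /and3P[/eqP <- _ _] := part.
exact: (bigcup_sup X).
Qed.

Lemma comp_memE X x y : X \in ntcomp G -> x \in X -> y \in D -> (y \in X) = R x y.
Proof.
move=> XC xX yD; have xD := subsetP (comp_sub XC) x xX.
have := pblock_equivalence_partition R_equiv xD yD => <-.
have /and3P[_ tP _] := part; rewrite (def_pblock tP _ xX) //.
by move: XC; rewrite inE => /andP[].
Qed.

Lemma comp_closed X x y : X \in ntcomp G -> x \in X -> y \in D -> x -- y -> y \in X.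
Proof.
move=> XC xX yD xy; rewrite (comp_memE XC xX yD); apply: connect1 => /=.
by rewrite xy yD (subsetP (comp_sub XC)).
Qed.

Lemma comp_boundary X x y : X \in ntcomp G -> x \in X -> x -- y -> y \notin X -> y \in A.
Proof.
move=> XC xX xy yX; rewrite inE; apply/andP; split.
  by apply: contra yX => yD; apply: comp_closed xy.
apply/existsP; exists x; rewrite sedge_sym xy andbT.
exact: (subsetP (comp_sub XC)).
Qed.

Lemma comp_inj X Y x : X \in ntcomp G -> Y \in ntcomp G -> x \in X -> x \in Y -> X = Y.
Proof.
move=> XC YC xX xY; apply/setP => y; have [yD|yD] := boolP (y \in D).
  by rewrite (comp_memE XC xX yD) (comp_memE YC xY yD).
have off Z : Z \in ntcomp G -> (y \in Z) = false.
  by move=> ZC; apply: contraNF yD; apply: (subsetP (comp_sub ZC)).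
by rewrite !off.
Qed.

Lemma comp_offA X x : X \in ntcomp G -> x \in X -> x \notin A.
Proof. by move=> XC xX; rewrite inE (subsetP (comp_sub XC)). Qed.

Lemma comp_nbr X x : X \in ntcomp G -> x \in X -> exists2 y, y \in X & x -- y.
Proof.
move=> XC xX; have xD := subsetP (comp_sub XC) x xX.
have : 1 < #|X| by move: XC; rewrite inE => /andP[].
rewrite (cardsD1 x) xX ltnS card_gt0 => /set0Pn[y]; rewrite !inE => /andP[yx yX].
have := yX; rewrite (comp_memE XC xX) ?(subsetP (comp_sub XC)) // => /connectP[[|z p] /=].
  by move=> _ yE; rewrite yE eqxx in yx.
case/andP=> /and3P[_ zD xz] _ _; exists z => //; exact: comp_closed xz.
Qed.

(* Gallai's lemma. *)
Lemma D_edge_missed m x y : opt_on (~: A) m -> R x y -> x \in D -> x <> y -> m x = x -> m y <> y.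
Proof.
move=> om /connectP[p]; elim: p x m om => [|z p IH] x m om /=; first by move=> _ ->.
case/andP=> /and3P[_ zD xz] zp yE xD xy mx.
have S_D u : u \in D -> u \in ~: A by move/missable_offA => [].
have xz_ n : opt_on (~: A) n -> n x = x -> n z <> z.
  by move=> on; apply: (opt_edge on) => //; apply: S_D.
have [<-|/eqP zy] := eqVneq z y; first exact: xz_.
have zy_ n : opt_on (~: A) n -> n z = z -> n y <> y by move=> on; apply: IH.
apply: missable_trans xz_ zy_ xy m om mx; exact/missable_offA.
Qed.

Lemma offA_comp S X m x : S = ~: A -> mate_on S m -> X \in ntcomp G -> x \in X -> m x \in X.
Proof.
move=> -> [[mK em] Sm] XC xX; have [-> //|nx] := eqVneq (m x) x.
apply: contraNT nx => mX; have mA := comp_boundary XC xX (em x _) mX.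
have [//|nx] := eqVneq (m x) x; have := Sm (m x); rewrite inE negbK mA // mK => /(_ isT) E.
by rewrite -E eqxx in nx.
Qed.

Lemma comp_opt X m : opt_on [set: G] m -> X \in ntcomp G ->
  exists d, [/\ d \in X, m d = d \/ m d \in A &
    forall x, x \in X -> x <> d -> m x \in X /\ m x <> x].
Proof.
move=> om XC; have [m' om' E] := opt_offA om.
have mX x : x \in X -> m' x \in X by apply: offA_comp om'.1 XC.
have fixE x : x \in X -> m' x <> x -> m x = m' x.
  by move=> xX; rewrite E (negPf (comp_offA XC xX)) /=; case: ifP.
have [[d /andP[dX /eqP md]]|nofix] := pselect (exists d, (d \in X) && (m' d == d)).
  exists d; split=> // [|x xX xd].
    by move: md; rewrite E (negPf (comp_offA XC dX)) /=; case: ifP => [_|_ ->]; [right | left].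
  have dD := subsetP (comp_sub XC) d dX; have xD := subsetP (comp_sub XC) x xX.
  have mx : m' x <> x.
    apply: D_edge_missed (om') _ dD _ md; last by move=> dx; apply: xd.
    by rewrite -(comp_memE XC dX xD).
  by rewrite fixE //; split=> //; apply: mX.
have [d dX] : exists d, d \in X.
  by apply/set0Pn; move: XC; rewrite inE -card_gt0 => /andP[_ /ltnW].
have /missable_offA[_ [n on nd]] := subsetP (comp_sub XC) d dX.
have nX x : x \in X -> n x \in X by apply: offA_comp on.1 XC.
have := on.2 _ (switch_mate on.1 om'.1 nX mX).
have := card_exposed_switch X n m'.
have -> : exposed m' :&: X = set0.
  apply/setP => x; rewrite !inE; apply/negP => /andP[mx xX].
  by apply: nofix; exists x; rewrite xX.
have : 0 < #|exposed n :&: X| by apply/card_gt0P; exists d; rewrite !inE nd eqxx dX.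
rewrite cards0; lia.
Qed.

(** Restrict to [X] an optimal matching off A that misses [d]; by Gallai's lemma it misses no other
    vertex of [X]. *)
Lemma comp_factor_critical X d : X \in ntcomp G -> d \in X ->
  exists s : G -> G, [/\ mate_on X s, s d = d & forall x, x \in X -> x <> d -> s x <> x].
Proof.
move=> XC dX; have dD := subsetP (comp_sub XC) d dX.
have /missable_offA[_ [n on nd]] := dD.
have nX x : x \in X -> n x \in X by apply: offA_comp on.1 XC.
have idm : mate_on (~: A) id by split=> //; split=> // x; rewrite eqxx.
exists (switch X n id); split=> [||x xX xd]; rewrite /switch ?dX ?xX //.
  have [sm _] := switch_mate idm on.1 (fun x xX => xX) nX; split=> // x.
  by move=> /negPf ->.
have xD := subsetP (comp_sub XC) x xX.
apply: D_edge_missed on _ dD _ nd; last by move=> E; apply: xd.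
by rewrite -(comp_memE XC dX xD).
Qed.

End GallaiEdmonds.

(** * Alternating reachability *)

Section Reach.
Variable G : sgraph.
Implicit Types (x y z b : G) (m : G -> G) (s t p c : seq G) (M : {set {set G}}).

(* Two consecutive edges of an alternating walk, the first one outside m. *)
Definition alt_arc m : rel G := [rel x y | x -- m y].

(* In 2-SAT terms: a Koenig vertex cover, if any, avoids the vertices in
   reach m, hence contains those in nreach m. *)
Inductive reach m : G -> Prop :=
| reach_exposed x : m x = x -> reach m x
| reach_arc x y : reach m x -> x -- y -> reach m (m y).

Definition nreach m y : Prop := exists2 x, reach m x & x -- y.

Definition core m x : Prop := reach m x /\ nreach m x.

Lemma nreach_mate m x : nreach m x -> reach m (m x).
Proof. by case=> y; apply: reach_arc. Qed.

Lemma reach_mate m x : is_mate m -> m x <> x -> reach m x -> nreach m (m x).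
Proof.
move=> [mK _] nx rx; case: rx nx => [//|z y rz zy nx].
by exists z; rewrite ?mK.
Qed.

(** The full vertex sequence of a walk stored as an [alt_arc] path: each entry [y] stands for the
    matching edge traversed from [m y] to [y]. *)
Fixpoint zig m s := if s is y :: s' then m y :: y :: zig m s' else [::].

Lemma zig_cat m s t : zig m (s ++ t) = zig m s ++ zig m t.
Proof. by elim: s => //= x s ->. Qed.

Lemma zigP m s z : reflect (exists2 y, y \in s & z = y \/ z = m y) (z \in zig m s).
Proof.
elim: s => [|y s IH] /=; first by constructor; case.
rewrite !inE; apply: (iffP or3P) => [[/eqP->|/eqP->|/IH[u us E]]|[u]].
- by exists y; [rewrite mem_head | right].
- by exists y; [rewrite mem_head | left].
- by exists u; rewrite ?inE ?us ?orbT.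
rewrite inE => /orP[/eqP->|us] E; last by constructor 3; apply/IH; exists u.
by case: E => ->; [constructor 2 | constructor 1].
Qed.

Lemma last_zig m x s : last x (zig m s) = last x s.
Proof. by elim: s x => //= y s IH x. Qed.

Lemma size_zig m s : size (zig m s) = (size s).*2.
Proof. by elim: s => //= y s ->. Qed.

Lemma path_zig m x s : path (@sedge G) x (zig m s) -> path (alt_arc m) x s.
Proof. by elim: s x => //= y s IH x /and3P[xy _ /IH ->]; rewrite /alt_arc /= xy. Qed.

Lemma arc_forward m x s : is_mate m -> path (alt_arc m) x s -> reach m x ->
  forall y, y \in s -> reach m y /\ nreach m (m y).
Proof.
move=> mm; have [mK _] := mm; elim: s x => //= y s IH x /andP[xy ys] rx z.
have ny : nreach m (m y) by exists x.
have ry : reach m y by rewrite -[y]mK; apply: nreach_mate.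
by rewrite inE => /orP[/eqP->|]; [split | apply: IH ys ry z].
Qed.

(** Read from its far end, the same walk enters each matching edge at [y] and leaves it at [m y]. *)
Lemma arc_backward m x s : is_mate m -> path (alt_arc m) x s -> nreach m (last x s) ->
  nreach m x /\ forall y, y \in s -> nreach m y /\ reach m (m y).
Proof.
move=> mm; elim: s x => //= y s IH x /andP[xy ys] nl.
have [ny H] := IH y ys nl; have rmy := nreach_mate ny.
split; first by exists (m y); rewrite // sedge_sym.
by move=> z; rewrite inE => /orP[/eqP->|]; [split | apply: H].
Qed.

Lemma reach_last m x s y : is_mate m -> path (alt_arc m) x s -> y \in x :: s ->
  reach m y -> reach m (last x s).
Proof.
move=> mm; have [mK _] := mm; elim: s x y => [|z s IH] x y /=.
  by move=> _; rewrite inE => /eqP->.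
case/andP=> xz zs; rewrite inE => /orP[/eqP->|ys] ry; last exact: IH zs ys ry.
apply: (IH z z zs (mem_head _ _)); rewrite -[z]mK; apply: nreach_mate; by exists x.
Qed.

Lemma nreach_head m x s y : is_mate m -> path (alt_arc m) x s -> y \in x :: s ->
  nreach m y -> nreach m x.
Proof.
move=> mm; elim: s x y => [|z s IH] x y /=; first by move=> _; rewrite inE => /eqP->.
case/andP=> xz zs; rewrite inE => /orP[/eqP-> //|ys] /(IH z y zs ys) nz.
by exists (m z); [apply: nreach_mate | rewrite sedge_sym].
Qed.

Lemma core_zig m x s : is_mate m -> path (alt_arc m) x s -> reach m x ->
  nreach m (last x s) -> forall z, z \in zig m s -> core m z.
Proof.
move=> mm xs rx nl z /zigP[y ys E].
have [ry nmy] := arc_forward mm xs rx ys.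
have [ny rmy] := (arc_backward mm xs nl).2 y ys.
by case: E => ->; split.
Qed.

Definition touched m z : Prop := reach m z \/ nreach m z.

(** A reached entry propagates forward to the last one, a neighbour of [b]; an entry next to a
    reached vertex propagates backward to [b]. For the mate of an entry the two roles are
    exchanged. *)
Lemma touched_blossom m b s : is_mate m -> path (alt_arc m) b s -> last b s -- b ->
  (forall y, y \in s -> m y <> y) ->
  forall z, z \in b :: zig m s -> touched m z -> nreach m b.
Proof.
move=> mm bs lb sat z zbs; have [mK _] := mm.
have fwd y : y \in b :: s -> reach m y -> nreach m b.
  by move=> ys /(reach_last mm bs ys) rl; exists (last b s).
have bwd y : y \in b :: s -> nreach m y -> nreach m b := nreach_head mm bs.
move: zbs; rewrite inE => /orP[/eqP->|/zigP[y ys E]].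
  by case=> //; apply: fwd; rewrite mem_head.
have ys' : y \in b :: s by rewrite inE ys orbT.
case: E => ->; first by case; [apply: fwd | apply: bwd].
case=> [/reach_mate|/nreach_mate]; rewrite mK; last exact: fwd.
move=> H; apply: (bwd y) => //; apply: H => // E; apply: (sat y ys); by rewrite -E.
Qed.

Lemma core_blossom m b s : is_mate m -> path (alt_arc m) b s -> last b s -- b ->
  reach m b -> forall z, z \in b :: zig m s -> core m z.
Proof.
move=> mm bs lb rb z; have [mK _] := mm.
have rl : reach m (last b s) by apply: (reach_last mm bs (mem_head _ _)).
have nb : nreach m b by exists (last b s).
rewrite inE => /orP[/eqP->|zs]; first by split.
by apply: (core_zig mm bs rb _ zs); exists b; [exact: rb | rewrite sedge_sym].
Qed.

(* The base of a blossom is reached as soon as any of its vertices is touched,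
   from either side; hence a posy is entirely in the core or untouched. *)
Lemma core_posy m y s b1 s1 b2 s2 : is_mate m -> path (alt_arc m) y s ->
  b1 = m y -> b2 = last y s ->
  path (alt_arc m) b1 s1 -> last b1 s1 -- b1 ->
  path (alt_arc m) b2 s2 -> last b2 s2 -- b2 ->
  (forall z, z \in y :: s ++ s1 ++ s2 -> m z <> z) ->
  let V := (b1 :: zig m s1) ++ (b2 :: zig m s2) ++ zig m (y :: s) in
  forall z, z \in V -> touched m z -> forall v, v \in V -> core m v.
Proof.
move=> mm ys E1 E2 p1 l1 p2 l2 sat V z zV tz v vV; have [mK _] := mm.
have sat1 u : u \in s1 -> m u <> u.
  by move=> us; apply: sat; rewrite inE !mem_cat us !orbT.
have sat2 u : u \in s2 -> m u <> u.
  by move=> us; apply: sat; rewrite inE !mem_cat us !orbT.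
have sat0 u : u \in y :: s -> m u <> u.
  by move=> us; apply: sat; rewrite -cat_cons mem_cat us.
have go1 : nreach m b1 -> nreach m b2.
  rewrite E1 => /nreach_mate; rewrite mK => ry.
  have rb2 := reach_last mm ys (mem_head _ _) ry; rewrite -E2 in rb2.
  by case: (core_blossom mm p2 l2 rb2 (mem_head _ _)).
have go2 : nreach m b2 -> reach m b1 /\ nreach m b1.
  rewrite E2 => /(arc_backward mm ys)[/nreach_mate rb1 _]; rewrite -E1 in rb1.
  exact: (core_blossom mm p1 l1 rb1 (mem_head _ _)).
have [n1 n2] : nreach m b1 /\ nreach m b2.
  suff : nreach m b1 \/ nreach m b2 by case=> [/[dup] /go1|/[dup]/go2[_]].
  move: zV; rewrite /V mem_cat => /orP[zV|].
    by left; apply: (touched_blossom mm p1 l1 sat1 zV tz).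
  rewrite mem_cat => /orP[zV|/zigP[u us E]].
    by right; apply: (touched_blossom mm p2 l2 sat2 zV tz).
  have fwd : reach m u -> nreach m b2.
    move=> /(reach_last mm ys us); rewrite -E2 => rb2.
    by case: (core_blossom mm p2 l2 rb2 (mem_head _ _)).
  have bwd : nreach m u -> nreach m b1.
    move=> /(nreach_head mm ys us)/nreach_mate; rewrite -E1 => rb1.
    by case: (core_blossom mm p1 l1 rb1 (mem_head _ _)).
  case: E tz => ->; first by case; [right; apply: fwd | left; apply: bwd].
  case=> [/reach_mate|/nreach_mate]; rewrite mK; last by right; apply: fwd.
  move=> H; left; apply: bwd; apply: H => // E; apply: (sat0 u us); by rewrite -E.
have [r1 _] := go2 n2.
have ry : reach m y by rewrite -[y]mK -E1; apply: nreach_mate.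
have rb2 : reach m b2 by rewrite E2; apply: (reach_last mm ys (mem_head _ _) ry).
move: vV; rewrite /V !mem_cat => /or3P[|| ] vV.
- exact: (core_blossom mm p1 l1 r1 vV).
- exact: (core_blossom mm p2 l2 rb2 vV).
have core_s u : u \in zig m s -> core m u.
  by move=> us; apply: (core_zig mm ys ry _ us); rewrite -E2.
move: vV; rewrite /= !inE => /or3P[/eqP->|/eqP->|]; last exact: core_s.
  by rewrite -E1; split.
split=> //; have := reach_mate mm _ r1; rewrite E1 mK; apply=> E.
by apply: (sat0 y (mem_head _ _)).
Qed.

End Reach.

(** * Blossoms, stems and posies as alternating walks *)

Section BlossomWalks.
Variable G : sgraph.
Implicit Types (x y z b v : G) (m : G -> G) (s t p c : seq G) (M : {set {set G}}).

Lemma nth_zig m s k : size s = k.*2 ->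
  (forall x0 j, j < k -> nth x0 s j.*2 = m (nth x0 s j.*2.+1)) ->
  exists t, s = zig m t.
Proof.
elim: k s => [|k IH] [|x [|y s]] //=; first by exists [::].
rewrite doubleS => -[sk] H.
have [|t ->] := IH s sk; first by move=> x0 j jk; exact: (H x0 j.+1).
by exists (y :: t); rewrite /= -(H y 0).
Qed.

(** The k matching edges on the cycle are disjoint, hence cover all 2k vertices other than the base.
    Going round from the base, the vertices are then matched in consecutive pairs. *)
Lemma blossom_zig M c b : matching M -> blossom M c -> base M c b ->
  exists t, [/\ c =i b :: zig (mate_of M) t, path (alt_arc (mate_of M)) b t,
    last b t -- b & forall y, y \in t -> mate_of M y <> y].
Proof.
move=> mM /and3P[/andP[/andP[cyc uc] sc] oc /eqP ck] /andP[bc bE].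
set m := mate_of M; have [mK _] : is_mate m := mate_of_mate mM.
have /rot_to[r c' Ec] := bc.
have uc' : uniq (b :: c') by rewrite -Ec rot_uniq.
have cyc' : cycle (@sedge G) (b :: c') by rewrite -Ec rot_cycle.
have memc : c =i b :: c' by move=> z; rewrite -Ec mem_rot.
have szc : size c = (size c').+1 by rewrite -[LHS](size_rot r) Ec.
have nextE x : next c x = next (b :: c') x by rewrite -Ec next_rot.
have sz' : size c' = ((size c)./2).*2.
  by apply: succn_inj; rewrite -szc -{1}(odd_double_half (size c)) oc.
set E := cycle_edges c :&: M.
have EM : E \subset M by apply: subsetIr.
have /andP[/subsetP ME tM] := mM.
have tE : trivIset E := trivIsetS EM tM.
have covE : cover E \subset c'.
  apply/subsetP => x /bigcupP[e eE xe].
  have xb : x != b by apply: contraNneq bE => <-; apply/bigcupP; exists e.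
  have : x \in c.
    move: eE xe; rewrite inE => /andP[/imsetP[u uc_ ->] _].
    by rewrite !inE => /orP[]/eqP-> //; rewrite mem_next.
  by rewrite memc inE (negPf xb).
have card_cov : #|cover E| = #|c'|.
  have [_ uc'2] := andP uc'.
  rewrite (card_uniqP uc'2) sz' -ck -(eqP tE) -mul2n mulnC -sum_nat_const.
  apply: eq_bigr => e /(subsetP EM)/ME/edgesP[x [y [xy ->]]].
  by rewrite cards2 (edge_neq xy).
have covEi : cover E =i c' by apply/subset_cardP.
have covered x : x \in c' -> m x = next c x \/ next c (m x) = x.
  move=> xc'; have /bigcupP[e] : x \in cover E by rewrite covEi.
  rewrite inE => /andP[/imsetP[u uc_ ->] eM]; rewrite !inE.
  have nu : u != next c u by apply: edge_neq; apply: matching_edge eM.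
  have mu : m u = next c u by apply/eqP; rewrite /m -mate_ofP.
  by case/orP=> /eqP->; [left | right; rewrite -mu mK mu].
have mb : forall x, x \in c' -> m x <> b.
  move=> x xc' xb; have /bigcupP[e] : x \in cover E by rewrite covEi.
  rewrite inE => /andP[eC eM] xe; case/negP: bE; apply/bigcupP; exists e.
    by rewrite inE eC.
  move: eC eM xe => /imsetP[u uc_ ->] eM; rewrite !inE.
  have nu : u != next c u by apply: edge_neq; apply: matching_edge eM.
  have mu : m u = next c u by apply/eqP; rewrite /m -mate_ofP.
  case/orP=> /eqP E'; rewrite E' in xb; first by rewrite -mu xb eqxx orbT.
  by rewrite -mu mK in xb; rewrite xb eqxx.
pose x_ i := nth b (b :: c') i.
have x_next i : i <= size c' -> next c (x_ i) = nth b c' i.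
  move=> ic; rewrite nextE next_nth mem_nth //=; case: i ic => [|i] ic; first by rewrite /x_ /= eqxx.
  rewrite /x_ /=; case: eqP => [E'|_].
    by move: uc'; rewrite /= E' mem_nth.
  by rewrite index_uniq //; case/andP: uc'.
have x_inj i j : i <= size c' -> j <= size c' -> x_ i = x_ j -> i = j.
  by move=> ic jc /eqP; rewrite nth_uniq // => /eqP.
(* The base has position 0. The mate of position 2j+1 is one of its two neighbours on the cycle, and
   position 2j is excluded: it is the base, or it is already matched with position 2j-1. *)
have step j : j < (size c)./2 -> m (x_ j.*2.+1) = x_ j.*2.+2.
  elim/ltn_ind: j => j IH jk.
  have jc : j.*2.+1 < size c' by rewrite sz' -doubleS leq_double.
  have xc' : x_ j.*2.+1 \in c' by rewrite /x_ /= mem_nth // ltnW.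
  case: (covered _ xc') => [->|]; first by rewrite x_next // ltnW.
  have [k kc mk] : exists2 k, k <= size c' & m (x_ j.*2.+1) = x_ k.
    have : m (x_ j.*2.+1) \in c.
      case: (covered _ xc') => [->|E'].
        by rewrite mem_next memc inE xc' orbT.
      by rewrite -mem_next E' memc inE xc' orbT.
    rewrite memc => mc; exists (index (m (x_ j.*2.+1)) (b :: c')).
      by have := index_mem (m (x_ j.*2.+1)) (b :: c'); rewrite mc.
    by rewrite /x_ nth_index.
  rewrite mk x_next // => E'.
  have kj : k = j.*2.
    have [kl|kg] := ltnP k (size c'); last first.
      rewrite nth_default // in E'; have : x_ 0 = x_ j.*2.+1 by [].
      by move/x_inj => /(_ isT (ltnW jc)).
    by have := x_inj k.+1 j.*2.+1 kl (ltnW jc) E'; case.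
  subst k; case: j IH jk jc xc' mk E' kc => [|j] IH jk jc xc' mk E' kc.
    by case: (mb _ xc').
  have Ej : x_ j.*2.+1 = x_ j.+1.*2.+1.
    by apply: (inv_inj mK); rewrite mk (IH j) ?ltnSn // ltnW.
  have le1 : j.*2.+1 <= size c' by clear -jc; rewrite doubleS in jc; do 3!apply: ltnW.
  by have := x_inj _ _ le1 (ltnW jc) Ej; rewrite doubleS => /eqP; rewrite !eqSS -addn2 -{1}[j.*2]addn0 eqn_add2l.
have [|t Et] := @nth_zig m c' (size c)./2 sz'.
  move=> x0 j jk; have jc : j.*2.+1 < size c' by rewrite sz' -doubleS leq_double.
  have := step j jk; rewrite /x_ /= => E'.
  by rewrite (set_nth_default b x0 (ltnW jc)) (set_nth_default b x0 jc) -E' mK.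
exists t; rewrite -Et; split=> //.
- by move: cyc'; rewrite /= Et rcons_path => /andP[/path_zig].
- by move: cyc'; rewrite /= Et rcons_path last_zig => /andP[_].
move=> y yt E'; have yc' : y \in c' by rewrite Et; apply/zigP; exists y; [|left].
have /bigcupP[e] : y \in cover E by rewrite covEi.
rewrite inE => /andP[/imsetP[u uc_ ->] eM]; rewrite !inE.
have nu : u != next c u by apply: edge_neq; apply: matching_edge eM.
have mu : m u = next c u by apply/eqP; rewrite /m -mate_ofP.
case/orP=> /eqP Eu; rewrite -mu in nu Eu; first by rewrite -Eu E' eqxx in nu.
by rewrite Eu mK in E'; rewrite -E' eqxx in nu.
Qed.

Lemma alternating_cons M x y p : alternating M x (y :: p) ->
  alternating M y p /\ (p != [::] -> ([set x; y] \in M) = ([set y; head y p] \notin M)).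
Proof.
rewrite /alternating /=; case: p => [|z p] //= /andP[+ ->].
by do 2!case: (_ \in M).
Qed.

Lemma alternating_zig M x p : matching M -> path (@sedge G) x p -> alternating M x p ->
  ~~ odd (size p) -> (p != [::] -> [set x; head x p] \notin M) ->
  exists t, [/\ p = zig (mate_of M) t, path (alt_arc (mate_of M)) x t &
    forall y, y \in t -> mate_of M y <> y].
Proof.
move=> mM; have [mK _] := mate_of_mate mM.
have [k] := ubnP (size p); elim: k x p => // k IH x [|y [|z p]] //= sk.
  by move=> *; exists [::].
move=> /and3P[xy yz zp] /alternating_cons[/alternating_cons[al Ez] /= /(_ isT) Ey].
rewrite negbK => op /(_ isT) xyM; rewrite (negPf xyM) in Ey.
have yzM : [set y; z] \in M by apply/negPn; rewrite -Ey.
have myz : mate_of M y = z by apply/eqP; rewrite -mate_ofP // edge_neq.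
have [||t [Ep zt sat]] := IH z p _ zp al op; first exact: ltnW.
  by move=> pn; rewrite -Ez.
have mzy : mate_of M z = y by rewrite -myz mK.
exists (z :: t); rewrite Ep /= mzy; split=> //; first by rewrite /alt_arc /= mzy xy.
move=> u; rewrite inE => /orP[/eqP->|]; last exact: sat.
by rewrite mzy => E; rewrite E sedge_irr in yz.
Qed.

Lemma alternating_last M x y p : alternating M x (y :: p) ->
  (last set0 (path_edges x (y :: p)) \in M) = ([set x; y] \in M) (+) odd (size p).
Proof.
elim: p x y => [|z p IH] x y /=; first by rewrite addbF.
move=> /alternating_cons[al /(_ isT) /= ->]; rewrite -[LHS]/(last set0 (path_edges y (z :: p)) \in M).
by rewrite IH // addbN addNb negbK.
Qed.

Lemma mm_path_zig M b p : matching M -> mm_path M b p ->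
  exists y t, [/\ b = mate_of M y, p = y :: zig (mate_of M) t,
    path (alt_arc (mate_of M)) y t & forall z, z \in y :: t -> mate_of M z <> z].
Proof.
move=> mM /and5P[/andP[bp _] al pn hM lM].
have [mK em] := mate_of_mate mM.
case: p bp al pn hM lM => // y p /= /andP[by_ yp] al _ byM lM.
have := alternating_last al; rewrite [LHS]lM byM => /esym /= op.
have [al' Ey] := alternating_cons al.
have mb : mate_of M b = y by apply/eqP; rewrite -mate_ofP // edge_neq.
have [|t [Ep yt sat]] := alternating_zig mM yp al' op.
  by move=> pn; rewrite -Ey.
exists y, t; rewrite -mb mK mb -Ep; split=> // z; rewrite inE => /orP[/eqP->|]; last exact: sat.
by rewrite -mb mK mb => E; rewrite E sedge_irr in by_.
Qed.

(** The stem is turned round to start at its exposed end [u], since this is the direction in which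
    [reach] propagates. *)
Lemma stem_zig M b s : matching M -> stem M b s ->
  exists u t, [/\ mate_of M u = u, path (alt_arc (mate_of M)) u t, b = last u t,
    b :: s =i u :: zig (mate_of M) t & s != [::] -> mate_of M b != b].
Proof.
move=> mM /and4P[/andP[bs _] al os ns].
have [mK em] := mate_of_mate mM.
have {ns} ml : mate_of M (last b s) = last b s.
  by apply/exposedP; rewrite exposed_mate_of // inE.
(* A nonempty stem leaves the base by a matching edge: otherwise, having even length, it would end
   with a matching edge and its last vertex would be saturated. *)
have hM : s != [::] -> [set b; head b s] \in M.
  move=> sn; apply/negPn/negP => hs.
  have [t [Es _ sat]] := alternating_zig mM bs al os (fun _ => hs).
  case: (lastP t) Es sat => [|t' y] Es sat; first by rewrite Es in sn.
  apply: (sat y); first by rewrite mem_rcons mem_head.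
  by move: ml; rewrite Es last_zig last_rcons.
have [k] := ubnP (size s); elim: k b s bs al os ml hM => // k IH b [|y [|z p]] //=.
  by move=> _ _ _ mb _ _; exists b, [::]; split.
move=> /and3P[by_ yz zp] al os ml /(_ isT) byM sk.
have [/alternating_cons[al' Ez] /= /(_ isT) Ey] := alternating_cons al.
have mb : mate_of M b = y by apply/eqP; rewrite -mate_ofP // edge_neq.
rewrite negbK in os; rewrite byM in Ey.
have [||u [t [mu ut zE mem _]]] := IH z p zp al' os ml _ _; last first.
- exists u, (rcons t b); split=> //.
  + by rewrite rcons_path ut -zE /alt_arc /= mb sedge_sym.
  + by rewrite last_rcons.
  + move=> v; have -> : rcons t b = t ++ [:: b] by rewrite cats1.
    rewrite zig_cat -cat_cons mem_cat -mem /= mb !inE.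
    by do 3!case: (v == _) => //=; rewrite ?orbT ?orbF.
  by move=> _; rewrite mb eq_sym edge_neq.
- exact: ltnW.
- by move=> pn; have := Ez pn; rewrite -[_ \in M]negbK -Ey /= => /esym/negPn.
Qed.

Lemma flower_core M c b s v : matching M -> Tflower M c b s -> v \in c ++ b :: s ->
  core (mate_of M) v.
Proof.
move=> mM [Bc bb st _]; have mm := mate_of_mate mM; have [mK em] := mm.
have [t1 [cE bt1 lt1 sat1]] := blossom_zig mM Bc bb.
have [u [t [mu ut bE sE nb]]] := stem_zig mM st.
have ru : reach (mate_of M) u by apply: reach_exposed.
have rb : reach (mate_of M) b by rewrite bE; apply: (reach_last mm ut (mem_head _ _)).
have cc := core_blossom mm bt1 lt1 rb.
rewrite mem_cat cE => /orP[/cc //|]; rewrite sE inE.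
have nl : nreach (mate_of M) (last u t) by rewrite -bE; case: (cc b (mem_head _ _)).
case/orP=> [/eqP->|]; last exact: (core_zig mm ut ru nl).
by split=> //; case: (arc_backward mm ut nl).
Qed.

Lemma posy_core M c1 c2 b p z : matching M -> Tposy M c1 c2 b p ->
  z \in c1 ++ c2 ++ b :: p -> touched (mate_of M) z ->
  forall v, v \in c1 ++ c2 ++ b :: p -> core (mate_of M) v.
Proof.
move=> mM [[B1 b1] [B2 b2] mp _ _]; have mm := mate_of_mate mM.
have [t1 [c1E p1 l1 sat1]] := blossom_zig mM B1 b1.
have [t2 [c2E p2 l2 sat2]] := blossom_zig mM B2 b2.
have [y [t [bE pE yt sat]]] := mm_path_zig mM mp.
have lE : last b p = last y t by rewrite pE /= last_zig.
have satA : forall z, z \in y :: t ++ t1 ++ t2 -> mate_of M z <> z.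
  move=> w; rewrite -cat_cons !mem_cat => /or3P[]; [exact: sat|exact: sat1|exact: sat2].
have VE v : (v \in c1 ++ c2 ++ b :: p) = (v \in (b :: zig (mate_of M) t1) ++
    (last b p :: zig (mate_of M) t2) ++ zig (mate_of M) (y :: t)).
  by rewrite !mem_cat c1E c2E pE /= bE.
rewrite VE => zV tz v; rewrite VE.
exact: (core_posy mm yt bE lE p1 l1 p2 l2 satA zV tz).
Qed.

(** Compare [m] with an optimal matching [n] that misses [d]. If [d] were not reached, then no
    iterate of [d] under [n \o m] would be, yet one of them is exposed by [m]. *)
Lemma GE_D_reach m d : opt_on [set: G] m -> d \in GE_D G -> reach m d.
Proof.
move=> om /GE_DP[_ [n on nd]]; apply: contrapT => nrd.
have [[mK _] _] := om.1; have [[nK en] _] := on.1.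
have [e [eP me] H] := opt_orbit_ends om on nd.
suff : forall i, ~ reach m (iter i (n \o m) d).
  have /alt_orbitP[i _ Ee] := eP => H'; apply: (H' i); rewrite -Ee.
  exact: reach_exposed.
elim=> [//|i IH] /=; set x := iter i _ d in IH *.
have xP : x \in alt_orbit m n d by rewrite inE; apply: fconnect_iter.
have mxP : m x \in alt_orbit m n d by apply: alt_orbit_m.
have [nmx|nx] := eqVneq (n (m x)) (m x); first by rewrite ((H _ mxP).2 nmx) nd.
by move=> r; apply: IH; rewrite -[x]mK; apply: reach_arc r _; rewrite sedge_sym en.
Qed.

End BlossomWalks.

(** * Dumbbells *)

Ltac count_lia :=
  rewrite ?count_cat /= ?count_cat /= ?count_cat ?count_rev;
  repeat (match goal with |- context [nat_of_bool ?b] => generalize (nat_of_bool b) end);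
  repeat (match goal with |- context [count ?p ?s] => generalize (count p s) end);
  clear; lia.

Section Dumbbells.
Variable G : sgraph.
Implicit Types (x y z u w a v : G) (m : G -> G) (s t p c d q P L : seq G) (W : {set G}).

(** [W] acts as a contracted vertex: at first the set of exposed vertices, later enlarged by the
    structures already found. Inside [W] the involution [m] need not follow edges. *)
Definition rooted m W : Prop :=
  [/\ involutive m, forall x, x \in W -> m x \in W & forall x, x \notin W -> x -- m x].

Definition verts m L := L ++ map m L.

Definition regular m W L := uniq (verts m L) && all (fun x => x \notin W) L.

(* y is adjacent to W, or c is an m-blossom with base y. *)
Definition terminal m W y c : bool :=
  if c is [::] then [exists w in W, y -- w]
  else path (alt_arc m) y c && (last y c -- y).

(* The arcs y :: ys stand for the mm-path m y, y, ..., m (last y ys), last y ys;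
   both its ends are terminal. *)
Definition dumbbell m W d y ys c : Prop :=
  [/\ path (alt_arc m) y ys, terminal m W (m y) d, terminal m W (last y ys) c &
      regular m W (d ++ (y :: ys) ++ c)].

Lemma mem_verts m L x : involutive m -> (x \in verts m L) = (x \in L) || (m x \in L).
Proof.
by move=> mK; rewrite mem_cat -{2}[x]mK mem_map //; exact: inv_inj.
Qed.

Lemma uniq_count (s1 s2 : seq G) : uniq s2 ->
  (forall x, count_mem x s1 <= count_mem x s2) -> uniq s1.
Proof.
move=> u2 le; apply: count_mem_uniq => x; have := le x; rewrite (count_uniq_mem _ u2).
have -> : (x \in s1) = (0 < count_mem x s1) by rewrite -has_count has_pred1.
by case: (x \in s2); case: (count _ _) => [|[|]].
Qed.

(** Rearranging the pieces of a configuration preserves regularity as long as no multiplicity grows,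
    so every disjointness check below reduces to the linear arithmetic of [count_lia]. *)
Lemma regular_le m m' W L L' : rooted m W -> regular m W L ->
  (forall x, count_mem x (verts m' L') <= count_mem x (verts m L)) -> regular m' W L'.
Proof.
move=> [mK Wm _] /andP[uL /allP LW] le; apply/andP; split; first exact: uniq_count uL le.
apply/allP => x xL'; have : x \in verts m L.
  rewrite -has_pred1 has_count; apply: leq_trans (le x).
  by rewrite -has_count has_pred1 mem_cat xL'.
rewrite mem_verts // => /orP[/LW //|/LW]; apply: contra; exact: Wm.
Qed.

(** With [m (last x s)] put in front, this is the walk [x :: s] traversed backwards: each matching
    edge is now represented by its other end. *)
Definition mirror m x s := rev (map m (belast x s)).

Lemma mirror_cons m x s : m (last x s) :: mirror m x s = rev (map m (x :: s)).
Proof. by rewrite (lastI x s) map_rcons rev_rcons. Qed.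

Lemma last_mirror m x s : last (m (last x s)) (mirror m x s) = m x.
Proof.
have := congr1 (last (m x)) (mirror_cons m x s) => /= ->.
by rewrite /= rev_cons last_rcons.
Qed.

Lemma arc_mirror m x s : involutive m -> path (alt_arc m) x s ->
  path (alt_arc m) (m (last x s)) (mirror m x s).
Proof.
move=> mK; elim: s x => // y s IH x /andP[xy ys].
rewrite /mirror /= rev_cons rcons_path IH //= last_mirror /alt_arc /= mK sedge_sym.
exact: xy.
Qed.

Lemma dumbbell_mirror m W d y ys c : rooted m W -> dumbbell m W d y ys c ->
  dumbbell m W c (m (last y ys)) (mirror m y ys) d.
Proof.
move=> rW; have [mK _ _] := rW; case=> yys td tc reg; split.
- exact: arc_mirror.
- by rewrite mK.
- by rewrite last_mirror.
apply: regular_le rW reg _ => x; rewrite /verts mirror_cons.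
rewrite !map_cat map_rev !count_cat !count_rev (mapK mK); count_lia.
Qed.

Lemma dumbbell_reverse m W d y ys c : rooted m W -> dumbbell m W d y ys c ->
  dumbbell m W d y ys (rev (map m c)).
Proof.
move=> rW; have [mK _ _] := rW; case=> yys td tc reg; split=> //; last first.
  apply: regular_le rW reg _ => x; rewrite /verts.
  rewrite !map_cat map_rev !count_cat !count_rev (mapK mK); count_lia.
move: tc; case: c {reg} => // z c /andP[/= /andP[bz zc] lb].
have := mirror_cons m z c => <-; rewrite /= arc_mirror // last_mirror /alt_arc /= mK.
by rewrite andbT; apply/andP; split; rewrite sedge_sym.
Qed.

Lemma dumbbell_ext m m' W d y ys c :
  (forall x, x \in verts m (d ++ (y :: ys) ++ c) -> m' x = m x) ->
  dumbbell m W d y ys c -> dumbbell m' W d y ys c.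
Proof.
set L := d ++ _ => E [yys td tc reg].
have arcE x z : z \in L -> alt_arc m' x z = alt_arc m x z.
  by move=> zL; rewrite /alt_arc /= E // mem_cat zL.
have pathE x s : {subset s <= L} -> path (alt_arc m') x s = path (alt_arc m) x s.
  elim: s x => // z s IH x sL; rewrite /= arcE ?sL ?mem_head // IH // => u us.
  by apply: sL; rewrite inE us orbT.
have subd : {subset d <= L} by move=> u; rewrite mem_cat => ->.
have subc : {subset c <= L} by move=> u uc; rewrite !mem_cat uc !orbT.
have suby : {subset y :: ys <= L} by move=> u uy; rewrite !mem_cat uy !orbT.
have termE x s : {subset s <= L} -> terminal m' W x s = terminal m W x s.
  by case: s => // u s /pathE; rewrite /terminal => ->.
split.
- by rewrite pathE // => u us; apply: suby; rewrite inE us orbT.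
- by rewrite termE // E // mem_cat suby ?mem_head.
- by rewrite termE.
move: reg; rewrite /regular /verts -/L; suff -> : map m' L = map m L by [].
by apply/eq_in_map => x xL; rewrite E // mem_cat xL.
Qed.

(** The matching may be replaced, but not on [W]; this protects both the exposed vertices and the
    structures already contracted into [W]. *)
Definition hits m W P : Prop :=
  exists m' d y ys c, [/\ rooted m' W, forall x, x \in W -> m' x = m x,
    dumbbell m' W d y ys c &
    {subset verts m P <= verts m' (d ++ (y :: ys) ++ c)}].

Lemma hits_dumbbell m W d y ys c P : rooted m W -> dumbbell m W d y ys c ->
  {subset P <= d ++ (y :: ys) ++ c} -> hits m W P.
Proof.
move=> rW D sub; exists m, d, y, ys, c; split=> // x; have [mK _ _] := rW.
by rewrite !(mem_verts _ _ mK) => /orP[]/sub ->; rewrite ?orbT.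
Qed.

(* Arcs being pairs of edges, the underlying path joins u to m w. *)
Definition ear m u P w : Prop := P != [::] /\ path (alt_arc m) u (rcons P w).

Lemma ear_mirror m u P w : involutive m -> ear m u P w ->
  ear m (m w) (rev (map m P)) (m u).
Proof.
move=> mK [Pn uPw]; split.
  by rewrite -size_eq0 size_rev size_map size_eq0.
have := arc_mirror mK uPw; rewrite last_rcons /mirror belast_rcons.
by rewrite map_cons rev_cons.
Qed.

Lemma hits_mirror m W P : involutive m -> hits m W (rev (map m P)) -> hits m W P.
Proof.
move=> mK [m' [d [y [ys [c [rW mW D sub]]]]]]; exists m', d, y, ys, c; split=> //.
move=> x xP; apply: sub; move: xP; rewrite !(mem_verts _ _ mK) !mem_rev.
by rewrite -{3}[x]mK !(mem_map (inv_inj mK)) orbC.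
Qed.

(** * Ears that close a blossom with part of a dumbbell *)

Section Ears.
Variables (m : G -> G) (W : {set G}).
Hypothesis rW : rooted m W.

Let mK : involutive m. Proof. by case: rW. Qed.

Lemma terminal_blossom y s : path (alt_arc m) y s -> s != [::] -> last y s -- y ->
  terminal m W y s.
Proof. by rewrite /terminal; case: s => // u s -> _ ->. Qed.

Definition joint d y ys c P := regular m W (d ++ (y :: ys) ++ c ++ P).

Lemma joint_mirror d y ys c P : joint d y ys c P -> joint d y ys c (rev (map m P)).
Proof.
move=> J; apply: regular_le rW J _ => x; rewrite /verts.
by rewrite !map_cat map_rev !count_cat !count_rev (mapK mK); count_lia.
Qed.

Lemma joint_mirror_core d y ys c P : joint d y ys c P ->
  joint c (m (last y ys)) (mirror m y ys) d P.
Proof.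
move=> J; apply: regular_le rW J _ => x; rewrite /verts mirror_cons.
by rewrite !map_cat map_rev !count_cat !count_rev (mapK mK); count_lia.
Qed.

Lemma joint_reverse d y ys c P : joint d y ys c P -> joint d y ys (rev (map m c)) P.
Proof.
move=> J; apply: regular_le rW J _ => x; rewrite /verts.
by rewrite !map_cat map_rev !count_cat !count_rev (mapK mK); count_lia.
Qed.

(** The last edge of the ear arrives at [a] itself, and [a] precedes [u]. The section from [a] to
    [u] followed by the ear is therefore a blossom with base [a], and [q1] leads to it from the
    terminal [d]. *)
Lemma ear_blossom_ordered d y ys c P q1 q2 q3 a u :
  terminal m W (m y) d -> path (alt_arc m) y (ys ++ c) -> joint d y ys c P ->
  ys ++ c = q1 ++ q2 ++ q3 -> last y q1 = a -> last a q2 = u ->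
  ear m u P (m a) -> hits m W P.
Proof.
move=> td pT J Eq Ea Eu [Pn]; rewrite rcons_path => /andP[uP la].
move: pT; rewrite Eq !cat_path Ea Eu => /and3P[p1 p2 _].
apply: (@hits_dumbbell _ _ d y q1 (q2 ++ P)) => //; last first.
  by move=> x xP; rewrite !mem_cat xP !orbT.
split=> //.
  apply: terminal_blossom; rewrite ?cat_path ?Ea ?Eu ?p2 //.
    by case: (q2) Pn.
  by rewrite last_cat Eu; move: la; rewrite /alt_arc /= mK.
apply: regular_le rW J _ => x; rewrite /verts.
have -> : (y :: ys) ++ c ++ P = (y :: q1) ++ q2 ++ q3 ++ P.
  by rewrite /= catA Eq -!catA.
by rewrite !map_cat !count_cat; count_lia.
Qed.

Lemma ear_blossom d y ys c P a u :
  terminal m W (m y) d -> path (alt_arc m) y (ys ++ c) -> joint d y ys c P ->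
  a \in y :: ys ++ c -> u \in y :: ys ++ c ->
  ear m u P (m a) -> hits m W P.
Proof.
move=> td pT J aT uT e.
have [q1 [q Eq Ea]] : exists q1, exists2 q, ys ++ c = q1 ++ q & last y q1 = a.
  by case/splitPl: aT => q1 q Ea; exists q1, q.
have : (u \in a :: q) || (u \in y :: q1).
  by move: uT; rewrite Eq -cat_cons mem_cat => /orP[->|uq]; rewrite ?orbT // inE uq !orbT.
case/orP=> [uq | uq1].
  case/splitPl: uq Eq => q2 q3 Eu Eq; exact: (ear_blossom_ordered td pT J Eq Ea Eu e).
apply: hits_mirror => //; have := ear_mirror mK e; rewrite mK => e'.
case/splitPl: uq1 Eq Ea => q2 q3 Eu; rewrite -catA last_cat Eu => Eq Ea.
exact: (ear_blossom_ordered td pT (joint_mirror J) Eq Eu Ea e').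
Qed.

End Ears.

End Dumbbells.

(** * Switching alternating cycles *)

Section Flips.
Variable G : sgraph.
Variables (m : G -> G) (W : {set G}).
Hypothesis rW : rooted m W.
Implicit Types (x y z u w a v : G) (s t p c d q P L T : seq G).

Let mK : involutive m. Proof. by case: rW. Qed.

(* x and y are consecutive on an alternating cycle switched from m to m'. *)
Definition linked (m' : G -> G) : rel G := [rel x y | (m' x == m y) && (m' (m y) == x)].

Lemma flip_cycle z s : path (alt_arc m) z (rcons s z) -> regular m W (z :: s) ->
  exists m', [/\ rooted m' W, forall x, x \in W -> m' x = m x,
    forall x, x \notin verts m (z :: s) -> m' x = m x &
    path (linked m') z (rcons s z)].
Proof.
move=> cyc /andP[uV /allP ZW]; have [_ Wm em] := rW.
set Z := z :: s in uV ZW *.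
have [uZ disj _] : [/\ uniq Z, ~~ has (mem Z) (map m Z) & uniq (map m Z)].
  by move: uV; rewrite cat_uniq => /and3P.
have mZ x : x \in Z -> m x \notin Z.
  move=> xZ; apply: contra disj => mxZ; apply/hasP; exists (m x) => //.
  by rewrite mem_map //; apply: inv_inj.
(* The unmatched edges of the cycle join each entry [x] to the mate of its successor; these become
   the matching edges. *)
pose m' x := if x \in Z then m (next Z x) else if m x \in Z then prev Z (m x) else m x.
have cycZ : cycle (alt_arc m) Z by [].
have offZ x : x \notin verts m Z -> m' x = m x.
  by rewrite mem_verts // negb_or /m' => /andP[/negPf -> /negPf ->].
have WZ x : x \in W -> x \notin verts m Z.
  move=> xW; rewrite mem_verts // negb_or; apply/andP; split; apply/negP => /ZW.
    by rewrite xW.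
  by rewrite Wm.
have linkZ x : x \in Z -> m' x = m (next Z x) /\ m' (m (next Z x)) = x.
  move=> xZ; rewrite {1}/m' xZ; split=> //.
  have nZ : next Z x \in Z by rewrite mem_next.
  by rewrite /m' (negPf (mZ _ nZ)) mK nZ prev_next.
exists m'; split=> //; first split.
- move=> x; have [xZ|xZ] := boolP (x \in Z).
    by have [-> ->] := linkZ x xZ.
  have [mxZ|mxZ] := boolP (m x \in Z).
    have pZ : prev Z (m x) \in Z by rewrite mem_prev.
    have -> : m' x = prev Z (m x) by rewrite /m' (negPf xZ) mxZ.
    by rewrite (linkZ _ pZ).1 next_prev // mK.
  have -> : m' x = m x by rewrite /m' (negPf xZ) (negPf mxZ).
  by rewrite /m' (negPf mxZ) mK (negPf xZ).
- by move=> x xW; rewrite offZ ?WZ // Wm.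
- move=> x xW; have [xZ|xZ] := boolP (x \in Z).
    by rewrite (linkZ x xZ).1; exact: (next_cycle cycZ xZ).
  have [mxZ|mxZ] := boolP (m x \in Z); last first.
    by rewrite /m' (negPf xZ) (negPf mxZ) em.
  rewrite /m' (negPf xZ) mxZ sedge_sym.
  by have := prev_cycle cycZ mxZ; rewrite /alt_arc /= mK.
- by move=> x xW; rewrite offZ ?WZ.
have := cycle_next uZ; rewrite /= -/Z; apply: (@sub_in_path _ (mem Z)).
  move=> x y xZ _ /eqP <-; have [E1 E2] := linkZ x xZ.
  by rewrite /linked /= E1 E2 !eqxx.
apply/allP => x; rewrite -rcons_cons mem_rcons inE => /orP[/eqP->|//]; exact: mem_head.
Qed.

Lemma linked_map m' x s : path (linked m') x s -> map m' (belast x s) = map m s.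
Proof. by elim: s x => //= y s IH x /andP[/andP[/eqP-> _] /IH ->]. Qed.

Lemma linked_map_belast m' x s : path (linked m') x s -> map m' (map m s) = belast x s.
Proof. by elim: s x => //= y s IH x /andP[/andP[_ /eqP->] /IH ->]. Qed.

(** After the switch the old matching edge of [y] is an unmatched edge from [y] to the new mate of
    the predecessor of [y], so the entries form an alternating walk in reverse order. *)
Lemma linked_rev m' x s : all (fun y => y \notin W) s -> path (linked m') x s ->
  path (alt_arc m') (last x s) (rev (belast x s)).
Proof.
have [_ _ em] := rW.
rewrite rev_path; elim: s x => //= y s IH x /andP[yW sW] /andP[/andP[/eqP E _] ys].
by rewrite IH // andbT /alt_arc /= E em.
Qed.

(** The opposite direction of travel on a switched section: the order is kept, and the entries are
    replaced by their old mates. *)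
Lemma linked_back m' e x s : all (fun y => y \notin W) s -> path (linked m') x s ->
  e -- x -> path (alt_arc m') e (map m s).
Proof.
have [_ _ em] := rW.
elim: s e x => //= y s IH e x /andP[yW sW] /andP[/andP[_ /eqP E] ys] ex.
rewrite {1}/alt_arc /= E ex; apply: IH ys _ => //.
by rewrite sedge_sym em.
Qed.

Lemma alt_arc_ext m' x s : {in s, m' =1 m} -> path (alt_arc m') x s = path (alt_arc m) x s.
Proof.
elim: s x => // y s IH x E; rewrite /= IH => [|u us]; last by apply: E; rewrite inE us orbT.
by rewrite /alt_arc /= E ?mem_head.
Qed.

Lemma terminal_ext m' y c : {in c, m' =1 m} -> terminal m' W y c = terminal m W y c.
Proof. by case: c => // z c E; rewrite /terminal alt_arc_ext. Qed.

Lemma off_verts X Z A : regular m W A ->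
  (forall x, count_mem x X + count_mem x Z <= count_mem x A) ->
  forall x, x \in X -> x \notin verts m Z.
Proof.
move=> /andP[uA _] le x xX; apply/negP => xZ.
have : count_mem x (verts m A) <= 1 by rewrite (count_uniq_mem _ uA); case: (_ \in _).
rewrite /verts count_cat.
have X1 : 0 < count_mem x X by rewrite -has_count has_pred1.
have := le x; move: xZ; rewrite mem_verts // => /orP[xZ|xZ].
  have Z1 : 0 < count_mem x Z by rewrite -has_count has_pred1.
  lia.
have Z1 : 0 < count_mem (m x) Z by rewrite -has_count has_pred1.
have : 0 < count_mem x (map m A).
  rewrite -has_count has_pred1 -[x]mK mem_map; last exact: inv_inj.
  by rewrite -has_pred1 has_count; have := le (m x); lia.
lia.
Qed.

Lemma count_last w s x : (last w s == x) <= count_mem x (w :: s).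
Proof.
rewrite (lastI w s) -cats1 count_cat /=; count_lia.
Qed.

Lemma hits_seq m' d T c P x0 : rooted m' W -> (forall x, x \in W -> m' x = m x) ->
  T != [::] -> sorted (alt_arc m') T -> terminal m' W (m' (head x0 T)) d ->
  terminal m' W (last x0 T) c -> regular m' W (d ++ T ++ c) ->
  {subset verts m P <= verts m' (d ++ T ++ c)} -> hits m W P.
Proof. by case: T => // y ys *; exists m', d, y, ys, c. Qed.

(** Here [w] comes after [u], so the ear is a detour that replaces the section [q2]. *)
Lemma bypass_stem d y ys c P q1 q2 q3 u w :
  dumbbell m W d y ys c -> joint m W d y ys c P ->
  ys = q1 ++ q2 ++ w :: q3 -> last y q1 = u -> ear m u P w -> hits m W P.
Proof.
case=> yys td tc _ J E Eu [Pn]; rewrite rcons_path => /andP[uP lw].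
move: yys; rewrite E !cat_path Eu => /and3P[p1 _ /= /andP[_ p3]].
have lE : last y ys = last y (q1 ++ P ++ w :: q3) by rewrite E !last_cat.
apply: (@hits_dumbbell _ _ _ d y (q1 ++ P ++ w :: q3) c) => //; last first.
  by move=> x xP; rewrite !(mem_cat, inE) xP !orbT.
split=> //; last first.
- apply: regular_le rW J _ => x; rewrite E /verts /= !map_cat /= !map_cat /= !count_cat /= !count_cat /=; count_lia.
- by rewrite -lE.
by rewrite !cat_path p1 Eu uP /= lw.
Qed.

Lemma bypass_loop d y ys c P q1 q2 q3 u w :
  dumbbell m W d y ys c -> joint m W d y ys c P ->
  c = q1 ++ q2 ++ w :: q3 -> last (last y ys) q1 = u -> ear m u P w -> hits m W P.
Proof.
case=> yys td tc _ J E Eu [Pn]; rewrite rcons_path => /andP[uP lw].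
have [pc lc] : path (alt_arc m) (last y ys) c /\ last (last y ys) c -- last y ys.
  by move: tc; rewrite E /terminal; case: q1 {E Eu} => [|? ?]; case: q2 => [|? ?] /andP[].
move: pc; rewrite E !cat_path Eu => /and3P[p1 _ /= /andP[_ p3]].
apply: (@hits_dumbbell _ _ _ d y ys (q1 ++ P ++ w :: q3)) => //; last first.
  by move=> x xP; rewrite !(mem_cat, inE) xP !orbT.
split=> //.
  apply: terminal_blossom; first by rewrite !cat_path p1 Eu uP /= lw.
    by case: (q1) => //; case: (P) Pn.
  by move: lc; rewrite E !last_cat.
apply: regular_le rW J _ => x; rewrite E /verts /= !map_cat /= !map_cat /= !count_cat /= !count_cat /=; count_lia.
Qed.

(* When w precedes u, the ear and the part of T from w to u form an alternating
   cycle; switching it lets T be rerouted through the reversed ear. *)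
Lemma flip_ear T (a2 T1 T3 P : seq G) u w (A : seq G) : T = T1 ++ (w :: a2) ++ T3 -> last w a2 = u ->
  path (alt_arc m) w a2 -> ear m u P w -> regular m W A ->
  (forall x, count_mem x T + count_mem x P <= count_mem x A) ->
  exists m', [/\ rooted m' W, forall x, x \in W -> m' x = m x,
    forall x, x \notin verts m (w :: a2 ++ P) -> m' x = m x,
    [/\ path (linked m') w a2, path (linked m') u (rcons P w) &
        all (fun y => y \notin W) ((w :: a2) ++ P)] &
    [/\ path (alt_arc m') (last u P) (rev (belast u P)),
        m' (last u P) = m w & map m' (u :: P) = map m (rcons P w)]].
Proof.
move=> TE Eu pa [Pn uPw] rA cA.
have rZ : regular m W (w :: a2 ++ P).
  apply: regular_le rW rA _ => x.
  have cm B : count_mem x (map m B) = count_mem (m x) B.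
    rewrite count_map; apply: eq_count => z /=; exact: (can2_eq mK mK).
  have le z : count_mem z (w :: a2 ++ P) <= count_mem z A.
    by apply: leq_trans (cA z); rewrite TE -cat_cons !count_cat; count_lia.
  rewrite /verts !count_cat !cm; exact: leq_add.
have [|m' [rW' Wm' off lk]] := flip_cycle _ rZ.
  by rewrite rcons_cat cat_path pa Eu.
exists m'; have aW : all (fun y => y \notin W) ((w :: a2) ++ P) by case/andP: rZ.
move: lk; rewrite rcons_cat cat_path Eu => /andP[la lP].
split=> //; have := lP; rewrite rcons_path => /andP[lP' /andP[/eqP lw _]].
split=> //; last by rewrite -(linked_map lP) belast_rcons.
by apply: linked_rev lP'; move: aW; rewrite all_cat => /andP[].
Qed.

Lemma last_rev x u s : last x (rev (u :: s)) = u.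
Proof. by rewrite rev_cons last_rcons. Qed.

Lemma rev_last u s : rev (u :: s) = last u s :: rev (belast u s).
Proof. by rewrite lastI rev_rcons. Qed.

Lemma flip_sub (m' : G -> G) u P w L : map m' (u :: P) = map m (rcons P w) ->
  {subset u :: P <= L} -> {subset verts m P <= verts m' L}.
Proof.
move=> mE sub x; rewrite mem_cat => /orP[xP|xP].
  by rewrite mem_cat sub // inE xP orbT.
have : x \in map m' (u :: P) by rewrite mE map_rcons mem_rcons inE xP orbT.
by case/mapP => z /sub zL ->; rewrite mem_cat map_f ?orbT.
Qed.

(** The new mate of [last u P] is [m w], so [T1] can enter the reversed ear where it used to
    continue to [w]. The reversed ear ends at [u], from which [T3] continues as before. *)
Lemma flip_route (m' : G -> G) T1 w (a2 : seq G) T3 u P x0 : last w a2 = u ->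
  sorted (alt_arc m) (T1 ++ (w :: a2) ++ T3) ->
  path (alt_arc m') (last u P) (rev (belast u P)) -> m' (last u P) = m w ->
  {in T1, m' =1 m} -> {in T3, m' =1 m} ->
  [/\ sorted (alt_arc m') (T1 ++ rev (u :: P) ++ T3),
      m' (head x0 (T1 ++ rev (u :: P) ++ T3)) = m (head x0 (T1 ++ (w :: a2) ++ T3)) &
      last x0 (T1 ++ rev (u :: P) ++ T3) = last x0 (T1 ++ (w :: a2) ++ T3)].
Proof.
move=> Eu srt pr ml E1 E3; split; last by rewrite !last_cat last_rev /= Eu.
  have p3 : path (alt_arc m) u T3 -> path (alt_arc m') (last u P) (rev (belast u P) ++ T3).
    rewrite cat_path pr -(alt_arc_ext _ E3).
    by have := last_rev u u P; rewrite rev_last /= => ->.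
  rewrite rev_last; case: T1 E1 srt => [_|y T1 E1] /=.
    by rewrite cat_path Eu => /andP[_ /p3].
  rewrite cat_path /= cat_path Eu => /and4P[p1 lw _ /p3 p3'].
  rewrite cat_path alt_arc_ext ?p1 /= => [|z zT]; last by apply: E1; rewrite inE zT orbT.
  by rewrite p3' andbT; move: lw; rewrite /alt_arc /= ml.
by rewrite rev_last; case: T1 E1 {srt} => [_|y T1 E1] //=; rewrite E1 ?mem_head.
Qed.

Lemma flip_stem d y ys c P T1 (a2 : seq G) T3 u w :
  dumbbell m W d y ys c -> joint m W d y ys c P ->
  y :: ys = T1 ++ (w :: a2) ++ T3 -> last w a2 = u -> ear m u P w -> hits m W P.
Proof.
case=> yys td tc _ J E Eu e.
have srt : sorted (alt_arc m) (T1 ++ (w :: a2) ++ T3) by rewrite -E.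
have pa : path (alt_arc m) w a2.
  move: srt; case: (T1) => [|z T'] /=; first by rewrite cat_path => /andP[].
  by rewrite cat_path /= cat_path => /and4P[].
have cA x : count_mem x (y :: ys) + count_mem x P <= count_mem x (d ++ (y :: ys) ++ c ++ P).
  by rewrite !count_cat; count_lia.
have [m' [rW' Wm' off _ [pr ml mE]]] := flip_ear E Eu pa e J cA.
have offX X : (forall x, count_mem x X <= count_mem x (d ++ T1 ++ T3 ++ c)) -> {in X, m' =1 m}.
  move=> le x xX; apply: off; apply: off_verts J _ _ xX => z; apply: leq_trans (leq_add (le z) (leqnn _)) _.
  by rewrite E !count_cat -cat_cons !count_cat; count_lia.
have [] := @flip_route m' T1 w a2 T3 u P y Eu srt pr ml _ _.
- by apply: offX => x; rewrite !count_cat; count_lia.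
- by apply: offX => x; rewrite !count_cat; count_lia.
rewrite -E /= => srt' hd lst.
apply: (@hits_seq m' d (T1 ++ rev (u :: P) ++ T3) c P y) => //.
- by case: (T1) => //; rewrite rev_last.
- by rewrite hd terminal_ext // => x xd; apply: offX xd => z; rewrite !count_cat; count_lia.
- by rewrite lst terminal_ext // => x xd; apply: offX xd => z; rewrite !count_cat; count_lia.
- apply: regular_le rW J _ => x; have := count_last w a2 x; rewrite Eu.
  have E1 : map m' (d ++ (T1 ++ rev (u :: P) ++ T3) ++ c) =
      map m d ++ (map m T1 ++ rev (map m (rcons P w)) ++ map m T3) ++ map m c.
    rewrite !map_cat map_rev mE; do !congr (_ ++ _); apply/eq_in_map; apply: offX => z;
    by rewrite !count_cat; count_lia.
  have cm B : count_mem x (map m B) = count_mem (m x) B.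
    rewrite count_map; apply: eq_count => z /=; exact: (can2_eq mK mK).
  have := count_last w a2 (m x); rewrite Eu.
  rewrite /verts E1 E !count_cat !count_rev !cm -cats1 !count_cat /=; count_lia.
apply: flip_sub mE _ => x xP; rewrite !mem_cat mem_rev xP; by rewrite !orbT.
Qed.

Lemma flip_loop d y ys c P T1 (a2 : seq G) T3 u w :
  dumbbell m W d y ys c -> joint m W d y ys c P ->
  c = T1 ++ (w :: a2) ++ T3 -> last w a2 = u -> ear m u P w -> hits m W P.
Proof.
case=> yys td tc _ J E Eu e; set b := last y ys.
have [pc lc] : path (alt_arc m) b c /\ last b c -- b.
  by move: tc; rewrite E /terminal; case: (T1) => [|? ?] /andP[].
(* The base is put in front so that the part before [w] is nonempty even when [T1] is empty, and the
   rerouted loop still starts at [b]. *)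
have srt : sorted (alt_arc m) ((b :: T1) ++ (w :: a2) ++ T3) by rewrite /= -E.
have pa : path (alt_arc m) w a2.
  by move: pc; rewrite E cat_path /= cat_path => /and4P[].
have cA x : count_mem x c + count_mem x P <= count_mem x (d ++ (y :: ys) ++ c ++ P).
  by rewrite !count_cat; count_lia.
have [m' [rW' Wm' off _ [pr ml mE]]] := flip_ear E Eu pa e J cA.
have offX X : (forall x, count_mem x X <= count_mem x (d ++ (y :: ys) ++ T1 ++ T3)) -> {in X, m' =1 m}.
  move=> le x xX; apply: off; apply: off_verts J _ _ xX => z; apply: leq_trans (leq_add (le z) (leqnn _)) _.
  by rewrite E !count_cat -cat_cons !count_cat; count_lia.
have [] := @flip_route m' (b :: T1) w a2 T3 u P y Eu srt pr ml _ _.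
- apply: offX => x; have := mem_last y ys; rewrite -/b => bY.
  have : (b == x) <= count_mem x (y :: ys) by have := count_last y ys x.
  by rewrite !count_cat /= ?count_cat /=; count_lia.
- by apply: offX => x; rewrite !count_cat; count_lia.
rewrite /= -E => srt' hd lst.
apply: (@hits_seq m' d (y :: ys) (T1 ++ rev (u :: P) ++ T3) P y) => //.
- rewrite /= alt_arc_ext // => x xs; apply: (offX (y :: ys)) => [z|]; last by rewrite inE xs orbT.
  by rewrite !count_cat; count_lia.
- have -> : m' (head y (y :: ys)) = m y.
    by apply: (offX (y :: ys)) (mem_head _ _) => z; rewrite !count_cat; count_lia.
  by rewrite terminal_ext // => x xd; apply: offX xd => z; rewrite !count_cat; count_lia.
- apply: terminal_blossom => //.
    by case: (T1) => //; rewrite rev_last.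
  by rewrite lst.
- apply: regular_le rW J _ => x; have := count_last w a2 x; rewrite Eu.
  have E1 : map m' (d ++ (y :: ys) ++ T1 ++ rev (u :: P) ++ T3) =
      map m d ++ map m (y :: ys) ++ (map m T1 ++ rev (map m (rcons P w)) ++ map m T3).
    rewrite !map_cat map_rev mE; do !congr (_ ++ _); apply/eq_in_map; apply: offX => z;
    by rewrite !count_cat; count_lia.
  have cm B : count_mem x (map m B) = count_mem (m x) B.
    rewrite count_map; apply: eq_count => z /=; exact: (can2_eq mK mK).
  have := count_last w a2 (m x); rewrite Eu.
  rewrite /verts E1 E !count_cat !count_rev !cm -cats1 !count_cat /=; count_lia.
apply: flip_sub mE _ => x xP; rewrite !mem_cat mem_rev xP; by rewrite !orbT.
Qed.

(* Switching the cycle moves the base of the blossom from last y ys to u; the new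
   blossom runs through c2, back to the old base, and through the mates of c1. *)
Lemma flip_stem_loop d y ys c P T1 (a2 : seq G) c1 c2 u w :
  dumbbell m W d y ys c -> joint m W d y ys c P ->
  y :: ys = T1 ++ w :: a2 -> c = c1 ++ c2 -> c1 != [::] -> last (last y ys) c1 = u ->
  ear m u P w -> hits m W P.
Proof.
case=> yys td tc _ J E Ec c1n; set b := last y ys => Eu e.
have bE : b = last w a2 by rewrite /b -[last y ys]/(last y (y :: ys)) E last_cat.
have [pc lc] : path (alt_arc m) b c /\ last b c -- b.
  by move: tc; rewrite Ec /terminal; case: (c1) c1n => // ? ? _ /andP[].
have [p1 p2] : path (alt_arc m) b c1 /\ path (alt_arc m) u c2.
  by move: pc; rewrite Ec cat_path Eu => /andP[].
have srt : sorted (alt_arc m) (T1 ++ w :: a2) by rewrite -E.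
have pa : path (alt_arc m) w (a2 ++ c1).
  rewrite cat_path -bE p1 andbT.
  by move: srt; case: (T1) => [|z T'] //=; rewrite !cat_path /= => /and3P[].
(* The cycle to be switched follows the stem from [w] to the base, the blossom along [c1] to [u],
   and then the ear. *)
have ET : (y :: ys) ++ c = T1 ++ (w :: a2 ++ c1) ++ c2 by rewrite E Ec /= -!catA.
have Eu' : last w (a2 ++ c1) = u by rewrite last_cat -bE.
have cA x : count_mem x ((y :: ys) ++ c) + count_mem x P <= count_mem x (d ++ (y :: ys) ++ c ++ P).
  by rewrite !count_cat; count_lia.
have srt2 : sorted (alt_arc m) (T1 ++ (w :: a2 ++ c1) ++ [::]).
  rewrite cats0 -cat_cons catA -E /= cat_path yys; exact: p1.
have [m' [rW' Wm' off [la lP aW] [pr ml mE]]] := flip_ear ET Eu' pa e J cA.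
have offX X : (forall x, count_mem x X <= count_mem x (d ++ T1 ++ c2)) -> {in X, m' =1 m}.
  move=> le x xX; apply: off; apply: off_verts J _ _ xX => z; apply: leq_trans (leq_add (le z) (leqnn _)) _.
  by rewrite E Ec !count_cat /= !count_cat /=; count_lia.
have [] := @flip_route m' T1 w (a2 ++ c1) [::] u P y Eu' srt2 pr ml _ _.
- by apply: offX => x; rewrite !count_cat; count_lia.
- by [].
rewrite !cats0 => srt' hd _.
have hdE : head y (T1 ++ w :: a2 ++ c1) = y by case: (T1) E => [|? ?] /= [].
have lc1 : path (linked m') b c1 by move: la; rewrite cat_path -bE => /andP[].
have aW1 : all (fun y => y \notin W) c1.
  by move: aW; rewrite /= !all_cat => /andP[_ /andP[/andP[_ ->]]].
apply: (@hits_seq m' d (T1 ++ rev (u :: P)) (c2 ++ map m c1) P y) => //.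
- by case: (T1) => //; rewrite rev_last.
- by rewrite hd hdE terminal_ext // => x xd; apply: offX xd => z; rewrite !count_cat; count_lia.
- rewrite last_cat last_rev; apply: terminal_blossom => //.
  + rewrite cat_path alt_arc_ext ?p2 /=; last by apply: offX => z; rewrite !count_cat; count_lia.
    by apply: linked_back aW1 lc1 _; move: lc; rewrite Ec last_cat Eu.
  + by case: (c2) => //; case: (c1) c1n.
  rewrite last_cat -Eu; have [_ _ em] := rW.
  case: (lastP c1) c1n aW1 => // c' z _; rewrite map_rcons !last_rcons all_rcons => /andP[zW _].
  by rewrite sedge_sym em.
- apply: regular_le rW J _ => x; have := count_last w a2 x; rewrite -bE.
  have E1 : map m' (d ++ (T1 ++ rev (u :: P)) ++ c2 ++ map m c1) =
      map m d ++ (map m T1 ++ rev (map m (rcons P w))) ++ map m c2 ++ belast b c1.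
    rewrite !map_cat map_rev mE (linked_map_belast lc1); do !congr (_ ++ _); apply/eq_in_map; apply: offX => z;
    by rewrite !count_cat; count_lia.
  have cm B : count_mem x (map m B) = count_mem (m x) B.
    rewrite count_map; apply: eq_count => z /=; exact: (can2_eq mK mK).
  have : count_mem x (belast b c1) + (u == x) = (b == x) + count_mem x c1.
    rewrite -[RHS]/(count_mem x (b :: c1)) lastI Eu -cats1 count_cat /=; count_lia.
  rewrite /verts E1 E Ec !count_cat !count_rev !cm -cats1 !count_cat /=; count_lia.
apply: flip_sub mE _ => x xP; rewrite !mem_cat mem_rev xP; by rewrite !orbT.
Qed.

End Flips.

(** * Ears on a dumbbell *)

Section Lifting.
Variable G : sgraph.
Implicit Types (m : G -> G) (W : {set G}).
Implicit Types (x y z u w a v : G) (s t p c d q P L T ys ps e : seq G).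

Section Ear.
Variables (m : G -> G) (W : {set G}).
Hypothesis rW : rooted m W.

Let mK : involutive m. Proof. by case: rW. Qed.

Lemma hits_sub P P' : hits m W P -> {subset P' <= verts m P} -> hits m W P'.
Proof.
move=> [m' [d [y [ys [c [rW' mW D sub]]]]]] sub'; exists m', d, y, ys, c; split=> // x.
rewrite (mem_verts _ _ mK) => /orP[]/sub'; first exact: sub.
by rewrite !(mem_verts _ _ mK) mK orbC -(mem_verts _ _ mK); apply: sub.
Qed.

Lemma dumbbell_path d y ys c : dumbbell m W d y ys c -> path (alt_arc m) y (ys ++ c).
Proof. by case=> p1 _ tc _; rewrite cat_path p1; case: c tc => //= ? ? /andP[]. Qed.

Lemma mem_revmap s x : (x \in rev (map m s)) = (m x \in s).
Proof. by rewrite mem_rev -{1}[x]mK mem_map //; apply: inv_inj. Qed.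

Lemma ear_stem d y ys c P u w : dumbbell m W d y ys c -> joint m W d y ys c P ->
  u \in y :: ys -> w \in y :: ys -> ear m u P w -> hits m W P.
Proof.
move=> D J uY wY e.
have [q1 [q2 Eq Eu]] : exists q1, exists2 q2, ys = q1 ++ q2 & last y q1 = u.
  by case/splitPl: uY => q1 q2 Eu; exists q1, q2.
move: wY; rewrite Eq -cat_cons mem_cat inE => /orP[/orP[/eqP E|wq]|wq].
- by apply: (@flip_stem _ _ _ rW d y ys c P [::] q1 q2 u w D J _ _ e); rewrite E ?Eq.
- case/splitPr: wq Eq Eu => a b Eq; rewrite last_cat /= => Eu.
  by apply: (@flip_stem _ _ _ rW d y ys c P (y :: a) b q2 u w D J _ _ e); rewrite //= Eq -catA.
case/splitPr: wq Eq => a b Eq.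
exact: (@bypass_stem _ _ _ rW d y ys c P q1 a b u w D J Eq Eu e).
Qed.

Lemma ear_loop d y ys c P u w : dumbbell m W d y ys c -> joint m W d y ys c P ->
  u \in c -> w \in c -> ear m u P w -> hits m W P.
Proof.
move=> D J uc wc e.
have [q1 [q2 Eq]] : exists q1 q2, c = rcons q1 u ++ q2.
  by case/path.splitP: uc => q1 q2; exists q1, q2.
move: wc; rewrite Eq mem_cat => /orP[wq|wq]; last first.
  case/splitPr: wq Eq => a b Eq.
  by apply: (@bypass_loop _ _ _ rW d y ys c P (rcons q1 u) a b u w D J Eq _ e); rewrite last_rcons.
have [a [b Ew]] : exists p s, rcons q1 u = p ++ w :: s by case/splitPr: wq => a b; exists a, b.
apply: (@flip_loop _ _ _ rW d y ys c P a b q2 u w D J _ _ e); first by rewrite Eq Ew -catA.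
by have := congr1 (last w) Ew; rewrite last_rcons last_cat.
Qed.

Lemma ear_stem_loop d y ys c P u w : dumbbell m W d y ys c -> joint m W d y ys c P ->
  w \in y :: ys -> u \in c -> ear m u P w -> hits m W P.
Proof.
move=> D J wY uc e.
have [q1 [q2 Eq]] : exists q1 q2, c = rcons q1 u ++ q2.
  by case/path.splitP: uc => q1 q2; exists q1, q2.
have [a [b Ew]] : exists p s, y :: ys = p ++ w :: s by case/splitPr: wY => a b; exists a, b.
apply: (@flip_stem_loop _ _ _ rW d y ys c P a b (rcons q1 u) q2 u w D J Ew Eq _ _ e).
  by case: (q1).
by rewrite last_rcons.
Qed.

(** Each of [u] and [w] lies on the stem, has its mate there, or lies in the blossom for one of its
    two orientations. Reversing the ear, the blossom or the whole dumbbell brings each combination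
    to a bypass, a flip or a new blossom. *)
Lemma ear_hits y ys c P u w : dumbbell m W [::] y ys c -> joint m W [::] y ys c P ->
  u \in verts m ((y :: ys) ++ c) -> w \in verts m ((y :: ys) ++ c) ->
  ear m u P w -> hits m W P.
Proof.
move=> D J; rewrite !(mem_verts _ _ mK) -!mem_revmap => uV wV e.
pose cc := rev (map m c).
have D' : dumbbell m W [::] y ys cc := dumbbell_reverse rW D.
have J' : joint m W [::] y ys cc P := joint_reverse rW J.
have td : terminal m W (m y) [::] by case: D.
have mcc x : (m x \in cc) = (x \in c) by rewrite /cc mem_revmap mK.
pose P' := rev (map m P).
have e' : ear m (m w) P' (m u) := ear_mirror mK e.
have JP : joint m W [::] y ys c P' := joint_mirror rW J.
have JP' : joint m W [::] y ys cc P' := joint_mirror rW J'.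
have hP' : hits m W P' -> hits m W P := @hits_mirror _ m W P mK.
have blos z : z \in y :: ys ++ c -> u \in y :: ys ++ c -> w = m z -> hits m W P.
  by move=> zT uT E; rewrite E in e; apply: (ear_blossom rW td (dumbbell_path D) J zT uT e).
have blos' z : z \in y :: ys ++ cc -> u \in y :: ys ++ cc -> w = m z -> hits m W P.
  by move=> zT uT E; rewrite E in e; apply: (ear_blossom rW td (dumbbell_path D') J' zT uT e).
have inY x : x \in y :: ys -> x \in y :: ys ++ c by rewrite -cat_cons mem_cat => ->.
have inY' x : x \in y :: ys -> x \in y :: ys ++ cc by rewrite -cat_cons mem_cat => ->.
have inC x : x \in c -> x \in y :: ys ++ c by rewrite -cat_cons mem_cat orbC => ->.
have inC' x : x \in cc -> x \in y :: ys ++ cc by rewrite -cat_cons mem_cat orbC => ->.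
have cases x : (x \in (y :: ys) ++ c) || (x \in rev (map m ((y :: ys) ++ c))) ->
    [\/ x \in y :: ys, m x \in y :: ys | x \in c \/ x \in cc].
  rewrite mem_revmap !mem_cat => /orP[]/orP[]; rewrite ?mem_cat; first by constructor 1.
  - by constructor 3; left.
  - by constructor 2.
  by move=> xc; constructor 3; right; rewrite /cc mem_revmap.
have wm : w = m (m w) by rewrite mK.
case: (cases u uV) => [uY|uY|uC]; case: (cases w wV) => [wY|wY|wC].
- exact: ear_stem D J uY wY e.
- by apply: (blos (m w)) => //; apply: inY.
- case: wC => wC; last by apply: (blos (m w)) => //; [apply: inC; rewrite -mcc mK | apply: inY].
  by apply: (blos' (m w)) => //; [apply: inC'; rewrite mcc | apply: inY'].
(* Seen from the end carrying [c], the entries of the stem are the mates of the former ones, so [u]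
   and [m w] both occur among them and the ear closes a blossom there. *)
- have D2 := dumbbell_mirror rW D; have J2 := joint_mirror_core rW J.
  have td2 : terminal m W (m (m (last y ys))) c by rewrite mK; case: D.
  have Y2 x : (x \in m (last y ys) :: mirror m y ys ++ [::]) = (m x \in y :: ys).
    by rewrite cats0 mirror_cons mem_revmap.
  rewrite wm in e; apply: (ear_blossom rW td2 (dumbbell_path D2) J2 _ _ e); rewrite Y2 //.
  by rewrite mK.
- by apply: hP'; apply: ear_stem D JP wY uY e'.
- case: wC => wC; last first.
    by apply: hP'; apply: (ear_stem_loop D JP uY _ e'); rewrite -mcc mK.
  by apply: hP'; apply: (ear_stem_loop D' JP' uY _ e'); rewrite mcc.
- by case: uC => uC; [apply: ear_stem_loop D J wY uC e | apply: ear_stem_loop D' J' wY uC e].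
- case: uC => uC; first by apply: (blos (m w)) => //; [apply: inY | apply: inC].
  by apply: (blos' (m w)) => //; [apply: inY' | apply: inC'].
case: uC => uC; case: wC => wC.
- exact: ear_loop D J uC wC e.
- by apply: (blos (m w)) => //; apply: inC; rewrite // -mcc mK.
- by apply: (blos' (m w)) => //; apply: inC'; rewrite // mcc.
- exact: ear_loop D' J' uC wC e.
Qed.

(* From any vertex of a dumbbell one leaves along its matching edge and follows
   the dumbbell to one of its ends. *)
Lemma dumbbell_exit d y ys c w : dumbbell m W d y ys c ->
  w \in verts m ((y :: ys) ++ c) ->
  exists s e, [/\ path (alt_arc m) w s, terminal m W (last w s) e &
    forall x, count_mem x (verts m (w :: s ++ e)) <= count_mem x (verts m (d ++ (y :: ys) ++ c))].
Proof.
move=> D; rewrite (mem_verts _ _ mK) !mem_cat -orbA => wV.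
have back c' : dumbbell m W d y ys c' -> m w \in y :: ys ++ c' ->
    exists s e, [/\ path (alt_arc m) w s, terminal m W (last w s) e &
    forall x, count_mem x (verts m (w :: s ++ e)) <= count_mem x (verts m (d ++ (y :: ys) ++ c'))].
  move=> D' wT; have [_ td _ _] := D'; have := dumbbell_path D'.
  have [q1 [q2 Eq Ew]] : exists q1, exists2 q2, ys ++ c' = q1 ++ q2 & last y q1 = m w.
    by case/splitPl: wT => q1 q2 Eu; exists q1, q2.
  rewrite Eq cat_path => /andP[p1 _]; have := arc_mirror mK p1; rewrite Ew mK => p1'.
  have lm := last_mirror m y q1; rewrite Ew mK in lm.
  exists (mirror m y q1), d; split=> //; first by rewrite lm.
  move=> x; have mc := mirror_cons m y q1; rewrite Ew mK in mc.
  have -> : (y :: ys) ++ c' = (y :: q1) ++ q2 by rewrite /= Eq.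
  rewrite -cat_cons mc /verts !map_cat map_rev !count_cat !count_rev (mapK mK); count_lia.
case/or4P: wV => wV.
- have [yys _ tc _] := D.
  have [q1 [q2 Eq Ew]] : exists q1, exists2 q2, ys = q1 ++ q2 & last y q1 = w.
    by case/splitPl: wV => q1 q2 Eu; exists q1, q2.
  exists q2, c; split.
  + by move: yys; rewrite Eq cat_path Ew => /andP[].
  + by move: tc; rewrite Eq last_cat Ew.
  move=> x; have := count_last y q1 x; rewrite Ew.
  have := count_last (m y) (map m q1) x; rewrite last_map Ew.
  rewrite Eq /verts /= !map_cat /= !map_cat !count_cat /= !count_cat; count_lia.
- have [|s [e [ps te le]]] := back _ (dumbbell_reverse rW D).
    by rewrite -cat_cons mem_cat mem_revmap mK wV orbT.
  exists s, e; split=> // x; apply: leq_trans (le x) _.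
  rewrite /verts !map_cat map_rev !count_cat !count_rev (mapK mK); count_lia.
- by apply: back => //; rewrite -cat_cons mem_cat wV.
by apply: back => //; rewrite -cat_cons mem_cat wV orbT.
Qed.

Section Lift.
Variables (y : G) (ys c : seq G).
Hypothesis D : dumbbell m W [::] y ys c.

Let S := (y :: ys) ++ c.

Definition enlarge : {set G} := W :|: [set x in verts m S].

Lemma enlargeP x : reflect (x \in W \/ x \in verts m S) (x \in enlarge).
Proof. by rewrite !inE; apply: orP. Qed.

Lemma enlarge_rooted : rooted m enlarge.
Proof.
have [_ Wm em] := rW; split=> // x; last first.
  by move=> xE; apply: em; apply: contra xE => xW; apply/enlargeP; left.
move=> /enlargeP[xW|xS]; apply/enlargeP; first by left; apply: Wm.
by right; move: xS; rewrite !(mem_verts _ _ mK) mK orbC.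
Qed.

Lemma regular_enlarge P : regular m enlarge P -> regular m W (S ++ P).
Proof.
move=> /andP[uP /allP PE]; have [_ _ _ /andP[uS SW]] := D.
have PW x : x \in P -> x \notin W.
  by move=> /PE; apply: contra => xW; apply/enlargeP; left.
apply/andP; split; last by rewrite all_cat SW; apply/allP.
have /perm_uniq -> : perm_eq (verts m (S ++ P)) (verts m S ++ verts m P).
  apply/allP => x _ /=; rewrite /verts map_cat; apply/eqP.
  rewrite !count_cat; count_lia.
rewrite cat_uniq uS uP andbT /=; apply/hasPn => x xP; apply/negP => xS.
have [_ Em _] := enlarge_rooted.
have xE : x \in enlarge by apply/enlargeP; right.
by move: xP; rewrite (mem_verts _ _ mK) => /orP[]/PE/negP[]; last apply: Em.
Qed.

Lemma terminal_enlarge x e : terminal m enlarge x e ->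
  terminal m W x e \/ (e = [::] /\ exists2 z, z \in verts m S & x -- z).
Proof.
case: e => [|z e]; last by left.
case/existsP=> z /andP[/enlargeP[zW|zS] xz]; last by right; split=> //; exists z.
by left; apply/existsP; exists z; rewrite zW.
Qed.

Lemma lift_exit d (p : G) ps : path (alt_arc m) p ps -> terminal m W (m p) d ->
  regular m enlarge (d ++ p :: ps) -> (exists2 z, z \in verts m S & last p ps -- z) ->
  hits m W (d ++ p :: ps).
Proof.
move=> pp td /regular_enlarge reg [z zS lz].
have [|s [e [ps_ te le]]] := dumbbell_exit (w := m z) D.
  by move: zS; rewrite !(mem_verts _ _ mK) mK orbC.
apply: (@hits_dumbbell _ _ _ d p (ps ++ m z :: s) e) => //; last first.
  by move=> x xP; rewrite -cat_cons -!catA catA mem_cat xP.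
split=> //.
- by rewrite cat_path pp /= /alt_arc /= mK lz.
- by rewrite last_cat.
apply: regular_le rW reg _ => x; have := le x.
rewrite /S /verts /= !map_cat /= !map_cat !count_cat /= !count_cat; count_lia.
Qed.

(** One end attached to the contracted dumbbell can be continued through it to a terminal. Two such
    ends might collide there; in that case the new path is treated as an ear. *)
Lemma lift_dumbbell d (p : G) ps (e : seq G) : dumbbell m enlarge d p ps e ->
  hits m W (d ++ (p :: ps) ++ e).
Proof.
move=> DP; have [pp td te reg] := DP; have [_ _ _ regS] := D.
have [tdW|[d0 [u uS pu]]] := terminal_enlarge td.
  have [teW|[e0 exz]] := terminal_enlarge te.
    apply: (@hits_dumbbell _ _ _ d p ps e) => //; split=> //.
    apply: regular_le rW (regular_enlarge reg) _ => x.
    rewrite /verts !map_cat !count_cat; count_lia.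
  by rewrite e0 cats0 in reg *; apply: lift_exit.
have [teW|[e0 [z zS lz]]] := terminal_enlarge te.
  have [pp' tdm tem regm] := dumbbell_mirror enlarge_rooted DP.
  rewrite d0 cats0 in regm *; rewrite cat0s; apply: (@hits_sub (e ++ m (last p ps) :: mirror m p ps)).
    apply: lift_exit => //; first by rewrite mK.
    by rewrite last_mirror; exists u.
  move=> x; rewrite (mem_verts _ _ mK) mirror_cons !mem_cat !mem_revmap mK.
  by case/orP=> ->; rewrite ?orbT.
rewrite d0 e0 cats0 in reg *; rewrite cat0s; apply: (ear_hits (u := u) (w := m z) D).
- by rewrite /joint cat0s catA; exact: (@regular_enlarge (p :: ps) reg).
- by [].
- by move: zS; rewrite !(mem_verts _ _ mK) mK orbC.
split=> //; rewrite rcons_path /= pp andbT /alt_arc /= mK lz andbT.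
by rewrite sedge_sym.
Qed.

End Lift.

End Ear.

(** * Existence of dumbbells, and dumbbells through a given vertex *)

Section Existence.
Variables (m : G -> G) (W : {set G}).
Hypothesis rW : rooted m W.

Let mK : involutive m. Proof. by case: rW. Qed.

(** A version of [reach] for walks that start at [W0] and then stay outside [W]. Keeping [W0] apart
    from [W] makes it possible to prescribe the vertex at which a dumbbell is attached. *)
Inductive reach_from (W0 : {set G}) : G -> Prop :=
| reach_from_root x w : x \notin W -> w \in W0 -> m x -- w -> reach_from W0 x
| reach_from_arc x z : reach_from W0 x -> alt_arc m x z -> z \notin W -> reach_from W0 z.

Lemma reach_from_off W0 x : reach_from W0 x -> x \notin W.
Proof. by case. Qed.

(* If no alternating path from W0 closes a blossom, these paths can always be
   extended, so that walks may be replaced by paths. *)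
Lemma dumbbell_exists (W0 : {set G}) x w : W0 \subset W -> reach_from W0 x -> w \in W -> x -- w ->
  exists y ys c, dumbbell m W [::] y ys c /\ exists2 w0, w0 \in W0 & m y -- w0.
Proof.
move=> W0W; pose goal := exists y ys c, dumbbell m W [::] y ys c /\ exists2 w0, w0 \in W0 & m y -- w0.
have root y w0 : w0 \in W0 -> m y -- w0 -> terminal m W (m y) [::].
  by move=> w0W yw; apply/existsP; exists w0; rewrite (subsetP W0W).
have [_ Wm em] := rW.
have paths z : reach_from W0 z -> goal \/ exists y ys w0, [/\ path (alt_arc m) y ys,
    last y ys = z, regular m W (y :: ys), w0 \in W0 & m y -- w0].
  elim=> {z} [z w0 zW w0W zw | z z' _ [|[y [ys [w0 [yys lz reg w0W yw]]]]] zz' z'W]; [|by left|].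
    right; exists z, [::], w0; split=> //; rewrite /regular /= zW !andbT inE.
    by apply: edge_neq; apply: em.
  have [z'Y|z'Y] := boolP (z' \in y :: ys).
    right; case/splitPl: z'Y yys lz reg => q1 q2 E; rewrite cat_path => /andP[p1 _] _ reg.
    exists y, q1, w0; split=> //.
    apply: regular_le rW reg _ => v; rewrite /verts /= !map_cat !count_cat; count_lia.
  have [mz'Y|mz'Y] := boolP (m z' \in y :: ys); last first.
    right; exists y, (rcons ys z'), w0; split=> //.
    - by rewrite rcons_path yys lz.
    - by rewrite last_rcons.
    case/andP: reg => uY aY; rewrite -rcons_cons; apply/andP; split; last by rewrite all_rcons z'W.
    have /perm_uniq -> : perm_eq (verts m (rcons (y :: ys) z')) ([:: z'; m z'] ++ verts m (y :: ys)).
      apply/allP => v _ /=; rewrite /verts map_rcons -!cats1; apply/eqP.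
      rewrite /= !count_cat /=; count_lia.
    have z'V : z' \notin verts m (y :: ys) by rewrite (mem_verts _ _ mK) negb_or z'Y mz'Y.
    have mz'V : m z' \notin verts m (y :: ys) by rewrite (mem_verts _ _ mK) mK negb_or z'Y mz'Y.
    move: (verts m (y :: ys)) uY z'V mz'V => V uY z'V mz'V.
    by rewrite /= inE negb_or (edge_neq (em _ z'W)) z'V mz'V.
  (* The path meets the next matching edge from the wrong side: the edge from [z] to [m z'] returns
     to the entry [m z'] and closes a blossom with that base. *)
  left; case/splitPl: mz'Y yys lz reg => q1 q2 E; rewrite cat_path last_cat E => /andP[p1 p2] lz reg.
  exists y, q1, q2; split; last by exists w0.
  split=> //; first exact: root w0W yw.
  rewrite E; apply: terminal_blossom p2 _ _; last by rewrite lz.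
  by apply: contraTneq zz' => q2E; rewrite q2E /= in lz; rewrite -lz /alt_arc /= sedge_irr.
move=> /paths[//|[y [ys [w0 [yys lx reg w0W yw]]]]] wW xw.
exists y, ys, [::]; split; last by exists w0.
split; rewrite ?cats0 //; first exact: root w0W yw.
by rewrite lx; apply/existsP; exists w; rewrite wW.
Qed.

(* Reversing the walk to m v. *)
Lemma reach_from_back W0 W1 v z : reach_from W0 v -> reach_from W1 z -> m z = v ->
  exists2 x, reach_from W0 x & exists2 w, w \in W1 & x -- w.
Proof.
have [_ Wm em] := rW.
move=> rv rz; elim: rz v rv => {z} [z w zW wW zw v rv E | z z' rz IH zz' z'W v rv E].
  by exists v => //; exists w => //; rewrite -E.
apply: (IH (m z)) => //; apply: reach_from_arc rv _ _.
  by rewrite -E /alt_arc /= mK sedge_sym.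
by apply: contra (reach_from_off rz) => mzW; rewrite -[z]mK; apply: Wm.
Qed.

End Existence.

(** The walk to [v], continued by the reversed walk to [m v], joins [W] to [W], so a dumbbell
    exists. If it avoids [v], both walks persist for the enlarged set, whose complement is
    smaller. *)
Theorem dumbbell_through m W v : rooted m W -> reach_from m W W v -> reach_from m W W (m v) ->
  hits m W [:: v].
Proof.
have [k] := ubnP #|~: W|; elim: k m W => // k IH m W leW rW rv rmv.
have [mK Wm em] := rW.
have [x rx [w wW xw]] := reach_from_back rW rv rmv (mK v).
have [y [ys [c [D _]]]] := dumbbell_exists rW (subxx W) rx wW xw.
have [vS|vS] := boolP (v \in verts m ((y :: ys) ++ c)).
  exists m, [::], y, ys, c; split=> // z; rewrite (mem_verts [:: v] z mK) !mem_seq1 => /orP[]/eqP zv.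
    by rewrite zv.
  by move: vS; rewrite -zv !(mem_verts _ _ mK) mK orbC.
have rE := enlarge_rooted rW y ys c.
pose W' := enlarge m W y ys c.
have reachE z : reach_from m W W z -> z \notin W' -> reach_from m W' W' z.
  elim=> {z} [z u zW uW zu | z z' _ IHz zz' z'W] zE.
    by apply: reach_from_root zE _ zu; apply/enlargeP; left.
  have [zW|zW] := boolP (z \in W'); last exact: reach_from_arc (IHz zW) zz' zE.
  by apply: reach_from_root zE zW _; rewrite sedge_sym.
have vE : v \notin W'.
  by apply/enlargeP => -[vW|]; [have := reach_from_off rv; rewrite vW | apply/negP].
have mvE : m v \notin W'.
  by apply: contra vE => mvE; rewrite -[v]mK; have [_ Em _] := rE; apply: Em.
have [] := IH m W' _ rE (reachE _ rv vE) (reachE _ rmv mvE).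
  rewrite -ltnS; apply: leq_trans leW; rewrite ltnS; apply: proper_card; apply/properP; split.
    by rewrite setCS; apply/subsetP => z zW; apply/enlargeP; left.
  have [_ _ _ /andP[_ aW]] := D.
  exists y; first by rewrite inE; case/andP: aW.
  by rewrite inE negbK; apply/enlargeP; right; rewrite !inE eqxx.
move=> m1 [d [p [ps [e [rE1 mE DP sub]]]]].
have rW1 : rooted m1 W.
  have [m1K _ em1] := rE1; split=> // z zW.
    by rewrite mE ?Wm //; apply/enlargeP; left.
  have [zE|zE] := boolP (z \in W'); last exact: em1.
  by rewrite mE // em.
(* The matching [m1] from the induction agrees with [m] on the enlarged set, which contains all
   vertices of the contracted dumbbell. *)
have D1 : dumbbell m1 W [::] y ys c.
  by apply: dumbbell_ext D => z zS; apply: mE; apply/enlargeP; right.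
have EE : enlarge m1 W y ys c = W'.
  apply/setP => z; rewrite !inE; congr (_ || _).
  have mem1 : map m1 (y :: ys ++ c) = map m (y :: ys ++ c).
    by apply/eq_in_map => u uS; apply: mE; apply/enlargeP; right; rewrite mem_cat uS.
  by rewrite /verts !mem_cat mem1.
rewrite -EE in DP.
have [m2 [d2 [q [qs [e2 [rW2 mE2 D2 sub2]]]]]] := lift_dumbbell rW1 D1 DP.
exists m2, d2, q, qs, e2; split=> //; first by move=> z zW; rewrite mE2 ?mE //; apply/enlargeP; left.
move=> z zv; apply: sub2; exact: sub.
Qed.

End Lifting.

(** * Core vertices lie in flowers or posies *)

Section Realization.
Variable G : sgraph.
Variable m : G -> G.
Implicit Types (x y z u w b v : G) (s p c d ys : seq G).
Hypothesis mm : is_mate m.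

Let mK : involutive m. Proof. by case: mm. Qed.
Let em x : m x != x -> x -- m x. Proof. by case: mm => _; apply. Qed.

Let M := edge_set m.
Let W := exposed m.

Lemma exposed_rooted : rooted m W.
Proof.
split=> // x; rewrite inE; last exact: em.
by move=> /eqP mx; rewrite inE !mx.
Qed.

Lemma zig_perm s : perm_eq (zig m s) (verts m s).
Proof.
elim: s => // y s IH; rewrite /verts /= -cat1s (perm_catCA [:: m y] [:: y]) /= perm_cons.
rewrite -cat1s -[m y :: map m s]cat1s perm_sym perm_catCA /= perm_cons perm_sym; exact: IH.
Qed.

Lemma mem_zig s : zig m s =i verts m s.
Proof. exact: perm_mem (zig_perm s). Qed.

Lemma uniq_zig s : uniq (zig m s) = uniq (verts m s).
Proof. exact: perm_uniq (zig_perm s). Qed.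

Lemma path_zigE x s : (forall y, y \in s -> m y != y) ->
  path (@sedge G) x (zig m s) = path (alt_arc m) x s.
Proof.
elim: s x => //= y s IH x sat; rewrite sedge_sym IH => [|z zs]; last by apply: sat; rewrite inE zs orbT.
by rewrite sedge_sym [m y -- y]sedge_sym em ?sat ?mem_head.
Qed.

Lemma path_zig_mem (e : rel G) x s : path e x (zig m s) -> forall y, y \in s -> e (m y) y.
Proof.
elim: s x => //= y s IH x /and3P[_ my ps] z; rewrite inE => /orP[/eqP-> //|]; exact: IH ps z.
Qed.

Lemma zig_blossom b s : path (alt_arc m) b s -> last b s -- b -> s != [::] ->
  regular m W s -> b \notin verts m s -> m b \notin verts m s ->
  blossom M (b :: zig m s) /\ base M (b :: zig m s) b.
Proof.
move=> bs lb sn /andP[us sW] bV mbV; set C := b :: zig m s.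
have sat y : y \in s -> m y != y by move=> ys; have /allP/(_ y ys) := sW; rewrite inE.
have uC : uniq C by rewrite /C /= uniq_zig us mem_zig bV.
have cC : cycle (@sedge G) C.
  by rewrite /C /= rcons_path last_zig lb path_zigE // bs.
have nxt y : y \in s -> next C (m y) = y.
  have := cycle_next uC; rewrite /C /= rcons_path => /andP[p _].
  by move=> ys; apply/eqP; exact: (path_zig_mem p ys).
have E : cycle_edges C :&: M = [set [set m y; y] | y in s].
  apply/setP => e; rewrite inE; apply/andP/imsetP => [[/imsetP[x xC ->]]|[y ys ->]].
    rewrite edge_set_in // => /andP[/eqP mx nx].
    move: xC; rewrite inE => /orP[/eqP E|].
      have : m x \in C by rewrite mx mem_next E mem_head.
      rewrite E inE => /orP[/eqP mb|]; last by rewrite mem_zig (negPf mbV).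
      by move: nx; rewrite -mx E mb eqxx.
    rewrite mem_zig (mem_verts _ _ mK) => /orP[xs|xs].
      by exists x => //; rewrite mx setUC.
    by exists (m x) => //; rewrite mK mx.
  split.
    apply/imsetP; exists (m y); last by rewrite nxt.
    by rewrite inE mem_zig (mem_verts _ _ mK) mK ys !orbT.
  by rewrite edge_set_in // mK eqxx sat.
have cE : #|cycle_edges C :&: M| = size s.
  rewrite E card_in_imset; last first.
    move=> y z ys zs /setP/(_ y); rewrite !inE eqxx orbT => /esym/orP[|] /eqP // yz.
    have : ~~ has (mem s) (map m s) by move: us; rewrite cat_uniq => /and3P[].
    by case/hasP; exists y => //; rewrite yz map_f.
  by apply/card_uniqP; move: us; rewrite cat_uniq => /andP[].
split; last first.
  rewrite /base mem_head E; apply/bigcupP => -[e /imsetP[y ys ->]].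
  rewrite !inE => /orP[]/eqP E'; case/negP: bV; rewrite (mem_verts _ _ mK) E' ?mK ys ?orbT //.
rewrite /blossom /is_cycle /ucycleb cC uC cE /C /= size_zig /= odd_double uphalf_double eqxx andbT /=.
by case: (s) sn => //= ? ? _; rewrite doubleS.
Qed.

Lemma in_setM x y : ([set x; y] \in M) = (m x == y) && (x != y).
Proof. exact: edge_set_in. Qed.

Lemma zig_cons y s : zig m (y :: s) = [:: m y, y & zig m s].
Proof. by []. Qed.

Lemma alternatingE x y z p : alternating M x [:: y, z & p] =
  (([set x; y] \in M) (+) ([set y; z] \in M)) && alternating M y (z :: p).
Proof. by []. Qed.

Lemma zig_alternating x s : uniq (x :: s) -> (forall y, y \in s -> m y != y) ->
  alternating M x (zig m s).
Proof.
elim: s x => //= y s IH x /and3P[xs ys us] sat.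
have al := IH y; rewrite /= ys us /= in al.
have {}al := al isT (fun z zs => sat z (mem_behead (s := y :: s) zs)).
move: xs; rewrite inE negb_or => /andP[xy xs].
have E1 : [set x; m y] \in M = false.
  by rewrite in_setM (inj_eq (inv_inj mK)) (negPf xy).
have E2 : [set m y; y] \in M by rewrite in_setM mK eqxx sat ?mem_head.
case: s IH ys us sat al xs => [|z s] _ ys us sat al xs; first by rewrite /alternating /= E1 E2.
rewrite !zig_cons in al *; rewrite alternatingE E1 alternatingE E2 al andbT in_setM (inj_eq (inv_inj mK)).
by move: ys; rewrite inE negb_or => /andP[/negPf ->].
Qed.

Lemma zig_mm_path y s : path (alt_arc m) y s -> regular m W (y :: s) ->
  mm_path M (m y) (y :: zig m s).
Proof.
move=> ys /andP[uV sW].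
have sat z : z \in y :: s -> m z != z by move=> zs; have /allP/(_ z zs) := sW; rewrite inE.
have E2 : [set m y; y] \in M by rewrite in_setM mK eqxx sat ?mem_head.
have uys : uniq (y :: s) by move: uV; rewrite cat_uniq => /andP[].
have sat' z : z \in s -> m z != z by move=> zs; apply: sat; rewrite inE zs orbT.
have al := zig_alternating uys sat'.
apply/and5P; split=> //.
- have uz : uniq (m y :: y :: zig m s) by rewrite -[_ :: _]/(zig m (y :: s)) uniq_zig.
  by rewrite /is_path uz andbT /= path_zigE // ys sedge_sym em // sat ?mem_head.
- case: (s) uys al => [|z s'] // ; rewrite cons_uniq inE negb_or => /andP[/andP[yz _] _].
  by rewrite zig_cons => al; rewrite alternatingE al E2 in_setM (inj_eq (inv_inj mK)) (negPf yz).
rewrite /path_edges /=; elim: (s) (y) E2 sat' => //= z s' IH x xM sat'.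
apply: IH; first by rewrite in_setM mK eqxx sat' ?mem_head.
by move=> u us; apply: sat'; rewrite inE us orbT.
Qed.

Lemma path_edges_rev x p : path_edges (last x p) (rev (belast x p)) = rev (path_edges x p).
Proof.
elim: p x => //= y p IH x; rewrite rev_cons /path_edges -cats1 pairmap_cat -/(path_edges _ _) IH.
rewrite /= rev_cons -cats1; congr (_ ++ [:: _]).
have -> : last (last y p) (rev (belast y p)) = y.
  by case: p {IH} => //= z p; rewrite rev_cons last_rcons.
exact: setUC.
Qed.

Lemma zig_stem u s : m u = u -> path (alt_arc m) u s -> regular m W s ->
  stem M (last u s) (rev (belast u (zig m s))).
Proof.
move=> mu us /andP[uV sW].
have sat z : z \in s -> m z != z by move=> zs; have /allP/(_ z zs) := sW; rewrite inE.
have uVu : u \notin verts m s.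
  by rewrite (mem_verts _ _ mK) mu orbb; apply/negP => /sat; rewrite mu eqxx.
have uus : uniq (u :: s).
  move: uV uVu; rewrite cat_uniq (mem_verts _ _ mK) negb_or /= => /andP[-> _] /andP[-> _] //.
have lz := last_zig m u s.
have lr : last (last u s) (rev (belast u (zig m s))) = u.
  by rewrite -lz; case: (zig m s) => //= z p; rewrite rev_cons last_rcons.
apply/and4P; split.
- rewrite /is_path -lz; have -> : last u (zig m s) :: rev (belast u (zig m s)) = rev (u :: zig m s).
    by rewrite (lastI u) rev_rcons.
  rewrite rev_uniq /= mem_zig uVu uniq_zig uV rev_path.
  rewrite (eq_path (e' := @sedge G)); first by rewrite path_zigE // us.
  by move=> x y; apply: sedge_sym.
- rewrite /alternating -lz path_edges_rev rev_sorted.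
  rewrite (eq_sorted (e' := fun e f => (e \in M) (+) (f \in M))) //.
    exact: zig_alternating.
  by move=> e f; rewrite addbC.
- by rewrite size_rev size_belast size_zig odd_double.
rewrite lr /saturated; have := exposed_mate_of (edge_set_matching mm).
by move/setP/(_ u); rewrite !inE edge_setK // mu eqxx => /esym ->.
Qed.

Hypothesis om : opt_on [set: G] m.

Lemma flower_SD c b s v : Tflower M c b s -> v \in c ++ b :: s -> v \in SD G.
Proof.
move=> F vF; rewrite inE; apply/asboolP; exists M; split; first exact: opt_max.
by left; exists c, b, s.
Qed.

Lemma posy_SD c1 c2 b p v : Tposy M c1 c2 b p -> v \in c1 ++ c2 ++ b :: p -> v \in SD G.
Proof.
move=> F vF; rewrite inE; apply/asboolP; exists M; split; first exact: opt_max.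
by right; exists c1, c2, b, p.
Qed.

Lemma regular_cat s1 s2 : regular m W (s1 ++ s2) ->
  [/\ regular m W s1, regular m W s2 & forall x, x \in verts m s1 -> x \notin verts m s2].
Proof.
move=> reg; have rW := exposed_rooted.
have reg1 : regular m W s1.
  apply: regular_le rW reg _ => x; rewrite /verts !map_cat !count_cat; count_lia.
have reg2 : regular m W s2.
  apply: regular_le rW reg _ => x; rewrite /verts !map_cat !count_cat; count_lia.
split=> // x x1; apply/negP => x2; case/andP: reg => + _.
rewrite -uniq_zig zig_cat cat_uniq => /and3P[_ /hasP[]].
by exists x; rewrite ?mem_zig.
Qed.

Lemma exposed_off u s : u \in W -> regular m W s -> u \notin verts m s.
Proof.
move=> uW /andP[_ /allP sW]; have mu : m u = u by apply/exposedP.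
by rewrite (mem_verts _ _ mK) mu orbb; apply/negP => /sW; rewrite uW.
Qed.

(** With both ends attached to the same exposed vertex, the path closes to a blossom with base [u],
    and the stem has length zero. *)
Lemma loop_SD u y ys v : u \in W -> path (alt_arc m) y ys -> m y -- u -> last y ys -- u ->
  regular m W (y :: ys) -> v \in u :: verts m (y :: ys) -> v \in SD G.
Proof.
move=> uW yys yu lu reg vV; have mu : m u = u by apply/exposedP.
have uV := exposed_off uW reg.
have [||||bl ba] := @zig_blossom u (y :: ys) _ _ _ reg uV; rewrite ?mu //.
  by rewrite /= yys andbT /alt_arc /= sedge_sym.
apply: (@flower_SD (u :: zig m (y :: ys)) u [::]); last first.
  by rewrite mem_cat in_cons mem_zig; move: vV; rewrite in_cons => ->.
split=> //; first exact: (@zig_stem u [::]).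
move=> x; rewrite mem_seq1; apply/andP/eqP => [[_ /eqP //]|->].
by rewrite mem_head eqxx.
Qed.

Lemma stem_SD u y ys c v : u \in W -> path (alt_arc m) y ys -> m y -- u ->
  terminal m W (last y ys) c -> c != [::] ->
  regular m W ((y :: ys) ++ c) -> v \in u :: verts m ((y :: ys) ++ c) -> v \in SD G.
Proof.
move=> uW yys yu tc cn reg vV; have mu : m u = u by apply/exposedP.
have [reg1 reg2 disj] := regular_cat reg; have uV := exposed_off uW reg.
set b := last y ys in tc *.
have [pc lc] : path (alt_arc m) b c /\ last b c -- b.
  by move: tc; rewrite /terminal; case: (c) cn => // ? ? _ /andP[].
have bY : b \in y :: ys := mem_last y ys.
have bV : b \notin verts m c by apply: disj; rewrite mem_cat bY.
have mbV : m b \notin verts m c by apply: disj; rewrite (mem_verts _ _ mK) mK bY orbT.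
have [bl ba] := zig_blossom pc lc cn reg2 bV mbV.
have uY : path (alt_arc m) u (y :: ys) by rewrite /= yys andbT /alt_arc /= sedge_sym.
have st := zig_stem mu uY reg1; rewrite -/b /= -/b in st.
have mems x : (x \in b :: rev (belast u (zig m (y :: ys)))) = (x \in u :: zig m (y :: ys)).
  have -> : b = last u (zig m (y :: ys)) by rewrite last_zig.
  by rewrite -[_ :: _]rev_rcons -lastI mem_rev.
apply: (@flower_SD (b :: zig m c) b (rev (belast u (zig m (y :: ys))))); last first.
  rewrite mem_cat mems [v \in b :: _]in_cons [v \in u :: _]in_cons; move: vV; rewrite in_cons -mem_zig zig_cat mem_cat.
  by case/or3P=> ->; rewrite ?orbT.
split=> // x; rewrite mems; apply/andP/eqP => [[]|->].
  rewrite inE => /orP[/eqP //|]; rewrite mem_zig => xc; rewrite inE mem_zig => /orP[/eqP E|/disj].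
    move: uV; rewrite -E (mem_verts _ _ mK) !mem_cat; move: xc; rewrite (mem_verts _ _ mK).
    by case/orP=> ->; rewrite ?orbT.
  by rewrite xc.
by rewrite mem_head inE mem_zig mem_cat bY orbT.
Qed.

Lemma bridge_SD d y ys c v : dumbbell m W d y ys c -> d != [::] -> c != [::] ->
  v \in verts m (d ++ (y :: ys) ++ c) -> v \in SD G.
Proof.
move=> [yys td tc reg] dn cn vV; set b := last y ys in tc.
have [pc lc] : path (alt_arc m) b c /\ last b c -- b.
  by move: tc; rewrite /terminal; case: (c) cn => // ? ? _ /andP[].
have [pd ld] : path (alt_arc m) (m y) d /\ last (m y) d -- m y.
  by move: td; rewrite /terminal; case: (d) dn => // ? ? _ /andP[].
have [regd regYc disjd] := regular_cat reg.
have [regY regc disj] := regular_cat regYc.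
have bY : b \in y :: ys := mem_last y ys.
have YV x : x \in verts m (y :: ys) -> x \notin verts m c /\ x \notin verts m d.
  move=> xY; split; first exact: disj.
  by apply/negP => /disjd; rewrite (mem_verts _ _ mK) !mem_cat; move: xY;
     rewrite (mem_verts _ _ mK) => /orP[]->; rewrite ?orbT.
have Y1 x : x \in y :: ys -> x \in verts m (y :: ys) by move=> xY; rewrite mem_cat xY.
have Y2 x : x \in y :: ys -> m x \in verts m (y :: ys).
  by move=> xY; rewrite (mem_verts _ _ mK) mK xY orbT.
have bb := zig_blossom pc lc cn regc (YV _ (Y1 _ bY)).1 (YV _ (Y2 _ bY)).1.
have yY := mem_head y ys.
have bd : blossom M (m y :: zig m d) /\ base M (m y :: zig m d) (m y).
  by apply: zig_blossom; rewrite ?mK ?(YV _ (Y1 _ yY)).2 ?(YV _ (Y2 _ yY)).2.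
have mmp := zig_mm_path yys regY.
have disjc : [disjoint m y :: zig m d & b :: zig m c].
  rewrite disjoint_has; apply/hasPn => x; rewrite !inE negb_or !mem_zig => /orP[/eqP->|xd].
    rewrite (YV _ (Y2 _ yY)).1 andbT; apply: contraTneq regY => E.
    apply/negP => /andP[]; rewrite cat_uniq => /and3P[_ /hasP[]]; exists (m y).
      by rewrite map_f.
    by rewrite /= E.
  have xYc := disjd _ xd; apply/andP; split.
    by apply: contraNneq xYc => ->; rewrite mem_cat mem_cat bY.
  apply: contra xYc; rewrite !(mem_verts _ _ mK) !mem_cat => /orP[]->; by rewrite ?orbT.
apply: (@posy_SD (m y :: zig m d) (b :: zig m c) (m y) (y :: zig m ys)); last first.
  move: vV; rewrite -mem_zig !zig_cat zig_cons !mem_cat !inE.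
  by do !case/orP; move=> ->; rewrite ?orbT.
split=> //.
- by rewrite /= last_zig.
- have uzY : uniq (m y :: y :: zig m ys).
    by rewrite -zig_cons uniq_zig; case/andP: regY.
  move=> x xI; have xB : x \in y :: zig m ys.
    by move: xI; rewrite /=; apply: mem_belast.
  have xV : x \in verts m (y :: ys) by rewrite -mem_zig zig_cons inE xB orbT.
  have [xc xd] := YV _ xV.
  rewrite !inE !mem_zig !negb_or xc xd !andbT; split.
    by case/andP: uzY => + _; apply: contraNneq => <-.
  have: uniq (y :: zig m ys) by case/andP: uzY.
  rewrite lastI last_zig rcons_uniq -/b => /andP[bB _].
  by apply: contraNneq bB => <-.
by left.
Qed.

End Realization.

(** Rather than augmenting at once, slide the exposed end: matching [u] with [m y] exposes [y]
    instead, keeps optimality and shortens the path, until an edge joins two exposed vertices. *)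
Lemma no_augmenting (G : sgraph) (m : G -> G) u (s : seq G) w : opt_on [set: G] m ->
  m u = u -> m w = w -> u != w -> path (alt_arc m) u s -> last u s -- w ->
  regular m (exposed m) s -> False.
Proof.
elim: s m u => [|y s IH] m u om mu mw uw.
  by move=> _ uw' _; apply: (opt_edge om _ _ uw' mu mw); rewrite inE.
move=> /andP[uy ys] lw /andP[uV /andP[yW sW]]; have mm := om.1.1; have [mK em] := mm.
have {}uy : u -- m y := uy.
have myy : m y != y by rewrite inE in yW.
have fixd x : m x = x -> [/\ x != y & x != m y].
  move=> mx; split; apply: contraNneq myy => E; first by rewrite -E mx.
  by rewrite -E -mx E mK.
have [uny unmy] := fixd u mu; have [wny wnmy] := fixd w mw.
set m1 := rejoin m u (m y).
have o1 : opt_on [set: G] m1.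
  apply: opt_same om (rejoin_mate om.1 _ _ uy) _; rewrite ?inE //.
  have uE : u \in exposed m by rewrite inE mu.
  have sub : exposed m1 \subset y |: (exposed m :\ u).
    apply/subsetP => x; rewrite (exposed_rejoin mm unmy) mu mK !inE.
    by case: (x == y); case: (x == u); case: (x == m y); case: (m x == x).
  by rewrite [X in _ <= X](cardsD1 u) uE; apply: leq_trans (subset_leq_card sub) _; rewrite cardsU1 leq_add2r leq_b1.
have m1y : m1 y = y.
  by rewrite /m1 /rejoin eq_sym (negPf uny) eq_sym (negPf myy) mK eqxx orbT.
have m1w : m1 w = w.
  rewrite /m1 /rejoin eq_sym (negPf uw) (negPf wnmy).
  by case: ifP.
have m1s : {in s, m1 =1 m}.
  move=> x xs; have xW : m x != x by have /allP/(_ x xs) := sW; rewrite inE.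
  have xu : x != u by apply: contraNneq xW => ->; rewrite mu.
  have xy : x != y.
    by apply: contraTneq uV => E; rewrite /verts /= mem_cat -E xs.
  have xmy : x != m y.
    apply: contraTneq uV => E; rewrite /verts /= cat_uniq; apply/negP => /and4P[_ _ /hasP[]].
    by exists (m y); [rewrite inE eqxx | rewrite /= -E xs].
  by rewrite /m1 /rejoin (negPf xu) (negPf xmy) mu mK (negPf xu) (negPf xy).
apply: (IH m1 y o1 m1y m1w) => //; first by rewrite eq_sym.
  by rewrite (alt_arc_ext _ m1s).
have mapE : map m1 s = map m s by apply/eq_in_map.
apply/andP; split; last first.
  by apply/allP => x xs; rewrite inE m1s //; have /allP/(_ x xs) := sW; rewrite inE.
by apply: uniq_count uV _ => x; rewrite /verts mapE /= !count_cat /=; count_lia.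
Qed.

Lemma dumbbell_exposed_SD (G : sgraph) (m : G -> G) u y ys c z : opt_on [set: G] m ->
  u \in exposed m -> dumbbell m (exposed m) [::] y ys c -> m y -- u ->
  z \in u :: verts m ((y :: ys) ++ c) -> z \in SD G.
Proof.
move=> om uW [yys _ tc reg] yu; have mm := om.1.1.
case: c tc reg => [|z' c] tc reg; last exact: (stem_SD mm om uW yys yu tc).
rewrite cat0s cats0 in reg *; case/existsP: tc => w /andP[wW lw].
have [E|uw] := eqVneq u w; first by apply: (loop_SD mm om uW yys yu _ reg); rewrite E.
have [mu mw] : m u = u /\ m w = w by split; apply/exposedP.
case: (@no_augmenting _ _ u (y :: ys) w om mu mw uw _ lw reg).
by rewrite /= yys andbT /alt_arc /= sedge_sym.
Qed.

Lemma dumbbell_SD (G : sgraph) (m : G -> G) d y ys c z : opt_on [set: G] m ->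
  dumbbell m (exposed m) d y ys c -> z \in verts m (d ++ (y :: ys) ++ c) -> z \in SD G.
Proof.
move=> om; have mm := om.1.1; have [mK em] := mm; have rW := exposed_rooted mm.
case: d => [|z' d] D zV.
  have [_ /existsP[u /andP[uW yu]] _ _] := D.
  by apply: (dumbbell_exposed_SD om uW D yu); rewrite in_cons zV orbT.
case: c D zV => [|z'' c] D zV; last exact: (bridge_SD mm om D).
have D' := dumbbell_mirror rW D; have [_ /existsP[u /andP[uW yu]] _ _] := D'.
apply: (dumbbell_exposed_SD om uW D' yu); rewrite in_cons; apply/orP; right.
move: zV; rewrite mirror_cons cats0 !(mem_verts _ _ mK) !mem_cat !(mem_revmap rW) mK.
by case/orP=> /orP[]->; rewrite ?orbT.
Qed.

Theorem core_SD (G : sgraph) (m : G -> G) v : opt_on [set: G] m -> core m v -> v \in SD G.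
Proof.
move=> om [rv nv]; have mm := om.1.1; have [mK em] := mm.
set W := exposed m; have rW : rooted m W := exposed_rooted mm.
have Wm x : m x \in W -> x \in W.
  by move=> /exposedP; rewrite mK => E; apply/exposedP.
have reachW x : reach m x -> x \in W \/ reach_from m W W x.
  elim=> {x} [x mx|x y _ IH xy]; first by left; apply/exposedP.
  have [myW|myW] := boolP (m y \in W); first by left.
  right; case: IH => [xW|rx]; first by apply: reach_from_root myW xW _; rewrite mK sedge_sym.
  by apply: reach_from_arc rx _ myW; rewrite /alt_arc /= mK.
have [vW|vW] := boolP (v \in W); last first.
  have [|rfv] := reachW v rv; first by rewrite (negPf vW).
  have [/Wm|rfmv] := reachW _ (nreach_mate nv); first by rewrite (negPf vW).
  have [m' [d [y [ys [c [[m'K Wm' em'] mE D sub]]]]]] := dumbbell_through rW rfv rfmv.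
  (* The switched matching exposes the same vertices, hence is again maximum. *)
  have expE : exposed m' = W.
    apply/setP => x; have [xW|xW] := boolP (x \in W).
      by rewrite inE mE //; move: xW; rewrite inE.
    by apply/negP; rewrite inE => /eqP E; have := em' x xW; rewrite E sedge_irr.
  have om' : opt_on [set: G] m'.
    apply: opt_same om _ _; last by rewrite expE.
    apply: mate_onT; split=> // x; have [xW|xW] := boolP (x \in W); last by move=> _; apply: em'.
    by rewrite mE //; move/exposedP: xW => ->; rewrite eqxx.
  by rewrite -expE in D; apply: (dumbbell_SD om' D); apply: sub; rewrite mem_cat mem_head.
have [z rz zv] := nv; have mv : m v = v by apply/exposedP.
have [zW|rfz] := reachW z rz.
  have mz : m z = z by apply/exposedP.
  by case: (opt_edge om _ _ zv mz mv); rewrite inE.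
have zW : z \notin W := reach_from_off rfz.
(* An exposed [v] lies on the flower only if the dumbbell is attached to [v] itself. The walk is
   therefore started at [v], through its neighbour [z] and the mate of [z]. *)
have rfmz : reach_from m W [set v] (m z).
  apply: (@reach_from_root _ _ _ _ _ v); rewrite ?set11 ?mK //.
  by apply: contra zW => mzW; apply: Wm.
have [x rx [w wW xw]] := reach_from_back rW rfmz rfz erefl.
have vs : [set v] \subset W by rewrite sub1set.
have [y [ys [c [D [w0]]]]] := dumbbell_exists rW vs rx wW xw.
rewrite inE => /eqP -> yv; apply: (dumbbell_exposed_SD om vW D yv).
exact: mem_head.
Qed.

(** * Posies under graph embeddings *)

Section Image.
Variables (K : finType) (H : sgraph) (f : K -> H) (M : {set {set H}}).
Hypothesis f_inj : injective f.
Implicit Types (x y b : K) (c p q s : seq K) (E : {set {set K}}).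

Let img (e : {set K}) : {set H} := f @: e.

Let img2 x y : img [set x; y] = [set f x; f y].
Proof. by rewrite /img imsetU1 imset_set1. Qed.

Lemma seq_preimage (s : seq H) c : {subset s <= map f c} -> exists s', s = map f s'.
Proof.
elim: s => [|x s IH] sub; first by exists [::].
have /mapP[y _ ->] := sub x (mem_head _ _).
have [|s' ->] := IH; last by exists (y :: s').
by move=> z zs; apply: sub; rewrite inE zs orbT.
Qed.

(** [K] carries no graph. Blossoms and paths in the image of [f] are expressed on [K], where [f]
    enters only through the adjacency pulled back and the pairs that [M] selects, so two embeddings
    can be compared. *)
Definition next_pairs c : {set {set K}} := [set [set x; next c x] | x in c].

Lemma cycle_edges_map c : uniq c -> cycle_edges (map f c) = img @: next_pairs c.
Proof.
move=> uc; apply/setP => e; apply/imsetP/imsetP => [[z /mapP[x xc ->] ->]|[_ /imsetP[x xc ->] ->]].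
  by exists [set x; next c x]; [apply/imsetP; exists x | rewrite next_map // img2].
by exists (f x); [exact: map_f | rewrite next_map // img2].
Qed.

Lemma path_edges_map x p :
  path_edges (f x) (map f p) = map img (pairmap (fun y z => [set y; z]) x p).
Proof. by elim: p x => //= y p IH x; rewrite -IH img2. Qed.

Definition chosen E : {set {set K}} := [set e in E | img e \in M].

Lemma chosen_edges E : img @: E :&: M = img @: chosen E.
Proof.
apply/setP => e; rewrite inE; apply/andP/imsetP => [[/imsetP[e' e'E ->] eM]|[e' + ->]].
  by exists e'; rewrite // inE e'E.
by rewrite inE => /andP[e'E eM]; split=> //; apply: imset_f.
Qed.

Lemma cycle_map_f c : is_cycle (map f c) = [&& cycle (relpre f (@sedge H)) c, uniq c & 2 < size c].
Proof.
rewrite /is_cycle /ucycleb size_map map_inj_uniq // -andbA; congr (_ && _).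
by case: c => //= x c; rewrite -map_rcons path_map.
Qed.

Lemma blossom_map c : blossom M (map f c) =
  [&& [&& cycle (relpre f (@sedge H)) c, uniq c & 2 < size c], odd (size c) &
      #|chosen (next_pairs c)| == (size c)./2].
Proof.
rewrite /blossom cycle_map_f size_map; have [uc|uc] := boolP (uniq c); last by rewrite !andbF.
by rewrite cycle_edges_map // chosen_edges card_imset //; apply: imset_inj.
Qed.

Lemma base_map c b : uniq c -> base M (map f c) (f b) = (b \in c) && (b \notin cover (chosen (next_pairs c))).
Proof.
move=> uc; rewrite /base mem_map // cycle_edges_map // chosen_edges; congr (_ && ~~ _).
apply/bigcupP/bigcupP => [[_ /imsetP[e eE ->]]|[e eE be]]; last first.
  by exists (img e); [apply: imset_f | apply: imset_f].
by rewrite /img mem_imset // => be; exists e.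
Qed.

Definition colors x p : seq bool := pairmap (fun y z => img [set y; z] \in M) x p.

Lemma colorsE x p : map (fun e => e \in M) (path_edges (f x) (map f p)) = colors x p.
Proof. by rewrite path_edges_map -map_comp; elim: p x => //= y p IH x; rewrite IH. Qed.

Lemma mm_path_map x p : mm_path M (f x) (map f p) =
  [&& path (relpre f (@sedge H)) x p && uniq (x :: p), sorted addb (colors x p),
      p != [::], head (set0 \in M) (colors x p) & last (set0 \in M) (colors x p)].
Proof.
rewrite /mm_path /is_path path_map -map_cons map_inj_uniq //.
rewrite /alternating -!colorsE sorted_map; congr [&& _, _, _, _ & _].
- by case: p.
- by case: path_edges.
by rewrite -(last_map (fun e => e \in M)).
Qed.

End Image.

Section Transfer.
Variables (K : finType) (H1 H2 : sgraph) (f : K -> H1) (g : K -> H2).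
Variables (M : {set {set H1}}) (N : {set {set H2}}).
Hypotheses (f_inj : injective f) (g_inj : injective g).
Hypothesis fg_edge : forall x y, f x -- f y = g x -- g y.
Hypothesis fg_matching : forall x y, ([set f x; f y] \in M) = ([set g x; g y] \in N).
Implicit Types (x y b : K) (c p q : seq K).

Let fM x y : (f @: [set x; y] \in M) = (g @: [set x; y] \in N).
Proof. by rewrite !imsetU1 !imset_set1. Qed.

Let relE : relpre f (@sedge H1) =2 relpre g (@sedge H2).
Proof. by move=> x y; apply: fg_edge. Qed.

Let chosenE c : chosen f M (next_pairs c) = chosen g N (next_pairs c).
Proof.
by apply/setP => e; rewrite !inE; apply: andb_id2l => /imsetP[x _ ->].
Qed.

Let cycleE c : cycle (relpre f (@sedge H1)) c = cycle (relpre g (@sedge H2)) c.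
Proof. by case: c => //= x c; apply: eq_path. Qed.

Let mm_pathE x p : mm_path M (f x) (map f p) -> mm_path N (g x) (map g p).
Proof.
rewrite !mm_path_map //.
have -> : colors f M x p = colors g N x p.
  by elim: p x => //= y p IH x; rewrite IH fM.
by rewrite (eq_path relE); case: p.
Qed.

Lemma posy_transfer c1 c2 b p :
  Tposy M (map f c1) (map f c2) (f b) (map f p) ->
  Tposy N (map g c1) (map g c2) (g b) (map g p).
Proof.
case=> [[B1 b1] [B2 b2] mp inn dis].
have blossomE c : blossom M (map f c) = blossom N (map g c).
  by rewrite !blossom_map // cycleE chosenE.
have baseE c x : uniq c -> base M (map f c) (f x) = base N (map g c) (g x).
  by move=> uc; rewrite !base_map // chosenE.
have blossom_uniq c : blossom M (map f c) -> uniq c.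
  by rewrite blossom_map // => /andP[/and3P[]].
have [u1 u2] := (blossom_uniq _ B1, blossom_uniq _ B2).
rewrite last_map in b2; split.
- by rewrite -blossomE -baseE.
- by rewrite last_map -blossomE -baseE.
- exact: mm_pathE.
- have bE (H : sgraph) (h : K -> H) : behead (belast (h b) (map h p)) = map h (behead (belast b p)).
    by rewrite belast_map behead_map.
  move=> z; rewrite bE => /mapP[x xI ->]; have := inn (f x); rewrite bE map_f // => /(_ isT).
  by rewrite !mem_map.
case: dis => [dis|[y [q [mq capV capE]]]].
  left; move: dis; rewrite !disjoint_has => /hasPn dis; apply/hasPn => _ /mapP[x xc ->].
  by have := dis (f x) (map_f _ xc); rewrite /= !mem_map.
right.
(* The common path of the two blossoms lies on the first one, so it too comes from [K]. *)
have [|[|y' q'] E] := @seq_preimage _ _ f (y :: q) c1; first last.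
- case: E => Ey Eq; subst y q; exists (g y'), (map g q'); split; first exact: mm_pathE.
    move=> z; apply/andP/idP => [[/mapP[x xc ->]]|].
      rewrite mem_map // => xc2; have := capV (f x).
      by rewrite !mem_map // xc xc2 -!map_cons !mem_map // => <-.
    rewrite -map_cons => /mapP[x xq ->]; have := capV (f x).
    rewrite -map_cons !mem_map // xq; by case/andP.
  have pE (H : sgraph) (h : K -> H) : injective h ->
      [set e in path_edges (h y') (map h q')] =
      (fun e : {set K} => h @: e) @: [set e in pairmap (fun y z => [set y; z]) y' q'].
    move=> h_inj; apply/setP => e; rewrite inE path_edges_map //.
    by apply/mapP/imsetP => -[e' e'P ->]; exists e'; rewrite ?inE // in e'P *.
  have cE (H : sgraph) (h : K -> H) : injective h ->
      cycle_edges (map h c1) :&: cycle_edges (map h c2) =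
      (fun e : {set K} => h @: e) @: (next_pairs c1 :&: next_pairs c2).
    move=> h_inj; rewrite !cycle_edges_map // imsetI // => ? ? _ _.
    exact: (imset_inj h_inj).
  move: capE; rewrite !cE // !pE //.
  by move/(imset_inj (imset_inj f_inj)) => ->.
- by [].
by move=> z zq; have := capV z; rewrite zq => /andP[].
Qed.

End Transfer.

(** * Matchings of G and of its reduced form *)

(* The elements of 'I_3 add up to 3. *)
Definition third (i j : 'I_3) : 'I_3 := inord (3 - (i + j)).

Lemma thirdP (i j : 'I_3) : i != j ->
  [/\ third i j != i, third i j != j & third i (third i j) = j].
Proof.
move: i j => [[|[|[|i]]] hi] [[|[|[|j]]] hj] // _; rewrite /third;
by split; rewrite -?val_eqE /= ?inordK //; apply: val_inj; rewrite /= !inordK.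
Qed.

Lemma third_cases (i j k : 'I_3) : i != j -> [\/ k = i, k = j | k = third i j].
Proof.
move: i j k => [[|[|[|i]]] hi] [[|[|[|j]]] hj] [[|[|[|k]]] hk] // _; rewrite /third;
first [ by constructor 1; apply: val_inj | by constructor 2; apply: val_inj
      | by constructor 3; apply: val_inj; rewrite /= inordK ].
Qed.

Section Transport.
Variables (G : sgraph) (t : comp_index G -> 'I_3).
Local Notation R := (reduced t).
Implicit Types (u v w : kept G) (X Y : comp_index G) (x y : G) (i j : 'I_3).
Implicit Types (m : G -> G) (n : R -> R).

Definition old u : R := inl u.
Definition new X i : R := inr (X, i).

Lemma old_inj : injective old. Proof. by move=> u v []. Qed.

Lemma new_inj X Y i j : new X i = new Y j -> X = Y /\ i = j.
Proof. by case. Qed.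

Lemma kept_off u X : val u \notin val X.
Proof.
by apply: contra (valP u) => uX; apply/bigcupP; exists (val X) => //; apply: valP.
Qed.

Lemma vertex_cases x : (exists u, x = val u) \/ exists X, x \in val X.
Proof.
have [/bigcupP[X XC xX]|xK] := boolP (x \in cover (ntcomp G)).
  by right; exists (exist _ X XC : comp_index G).
by left; exists (exist _ x xK : kept G).
Qed.

Lemma red_cases (a : R) : (exists u, a = old u) \/ exists X i, a = new X i.
Proof. by case: a => [u|[X i]]; [left; exists u | right; exists X, i]. Qed.

Lemma part_inj X Y x : x \in val X -> x \in val Y -> X = Y.
Proof. by move=> xX xY; apply: val_inj; apply: comp_inj (valP X) (valP Y) xX xY. Qed.

Lemma A_kept x : x \in GE_A G -> exists u, x = val u.
Proof.
move=> xA; case: (vertex_cases x) => // -[X xX].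
by rewrite (negPf (comp_offA (valP X) xX)) in xA.
Qed.

Lemma attached_edge u X x : x \in val X -> x -- val u -> new X (t X) -- old u.
Proof.
move=> xX xu; rewrite /= /attached /= eqxx (comp_boundary (valP X) xX xu) ?kept_off //=.
by apply/existsP; exists x; rewrite xX sedge_sym.
Qed.

Lemma edge_attached u X i : new X i -- old u -> i = t X /\ exists2 x, x \in val X & val u -- x.
Proof.
by move=> /and3P[/eqP /= it _ /existsP[x /andP[xX ux]]]; split=> //; exists x.
Qed.

Lemma edge_new X Y i j : (new X i -- new Y j) = (X == Y) && (i != j).
Proof. by []. Qed.

Lemma edge_old u v : (old u -- old v) = (val u -- val v).
Proof. by []. Qed.

(** Nothing is said about the pairs inside components and triangles. Reachability of kept vertices
    is insensitive to them as soon as all components and triangles are reached. *)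
Definition corresponding m n : Prop :=
  [/\ is_mate m, is_mate n,
     forall u v, m (val u) = val v <-> n (old u) = old v &
     forall u X, m (val u) \in val X <-> n (old u) = new X (t X)].

Lemma corresponding_reach m n : corresponding m n ->
  (forall X x, x \in val X -> reach m x) -> (forall X i, reach n (new X i)) ->
  forall u, reach m (val u) <-> reach n (old u).
Proof.
move=> [[mK em] [nK en] Ekept Ecomp] rX rT.
have fwd x : reach m x -> forall u, val u = x -> reach n (old u).
  elim=> {x} [x mx u ux|x y rx IH xy u uy].
    by apply: reach_exposed; apply/Ekept; rewrite ux.
  case: (vertex_cases y) => [[v yv]|[Y yY]].
    have nv : n (old v) = old u by apply/Ekept; rewrite -yv.
    rewrite -nv; case: (vertex_cases x) => [[w xw]|[X xX]].
      by apply: reach_arc (IH w _) _; rewrite // edge_old -xw -yv.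
    by apply: reach_arc (rT X (t X)) _; apply: (attached_edge xX); rewrite -yv.
  have nu : n (old u) = new Y (t Y) by apply/Ecomp; rewrite uy mK.
  (* Another vertex of the triangle is reached and adjacent to [new Y (t Y)], hence the mate of the
     latter, [old u], is reached. *)
  rewrite -[old u]nK nu; have [i ni] : exists i, i != t Y.
    by case: (t Y) => [[|k] hk]; [exists ord_max | exists ord0].
  by apply: reach_arc (rT Y i) _; rewrite edge_new eqxx.
have bwd a : reach n a -> forall u, old u = a -> reach m (val u).
  elim=> {a} [a na u ua|a b ra IH ab u ub].
    by apply: reach_exposed; apply/Ekept; rewrite ua.
  case: (red_cases b) => [[v bv]|[Y [j bY]]].
    have mv : m (val v) = val u by apply/Ekept; rewrite -bv.
    rewrite -mv; case: (red_cases a) => [[w aw]|[X [i aX]]].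
      by apply: reach_arc (IH w _) _; rewrite // -edge_old -aw -bv.
    rewrite aX bv in ab; have [_ [x xX vx]] := edge_attached ab.
    by apply: reach_arc (rX X x xX) _; rewrite sedge_sym.
  have nu : n (old u) = new Y j by rewrite ub nK.
  have jt : j = t Y.
    have : old u -- n (old u) by apply: en; rewrite nu.
    by rewrite nu sedge_sym => /edge_attached[].
  rewrite jt in nu; have muY := (Ecomp u Y).2 nu.
  have [y yY my] := comp_nbr (valP Y) muY.
  by rewrite -[val u]mK; apply: reach_arc (rX Y y yY) _; rewrite sedge_sym.
by move=> u; split; [move/fwd; apply | move/bwd; apply].
Qed.

Lemma corresponding_core m n : corresponding m n ->
  (forall X x, x \in val X -> reach m x) -> (forall X i, reach n (new X i)) ->
  forall u, core m (val u) <-> core n (old u).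
Proof.
move=> mn rX rT u; have E := corresponding_reach mn rX rT.
split=> -[/E ru [x rx xu]]; split=> //.
  case: (vertex_cases x) => [[v xv]|[X xX]].
    by exists (old v); [apply/E; rewrite -xv | rewrite edge_old -xv].
  by exists (new X (t X)); [apply: rT | apply: attached_edge xX xu].
case: (red_cases x) => [[v xv]|[X [i xX]]].
  by exists (val v); [apply/E; rewrite -xv | rewrite -edge_old -xv].
rewrite xX in xu; have [_ [y yX uy]] := edge_attached xu.
by exists y; [apply: rX yX | rewrite sedge_sym].
Qed.

Lemma mate_to_reduced m : opt_on [set: G] m -> exists n, [/\ corresponding m n,
  #|exposed n| <= #|exposed m| &
  forall X, (exists2 d, d \in val X & m d = d) -> n (new X (t X)) = new X (t X)].
Proof.
move=> om; have mm := om.1.1; have [mK em] := mm.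
have /choice[d dP] : forall X, exists d, [/\ d \in val X, m d = d \/ m d \in GE_A G &
    forall x, x \in val X -> x <> d -> m x \in val X /\ m x <> x].
  by move=> X; apply: comp_opt om (valP X).
have only_d x X : x \in val X -> m x \notin val X \/ m x = x -> x = d X.
  move=> xX H; apply: contrapT => xd; have [_ _ /(_ x xX xd)[mX nx]] := dP X.
  by case: H => //; rewrite mX.
(* The attaching vertex [new X (t X)] takes over the role of [d X], the only vertex of [X] not
   matched inside [X]; the other two vertices of the triangle are matched with each other. *)
pose n (a : R) : R := match (a : red_vertex G) with
  | inl u => if insub (m (val u)) is Some v then old v else
             if [pick X : comp_index G | m (val u) \in val X] is Some X then new X (t X) else a
  | inr (X, i) => if i == t X then
                    (if insub (m (d X)) is Some v then old v else a)
                  else new X (third (t X) i)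
  end.
have n_kept u v : m (val u) = val v -> n (old u) = old v.
  by move=> E; rewrite /n /= E valK.
have n_comp u X : m (val u) \in val X -> n (old u) = new X (t X).
  move=> mX; rewrite /n /= insubF; last first.
    by apply/negbTE; rewrite negbK; apply/bigcupP; exists (val X); rewrite // (valP X).
  by case: pickP => [Y mY|/(_ X)]; [rewrite (part_inj mX mY) | rewrite mX].
have n_base X v : m (d X) = val v -> n (new X (t X)) = old v.
  by move=> E; rewrite /n /= eqxx E valK.
have n_fixed X : m (d X) = d X -> n (new X (t X)) = new X (t X).
  move=> E; rewrite /n /= eqxx E insubF //.
  have [dX _ _] := dP X.
  by apply/negbTE; rewrite negbK; apply/bigcupP; exists (val X); rewrite // (valP X).
have n_third X i : i != t X -> n (new X i) = new X (third (t X) i).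
  by move=> /negPf it; rewrite /n /= it.
have m_cases u : (exists v, m (val u) = val v) \/ exists2 X : comp_index G, m (val u) \in val X & d X = m (val u).
  case: (vertex_cases (m (val u))) => [[v E]|[X mX]]; first by left; exists v.
  right; exists X => //; apply/esym/only_d => //; left; rewrite mK; exact: kept_off.
have d_cases X : m (d X) = d X \/ exists v, m (d X) = val v.
  by have [_ [E|/A_kept]] := dP X; [left | right].
have n_mate : is_mate n.
  split=> a; case: (red_cases a) => [[u ->]|[X [i ->]]].
  - case: (m_cases u) => [[v E]|[X mX E]].
      by rewrite (n_kept _ _ E); apply: n_kept; rewrite -E mK.
    by rewrite (n_comp _ _ mX); apply: n_base; rewrite E mK.
  - have [->|it] := eqVneq i (t X); last first.
      have it' : t X != i by rewrite eq_sym.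
      by have [t1 _ tt] := thirdP it'; rewrite n_third // n_third // tt.
    case: (d_cases X) => [E|[v E]]; first by rewrite !n_fixed.
    by rewrite (n_base _ _ E); apply: n_comp; rewrite -E mK; have [] := dP X.
  - case: (m_cases u) => [[v E]|[X mX E]].
      rewrite (n_kept _ _ E) edge_old -E => nu; apply: em.
      apply: contraNneq nu => mu; apply/eqP; congr old; apply: val_inj.
      by rewrite -E mu.
    rewrite (n_comp _ _ mX) => _; rewrite sedge_sym; apply: (attached_edge mX).
    rewrite sedge_sym; apply: em; apply: contraTneq mX => ->; exact: kept_off.
  have [->|it] := eqVneq i (t X); last first.
    rewrite n_third // edge_new eqxx => _ /=.
    have it' : t X != i by rewrite eq_sym.
    by have [_ t2 _] := thirdP it'; rewrite eq_sym.
  case: (d_cases X) => [E|[v E]]; first by rewrite n_fixed // eqxx.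
  rewrite (n_base _ _ E) => _; have [dX _ _] := dP X.
  apply: (attached_edge dX); rewrite -E; apply: em.
  by rewrite E; apply: contraTneq dX => <-; apply: kept_off.
have old_new u X i : old u <> new X i by [].
exists n; split.
- split=> // [u v|u X].
    split; first exact: n_kept.
    case: (m_cases u) => [[w E]|[X mX _]]; last by rewrite (n_comp _ _ mX).
    by rewrite (n_kept _ _ E) E => /old_inj ->.
  split; first exact: n_comp.
  case: (m_cases u) => [[w E]|[Y mY _]]; first by rewrite (n_kept _ _ E).
  by rewrite (n_comp _ _ mY) => /new_inj[<-].
(* The only triangle vertex that [n] can expose is the attaching one, and then [m] exposes [d X];
   this injects the exposed vertices of [n] into those of [m]. *)
- pose phi (a : R) : G := match (a : red_vertex G) with inl u => val u | inr (X, _) => d X end.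
  have dK X u : d X <> val u.
    by have [dX _ _] := dP X => E; have := kept_off u X; rewrite -E dX.
  have fix_new X i : n (new X i) = new X i -> i = t X /\ m (d X) = d X.
    have [->|it] := eqVneq i (t X).
      by case: (d_cases X) => [//|[v E]]; rewrite (n_base _ _ E).
    rewrite n_third // => /new_inj[_ E].
    have it' : t X != i by rewrite eq_sym.
    by have [_ t2 _] := thirdP it'; rewrite E eqxx in t2.
  rewrite -(card_in_imset (f := phi) (D := exposed n)); last first.
    move=> a b; rewrite !inE => /eqP na /eqP nb.
    case: (red_cases a) na => [[u ->]|[X [i ->]]] na; case: (red_cases b) nb => [[v ->]|[Y [j ->]]] nb.
    - by move/val_inj => ->.
    - by move=> /esym/dK.
    - by move/dK.
    move=> E; have XY : X = Y.
      by have [dX _ _] := dP X; have [dY _ _] := dP Y; apply: part_inj dX _; rewrite [d X]E.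
    by have [-> _] := fix_new _ _ na; have [-> _] := fix_new _ _ nb; rewrite XY.
  apply: subset_leq_card; apply/subsetP => x /imsetP[a]; rewrite !inE => /eqP na ->.
  case: (red_cases a) na => [[u ->]|[X [i ->]]] na /=; last first.
    by have [_ ->] := fix_new _ _ na.
  case: (m_cases u) => [[v E]|[X mX _]]; last by rewrite (n_comp _ _ mX) in na.
  by rewrite (n_kept _ _ E) in na; rewrite E (old_inj na).
move=> X [x xX mx]; apply: n_fixed; by rewrite -(only_d x X xX (or_intror mx)).
Qed.

Lemma mate_from_reduced n : is_mate n -> exists2 m, corresponding m n &
  #|exposed m| <= #|exposed n|.
Proof.
move=> nn; have [nK en] := nn.
have n_new X i : (exists j, n (new X i) = new X j) \/ i = t X /\ exists u, n (new X i) = old u.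
  have [E|nX] := eqVneq (n (new X i)) (new X i); first by left; exists i.
  have := en _ nX; case: (red_cases (n (new X i))) => [[u E]|[Y [j E]]]; rewrite E.
    by move=> /edge_attached[it _]; right; split=> //; exists u.
  by rewrite edge_new => /andP[/eqP <- _]; left; exists j.
(* [q X] is a neighbour in [X] of the kept vertex matched with [new X (t X)], and arbitrary if there
   is no such vertex. The rest of [X] is then covered by factor-criticality. *)
have /choice[q qP] : forall X, exists q, q \in val X /\
    forall u, n (new X (t X)) = old u -> val u -- q.
  move=> X; case: (n_new X (t X)) => [[j E]|[_ [u E]]].
    have [q qX] : exists q, q \in val X.
      by apply/set0Pn; have := valP X; rewrite inE -card_gt0 => /andP[_ /ltnW].
    by exists q; split=> // u; rewrite E.
  have : new X (t X) -- n (new X (t X)) by apply: en; rewrite E.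
  rewrite E => /edge_attached[_ [q qX uq]]; exists q; split=> // v /old_inj vu.
  by rewrite -vu.
have qX X := (qP X).1.
have /choice[s sP] : forall X, exists s : G -> G, [/\ mate_on (val X) s, s (q X) = q X &
    forall x, x \in val X -> x <> q X -> s x <> x].
  by move=> X; apply: comp_factor_critical (valP X) (qX X).
have sX X x : x \in val X -> s X x \in val X.
  move=> xX; have [[[sK es] so] _ _] := sP X; apply: contraTT xX => sxX.
  by have := so _ sxX; rewrite sK => ->.
have n_old u : (exists v, n (old u) = old v) \/ exists X, n (old u) = new X (t X).
  case: (red_cases (n (old u))) => [[v E]|[X [i E]]]; first by left; exists v.
  right; exists X; have : old u -- n (old u) by apply: en; rewrite E.
  by rewrite E sedge_sym => /edge_attached[<- _].
pose m x := if insub x is Some u then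
     (match (n (old u) : red_vertex G) with inl v => val v | inr (X, _) => q X end)
   else if [pick X : comp_index G | x \in val X] is Some X then
     (if x == q X then
        (match (n (new X (t X)) : red_vertex G) with inl v => val v | inr _ => x end)
      else s X x)
   else x.
have m_kept u v : n (old u) = old v -> m (val u) = val v.
  by move=> E; rewrite /m valK E.
have m_comp u X i : n (old u) = new X i -> m (val u) = q X.
  by move=> E; rewrite /m valK E.
have m_X x X : x \in val X -> m x = if x == q X then
        (match (n (new X (t X)) : red_vertex G) with inl v => val v | inr _ => x end)
      else s X x.
  move=> xX; rewrite /m insubF; last first.
    by apply/negbTE; rewrite negbK; apply/bigcupP; exists (val X); rewrite // (valP X).
  by case: pickP => [Y xY|/(_ X)]; [rewrite (part_inj xX xY) | rewrite xX].
have m_base X v : n (new X (t X)) = old v -> m (q X) = val v.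
  by move=> E; rewrite (m_X _ X) // eqxx E.
have m_base' X j : n (new X (t X)) = new X j -> m (q X) = q X.
  by move=> E; rewrite (m_X _ X) // eqxx E.
have m_in X x : x \in val X -> x != q X -> m x = s X x.
  by move=> xX /negPf xq; rewrite (m_X _ X) // xq.
have q_cases X : (exists v, n (new X (t X)) = old v) \/ exists j, n (new X (t X)) = new X j.
  by case: (n_new X (t X)) => [|[_]]; [right | left].
have mm : is_mate m.
  split=> x.
    case: (vertex_cases x) => [[u ->]|[X xX]].
      case: (n_old u) => [[v E]|[X E]].
        by rewrite (m_kept _ _ E); apply: m_kept; rewrite -E nK.
      by rewrite (m_comp _ _ _ E); apply: m_base; rewrite -E nK.
    have [->|xq] := eqVneq x (q X); last first.
      have [[[sK es] so] sq _] := sP X.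
      rewrite (m_in X) // (m_in X) ?sK ?sX //.
      by apply: contraNneq xq => E; rewrite -[x]sK E sq.
    case: (q_cases X) => [[v E]|[j E]]; last by rewrite !(m_base' _ _ E).
    by rewrite (m_base _ _ E); apply: (m_comp _ _ (t X)); rewrite -E nK.
  case: (vertex_cases x) => [[u ->]|[X xX]].
    case: (n_old u) => [[v E]|[X E]].
      rewrite (m_kept _ _ E) -edge_old -E => nu; apply: en.
      by apply: contraNneq nu => Eu; rewrite Eu in E; rewrite (old_inj E).
    by rewrite (m_comp _ _ _ E) => _; apply: (qP X).2; rewrite -E nK.
  have [->|xq] := eqVneq x (q X); last first.
    by have [[[sK es] so] sq _] := sP X; rewrite (m_in X) //; apply: es.
  case: (q_cases X) => [[v E]|[j E]]; last by rewrite (m_base' _ _ E) eqxx.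
  by rewrite (m_base _ _ E) sedge_sym => _; apply: (qP X).2.
(* If the attaching vertex is not matched with a kept one, [n] acts within the triangle, whose odd
   order leaves a vertex exposed; it pays for the exposed [q X]. *)
have fixT X j : n (new X (t X)) = new X j -> exists i, n (new X i) = new X i.
  have [->|jt] := eqVneq j (t X); first by exists (t X).
  have tj : t X != j by rewrite eq_sym.
  have [k1 k2 _] := thirdP tj; set k := third (t X) j in k1 k2 * => E.
  exists k; case: (n_new X k) => [[l El]|[kt]]; last by rewrite kt eqxx in k1.
  have El' : n (new X l) = new X k by rewrite -El nK.
  case: (third_cases l tj) => lE; rewrite lE in El El'; rewrite ?El //.
    by move: El'; rewrite E => /new_inj[_ jk]; rewrite jk eqxx in k2.
  have : n (new X j) = new X (t X) by rewrite -E nK.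
  by rewrite El' => /new_inj[_ kt]; rewrite kt eqxx in k1.
exists m.
  split=> // [u v|u X].
    split; last exact: m_kept.
    case: (n_old u) => [[w E]|[X E]].
      by rewrite (m_kept _ _ E) E => /val_inj ->.
    by rewrite (m_comp _ _ _ E) => E'; have := kept_off v X; rewrite -E' qX.
  split; last by move=> E; rewrite (m_comp _ _ _ E).
  case: (n_old u) => [[w E]|[Y E]].
    by rewrite (m_kept _ _ E) (negPf (kept_off w X)).
  by rewrite (m_comp _ _ _ E) => qY; rewrite E (part_inj (qX Y) qY).
have fix_q x X : x \in val X -> m x = x -> x = q X /\ exists i, n (new X i) = new X i.
  move=> xX; have [->|xq] := eqVneq x (q X); last first.
    by rewrite (m_in X) // => E; have [_ _ H] := sP X; case: (H x xX _ E); apply/eqP.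
  case: (q_cases X) => [[v E]|[j E]]; last by split=> //; apply: fixT E.
  by rewrite (m_base _ _ E) => E'; have := kept_off v X; rewrite E' qX.
pose e X := odflt (t X) [pick i | n (new X i) == new X i].
have eP X : (exists i, n (new X i) = new X i) -> n (new X (e X)) = new X (e X).
  rewrite /e => -[i ni]; case: pickP => [k /eqP //|/(_ i)]; by rewrite ni eqxx.
pose psi x : option R := if insub x is Some u then Some (old u) else
  if [pick X : comp_index G | x \in val X] is Some X then Some (new X (e X)) else None.
have psi_kept u : psi (val u) = Some (old u) by rewrite /psi valK.
have psi_X x X : x \in val X -> psi x = Some (new X (e X)).
  move=> xX; rewrite /psi insubF; last first.
    by apply/negbTE; rewrite negbK; apply/bigcupP; exists (val X); rewrite // (valP X).
  by case: pickP => [Y xY|/(_ X)]; [rewrite (part_inj xX xY) | rewrite xX].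
rewrite -(card_in_imset (f := psi) (D := exposed m)); last first.
  move=> x y; rewrite !inE => /eqP mx /eqP my.
  case: (vertex_cases x) mx => [[u ->]|[X xX]] mx; case: (vertex_cases y) my => [[v ->]|[Y yY]] my.
  - by rewrite !psi_kept => -[->].
  - by rewrite psi_kept (psi_X _ _ yY).
  - by rewrite psi_kept (psi_X _ _ xX).
  rewrite (psi_X _ _ xX) (psi_X _ _ yY) => -[XY _].
  by have [-> _] := fix_q _ _ xX mx; have [-> _] := fix_q _ _ yY my; rewrite XY.
rewrite -(card_imset (exposed n) (@Some_inj _)); apply: subset_leq_card.
apply/subsetP => z /imsetP[x]; rewrite inE => /eqP mx ->.
case: (vertex_cases x) mx => [[u ->]|[X xX]] mx.
  rewrite psi_kept; apply: imset_f; rewrite inE.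
  case: (n_old u) => [[v E]|[X E]].
    by move: mx; rewrite (m_kept _ _ E) E => /val_inj ->.
  by have := kept_off u X; rewrite -mx (m_comp _ _ _ E) qX.
rewrite (psi_X _ _ xX); apply: imset_f; rewrite inE; apply/eqP; apply: eP.
exact: (fix_q _ _ xX mx).2.
Qed.

End Transport.

(** * Maximum matchings and the set [SD] on both sides *)

Section Comparison.
Variables (G : sgraph) (t : comp_index G -> 'I_3).
Local Notation R := (reduced t).
Implicit Types (u v w : kept G) (X Y : comp_index G) (x y : G) (i j : 'I_3).
Implicit Types (m : G -> G) (n : R -> R).

Lemma opt_to_reduced m : opt_on [set: G] m -> exists n, [/\ corresponding m n,
  opt_on [set: R] n &
  forall X, (exists2 d, d \in val X & m d = d) -> n (new t X (t X)) = new t X (t X)].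
Proof.
move=> om; have [n [mn le nX]] := mate_to_reduced t om; exists n; split=> //.
have [_ nn _ _] := mn; split; first exact: mate_onT.
move=> n' [nn' _]; have [m' [mm' _ _ _] le'] := mate_from_reduced nn'.
by apply: leq_trans le (leq_trans _ le'); apply: om.2; apply: mate_onT.
Qed.

(** Optimality of [m] follows by comparing [n] with the image in the reduced form of some optimal
    matching of [G]. *)
Lemma opt_from_reduced n : opt_on [set: R] n -> exists2 m, corresponding m n &
  opt_on [set: G] m.
Proof.
move=> on; have [m mn le] := mate_from_reduced on.1.1; exists m => //.
have [mm _ _ _] := mn; split; first exact: mate_onT.
move=> m' mm'; have [m0 om0] := opt_exists G.
have [n0 [mn0 on0 _]] := opt_to_reduced om0.
have [n1 [mn1 le1 _]] := mate_to_reduced t om0.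
apply: leq_trans le (leq_trans _ (leq_trans le1 (om0.2 _ mm'))).
by have [_ nn1 _ _] := mn1; apply: on.2; apply: mate_onT.
Qed.

Lemma comp_reach m X x : opt_on [set: G] m -> x \in val X -> reach m x.
Proof.
by move=> om xX; apply: GE_D_reach om _; apply: (subsetP (comp_sub (valP X))).
Qed.

(** An optimal matching of [G] missing a vertex of [X] yields one of the reduced form missing
    [new X (t X)], so that vertex lies in D and is reached. From it the rest of the triangle is
    reached whatever [n] does there. *)
Lemma triangle_reach n X i : opt_on [set: R] n -> reach n (new t X i).
Proof.
move=> on; have [nK en] := on.1.1.
have rt : reach n (new t X (t X)).
  apply: GE_D_reach on _; apply/GE_DP; split; first by rewrite inE.
  have [d dX] : exists d, d \in val X.
    by apply/set0Pn; have := valP X; rewrite inE -card_gt0 => /andP[_ /ltnW].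
  have /GE_DP[_ [m om md]] := subsetP (comp_sub (valP X)) d dX.
  have [n' [_ on' fixn']] := opt_to_reduced om.
  by exists n' => //; apply: fixn'; exists d.
have [->//|it] := eqVneq i (t X); have ti : t X != i by rewrite eq_sym.
have [k1 k2 _] := thirdP ti; set k := third (t X) i in k1 k2.
have n_new j : j != t X -> exists l, n (new t X j) = new t X l.
  move=> jt; have [E|nj] := eqVneq (n (new t X j)) (new t X j); first by exists j.
  have := en _ nj; case: (red_cases (n (new t X j))) => [[u E]|[Y [l E]]]; rewrite E.
    by move=> /edge_attached[E' _]; rewrite E' eqxx in jt.
  by rewrite edge_new => /andP[/eqP <- _]; exists l.
have [l El] := n_new i it; case: (third_cases l ti) => lE; rewrite lE in El.
(* Here [i] is matched with the attaching vertex, so the third vertex [k] is exposed, and its edge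
   to the attaching vertex reaches [i]. *)
- have [l' El'] := n_new k k1; case: (third_cases l' ti) => lE'; rewrite lE' -/k in El'.
  + have := congr1 n El'; rewrite nK -El nK => /new_inj[_ E]; by rewrite E eqxx in k2.
  + have := congr1 n El'; rewrite nK El => /new_inj[_ E]; by rewrite E eqxx in k1.
  have : reach n (n (new t X (t X))).
    by apply: reach_arc (reach_exposed El') _; rewrite edge_new eqxx.
  by rewrite -El nK.
- exact: reach_exposed.
have : reach n (n (new t X k)) by apply: reach_arc rt _; rewrite edge_new eqxx eq_sym.
by rewrite -El nK.
Qed.

Lemma comp_SD X x : x \in val X -> x \in SD G.
Proof.
move=> xX; have [m om] := opt_exists G; have [y yX xy] := comp_nbr (valP X) xX.
apply: (core_SD om); split; first exact: (comp_reach om xX).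
by exists y; [exact: (comp_reach om yX) | rewrite sedge_sym].
Qed.

Lemma triangle_SD X i : new t X i \in SD R.
Proof.
have [n on] := opt_exists R; apply: (core_SD on); split; first exact: triangle_reach.
have [j ji] : exists j, j != i.
  by case: i => [[|k] hk]; [exists ord_max | exists ord0].
by exists (new t X j); [apply: triangle_reach | rewrite edge_new eqxx].
Qed.

Lemma mem_SDP (H : sgraph) (v : H) : v \in SD H -> exists M : {set {set H}},
  max_matching M /\ (core (mate_of M) v \/ exists c1 c2 b p,
    [/\ Tposy M c1 c2 b p, v \in c1 ++ c2 ++ b :: p &
        forall z, z \in c1 ++ c2 ++ b :: p -> ~ touched (mate_of M) z]).
Proof.
rewrite inE => /asboolP[M [maxM F]]; exists M; split=> //.
have /andP[mM _] := maxM.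
case: F => [[c [b [s [F vF]]]]|[c1 [c2 [b [p [P vP]]]]]]; first by left; apply: flower_core F vF.
have [[z [zP tz]]|nt] := pselect (exists z, z \in c1 ++ c2 ++ b :: p /\ touched (mate_of M) z).
  by left; apply: (posy_core mM P zP tz).
right; exists c1, c2, b, p; split=> // z zP tz; by apply: nt; exists z.
Qed.

(** Stated for two arbitrary embeddings of [K], so that it serves both from [G] to the reduced form
    and back. *)
Lemma untouched_transfer (K : finType) (H1 H2 : sgraph) (f : K -> H1) (g : K -> H2)
    (M : {set {set H1}}) (m2 : H2 -> H2) (c1 c2 : seq H1) (b : H1) (p : seq H1) (v : K) :
  injective f -> injective g -> (forall x y : K, f x -- f y = g x -- g y) ->
  matching M -> opt_on [set: H2] m2 ->
  (forall x y : K, mate_of M (f x) = f y <-> m2 (g x) = g y) ->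
  Tposy M c1 c2 b p -> (forall z, z \in c1 ++ c2 ++ b :: p -> exists x : K, z = f x) ->
  f v \in c1 ++ c2 ++ b :: p -> g v \in SD H2.
Proof.
move=> fI gI fgE mM om2 fgM P im vP.
have pre (s : seq H1) : {subset s <= c1 ++ c2 ++ b :: p} -> exists s', s = map f s'.
  move=> sub; apply: (@seq_preimage _ _ f s (enum K)) => z /sub/im[x ->].
  by rewrite map_f // mem_enum.
have [c1' E1] : exists s', c1 = map f s' by apply: pre => z zc; rewrite mem_cat zc.
have [c2' E2] : exists s', c2 = map f s' by apply: pre => z zc; rewrite !mem_cat zc orbT.
have [[//|b' p'] [Eb Ep]] : exists s', b :: p = map f s'.
  by apply: pre => z zc; rewrite !mem_cat zc !orbT.
subst c1 c2 b p; have mm2 := om2.1.1.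
have P2 : Tposy (edge_set m2) (map g c1') (map g c2') (g b') (map g p').
  apply: posy_transfer P => // x y; have [<-|nxy] := eqVneq x y.
    rewrite edge_set_in // eqxx andbF; apply/negbTE/negP => /(matching_edge mM).
    by rewrite sedge_irr.
  rewrite mate_ofP ?inj_eq // edge_set_in // inj_eq // nxy andbT.
  by apply/eqP/eqP => /fgM.
rewrite inE; apply/asboolP; exists (edge_set m2); split; first exact: opt_max.
right; exists (map g c1'), (map g c2'), (g b'), (map g p'); split=> //.
by move: vP; rewrite -!map_cons -!map_cat !mem_map.
Qed.

Lemma kept_SD u : (val u \in SD G) = (old t u \in SD R).
Proof.
apply/idP/idP => /mem_SDP[M [maxM]]; have om := max_opt maxM; have /andP[mM _] := maxM.
  have [n [mn on _]] := opt_to_reduced om.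
  have rX X x : x \in val X -> reach (mate_of M) x by apply: comp_reach.
  have rT X i : reach n (new t X i) by apply: triangle_reach.
  case=> [/(corresponding_core mn rX rT)/(core_SD on)//|[c1 [c2 [b [p [P uP nt]]]]]].
  have [_ _ E _] := mn.
  apply: (untouched_transfer (f := val : kept G -> G) (g := old t) _ _ _ mM on E P) uP => //.
  - exact: val_inj.
  - exact: old_inj.
  move=> z zP; case: (vertex_cases z) => // -[X zX].
  by case: (nt z zP); left; apply: rX zX.
have [m mn om'] := opt_from_reduced om.
have rX X x : x \in val X -> reach m x by apply: comp_reach.
have rT X i : reach (mate_of M) (new t X i) by apply: triangle_reach.
case=> [/(corresponding_core mn rX rT)/(core_SD om')//|[c1 [c2 [b [p [P uP nt]]]]]].
have [_ _ E _] := mn.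
apply: (untouched_transfer (f := old t) (g := val : kept G -> G) _ _ _ mM om' _ P) uP => //.
- exact: old_inj.
- exact: val_inj.
- by move=> x y; rewrite E.
move=> z zP; case: (red_cases z) => // -[X [i zX]].
by case: (nt z zP); left; rewrite zX.
Qed.

End Comparison.

Theorem theorem4p7 (G : sgraph) (t : comp_index G -> 'I_3) :
  [set old_vertex v | v in KE G] = [set new_vertex a | a in KE (reduced t)].
Proof.
apply/setP => z; apply/imsetP/imsetP => -[a aKE ->]; rewrite inE in aKE.
  case: (vertex_cases a) => [[u aE]|[X aX]]; last by rewrite (comp_SD aX) in aKE.
  by exists (old t u); [rewrite inE -kept_SD -aE | rewrite aE].
case: (red_cases a) => [[u aE]|[X [i aE]]]; last by rewrite aE triangle_SD in aKE.
by exists (val u); [rewrite inE (kept_SD t) -aE | rewrite aE].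
Qed.
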